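(* Consider the bilevel problem, the stochastic gradient estimator $\bar\nabla f(x,y;\bar\xi)$ and the SUSTAIN algorithm described in the context, under Assumptions 1–4 of the context, and suppose in addition that $\ell$ is $\mu_f$-strongly convex ($\mu_f>0$). Fix any $T\ge1$, set the number of samples in the gradient estimator to $K=\frac{L_g}{2\mu_g}\log\big(\frac{C_{g_{xy}}^2C_{f_y}^2T}{\mu_g^2}\big)$, let $$\hat c_\beta=\frac{8L_y^2+8L^2+2\mu_f}{\mu_g},$$ and choose constant parameters $\alpha_t\equiv\alpha>0$ with $$\alpha\le\min\bigg\{\frac1{\mu_f+1},\ \frac1{2\mu_g\hat c_\beta},\ \frac{\mu_g}{\hat c_\beta L_g^2},\ \frac1{8L_K^2+L_f},\ \frac{L^2+2L_y^2}{4L_K^2L_g^2\hat c_\beta^2}\bigg\},$$ $\eta_t^f\equiv(\mu_f+1)\alpha$ (with $\eta_0^f=1$ at initialization, as prescribed by the algorithm), $\beta_t\equiv\hat c_\beta\alpha$ and $\eta_t^g\equiv1$. Then the iterates generated by the SUSTAIN algorithm satisfy, for any $t\ge1$, $$\mathbb{E}[\ell(x_t)-\ell^\ast]\le(1-\mu_f\alpha)^t\bar\Delta_0+\frac1{\mu_f}\Big\{\frac2T+\big[(2\hat c_\beta^2+8\hat c_\beta^2L_K^2)\sigma_g^2+2(\mu_f+1)^2\sigma_f^2\big]\alpha\Big\},$$ where $\bar\Delta_0=\ell(x_0)-\ell^\ast+\sigma_f^2+\|y_0-y^\ast(x_0)\|^2$.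
   Context: Problem. $\min_{x\in\mathbb{R}^{d_{\sf up}}}\ell(x)=f(x,y^\ast(x))$ with $f(x,y)=\mathbb{E}_{\xi\sim\pi_f}[f(x,y;\xi)]$, $y^\ast(x)=\arg\min_{y\in\mathbb{R}^{d_{\sf lo}}}g(x,y)$, $g(x,y)=\mathbb{E}_{\zeta\sim\pi_g}[g(x,y;\zeta)]$, and $\ell^\ast=\min_x\ell(x)$. Norms are Euclidean for vectors and the induced operator norm for matrices. Sampled gradients and Hessians are unbiased for the corresponding derivatives of $f,g$. A function $\phi$ is $\mu$-strongly convex if $\phi-\frac\mu2\|\cdot\|^2$ is convex. Assumption 1 (upper level). $\nabla_xf$ and $\nabla_yf$ are Lipschitz in $(x,y)$ with constants $L_{f_x},L_{f_y}\ge0$; $\|\nabla_yf(x,y)\|\le C_{f_y}$ for all $(x,y)$. Assumption 2 (lower level). $g$ is twice continuously differentiable; $\nabla_yg$ is $L_g$-Lipschitz in $(x,y)$; $g(x,\cdot)$ is $\mu_g$-strongly convex with $\mu_g>0$ for every $x$; $\nabla^2_{xy}g$ and $\nabla^2_{yy}g$ are Lipschitz in $(x,y)$ with constants $L_{g_{xy}},L_{g_{yy}}\ge0$; $\|\nabla^2_{xy}g(x,y)\|\le C_{g_{xy}}$ for all $(x,y)$, with $C_{g_{xy}}>0$. Assumption 3. Assumptions 1 and 2 hold, with the same constants, for $f(\cdot,\cdot;\xi)$ and $g(\cdot,\cdot;\zeta)$ for all $\xi\in\mathrm{supp}(\pi_f)$, $\zeta\in\mathrm{supp}(\pi_g)$.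 Gradient surrogate: $\bar\nabla f(x,y)=\nabla_xf(x,y)-\nabla^2_{xy}g(x,y)[\nabla^2_{yy}g(x,y)]^{-1}\nabla_yf(x,y)$. Stochastic estimator with parameter $K\in\mathbb{N}$, $K\ge1$ (a prescribed non-integer value of $K$ is understood as rounded up to a positive integer): draw independent $\bar\xi=\{\xi,\zeta^{(0)},\dots,\zeta^{(K)},\mathsf{k}\}$ with $\xi\sim\pi_f$, $\zeta^{(i)}\sim\pi_g$, $\mathsf{k}$ uniform on $\{0,\dots,K-1\}$, and set $$\bar\nabla f(x,y;\bar\xi)=\nabla_xf(x,y;\xi)-\frac{K}{L_g}\nabla^2_{xy}g(x,y;\zeta^{(0)})\prod_{i=1}^{\mathsf{k}}\Big(I-\frac{\nabla^2_{yy}g(x,y;\zeta^{(i)})}{L_g}\Big)\nabla_yf(x,y;\xi),$$ where the empty product is $I$. Its bias is $B(x,y)=\mathbb{E}_{\bar\xi}[\bar\nabla f(x,y;\bar\xi)]-\bar\nabla f(x,y)$. Assumption 4. There are $\sigma_f,\sigma_g\ge0$ such that for all $(x,y)$: $\mathbb{E}_{\bar\xi}\|\bar\nabla f(x,y;\bar\xi)-\bar\nabla f(x,y)-B(x,y)\|^2\le\sigma_f^2$ and $\mathbb{E}_\zeta\|\nabla_yg(x,y;\zeta)-\nabla_yg(x,y)\|^2\le\sigma_g^2$. SUSTAIN algorithm. Input step sizes $\alpha_t,\beta_t>0$ and momentum parameters $\eta_t^f,\eta_t^g\in[0,1]$ with $\eta_0^f=\eta_0^g=1$; initial points $x_0,y_0$;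 $x_{-1}=y_{-1}=h^f_{-1}=h^g_{-1}=0$. For $t=0,1,2,\dots$, with fresh independent samples $\zeta_t\sim\pi_g$ and $\bar\xi_t$ (distributed as $\bar\xi$), $$h^g_t=\eta^g_t\nabla_yg(x_t,y_t;\zeta_t)+(1-\eta^g_t)\big(h^g_{t-1}+\nabla_yg(x_t,y_t;\zeta_t)-\nabla_yg(x_{t-1},y_{t-1};\zeta_t)\big),\quad y_{t+1}=y_t-\beta_th^g_t,$$ $$h^f_t=\eta^f_t\bar\nabla f(x_t,y_t;\bar\xi_t)+(1-\eta^f_t)\big(h^f_{t-1}+\bar\nabla f(x_t,y_t;\bar\xi_t)-\bar\nabla f(x_{t-1},y_{t-1};\bar\xi_t)\big),\quad x_{t+1}=x_t-\alpha_th^f_t.$$ Constants. $L=L_{f_x}+\frac{L_{f_y}C_{g_{xy}}}{\mu_g}+C_{f_y}\big(\frac{L_{g_{xy}}}{\mu_g}+\frac{L_{g_{yy}}C_{g_{xy}}}{\mu_g^2}\big)$, $L_f=L+\frac{LC_{g_{xy}}}{\mu_g}$, $L_y=\frac{C_{g_{xy}}}{\mu_g}$, $$L_K^2=2L_{f_x}^2+\frac{6C_{g_{xy}}^2L_{f_y}^2K}{2\mu_gL_g-\mu_g^2}+\frac{6C_{f_y}^2L_{g_{xy}}^2K}{2\mu_gL_g-\mu_g^2}+\frac{6C_{g_{xy}}^2C_{f_y}^2L_{g_{yy}}^2K^3}{(L_g-\mu_g)^2(2\mu_gL_g-\mu_g^2)}$$ (all constants by which one divides, including $L_g-\mu_g$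 and $L_K$, are implicitly positive). *)

(* Defs.v *)
From HB Require Import structures.
From mathcomp Require Import all_boot all_order all_algebra finmap.
From mathcomp Require Import all_classical all_reals all_analysis.

Set Implicit Arguments.
Unset Strict Implicit.
Unset Printing Implicit Defensive.

Import Order.TTheory GRing.Theory Num.Theory.
Import numFieldNormedType.Exports.

Local Open Scope classical_set_scope.
Local Open Scope ring_scope.

(* The norm [`|_|] that MathComp-Analysis puts on matrices is the max norm;
   it is only used here for the topology. *)
Definition enorm {R : realType} {n : nat} (v : 'cV[R]_n) : R :=
  Num.sqrt (\sum_i v i 0 ^+ 2).

Definition enorm_pair {R : realType} {n m : nat} (x : 'cV[R]_n) (y : 'cV[R]_m)
  : R := Num.sqrt (enorm x ^+ 2 + enorm y ^+ 2).

Definition opnorm {R : realType} {n m : nat} (A : 'M[R]_(n, m)) : R :=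
  sup [set enorm (A *m v) | v in [set v : 'cV[R]_m | enorm v <= 1]].

Definition lipschitz_xy {R : realType} {n m : nat} {W : zmodType}
    (N : W -> R) (L : R) (h : 'cV[R]_n -> 'cV[R]_m -> W) : Prop :=
  forall x y x' y',
    N (h x y - h x' y') <= L * enorm_pair (x - x') (y - y').

Definition grad_x {R : realType} {n m : nat}
    (f : 'cV[R]_n -> 'cV[R]_m -> R) (x : 'cV[R]_n) (y : 'cV[R]_m) : 'cV[R]_n :=
  \col_i 'D_(delta_mx i 0) (f ^~ y) x.

Definition grad_y {R : realType} {n m : nat}
    (f : 'cV[R]_n -> 'cV[R]_m -> R) (x : 'cV[R]_n) (y : 'cV[R]_m) : 'cV[R]_m :=
  \col_j 'D_(delta_mx j 0) (f x) y.

Definition hess_xy {R : realType} {n m : nat}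
    (g : 'cV[R]_n -> 'cV[R]_m -> R) (x : 'cV[R]_n) (y : 'cV[R]_m)
  : 'M[R]_(n, m) :=
  \matrix_(i, j) 'D_(delta_mx i 0) (fun x' => grad_y g x' y j 0) x.

Definition hess_yy {R : realType} {n m : nat}
    (g : 'cV[R]_n -> 'cV[R]_m -> R) (x : 'cV[R]_n) (y : 'cV[R]_m)
  : 'M[R]_m :=
  \matrix_(i, j) 'D_(delta_mx i 0) (fun y' => grad_y g x y' j 0) y.

Definition differentiable_xy {R : realType} {n m : nat}
    (f : 'cV[R]_n -> 'cV[R]_m -> R) : Prop :=
  forall z : 'cV[R]_n * 'cV[R]_m, differentiable (fun w => f w.1 w.2) z.

Definition twice_continuously_differentiable {R : realType}
    {V : normedModType R} (F : V -> R) : Prop :=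
  [/\ forall z, differentiable F z,
      forall v z, differentiable ('D_v F) z &
      forall v w, continuous ('D_w ('D_v F))].

Definition strongly_convex {R : realType} {n : nat} (mu : R)
    (phi : 'cV[R]_n -> R) : Prop :=
  convex_function [set: convex_lmodType 'cV[R]_n]
    (fun x : 'cV[R]_n => phi x - mu / 2 * enorm x ^+ 2).

Record constants (R : realType) := Constants {
  L_fx : R; L_fy : R; C_fy : R;
  L_g : R; mu_g : R; L_gxy : R; L_gyy : R; C_gxy : R
}.

Record upper_level {R : realType} {n m : nat} (c : constants R)
    (f : 'cV[R]_n -> 'cV[R]_m -> R) : Prop := {
  upper_diff : differentiable_xy f;
  upper_lip_x : lipschitz_xy enorm (L_fx c) (grad_x f);
  upper_lip_y : lipschitz_xy enorm (L_fy c) (grad_y f);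
  upper_bound : forall x y, enorm (grad_y f x y) <= C_fy c
}.

Record lower_level {R : realType} {n m : nat} (c : constants R)
    (g : 'cV[R]_n -> 'cV[R]_m -> R) : Prop := {
  lower_C2 : twice_continuously_differentiable
               (fun w : 'cV[R]_n * 'cV[R]_m => g w.1 w.2);
  lower_lip : lipschitz_xy enorm (L_g c) (grad_y g);
  lower_convex : forall x, strongly_convex (mu_g c) (g x);
  lower_lip_xy : lipschitz_xy opnorm (L_gxy c) (hess_xy g);
  lower_lip_yy : lipschitz_xy opnorm (L_gyy c) (hess_yy g);
  lower_bound : forall x y, opnorm (hess_xy g x y) <= C_gxy c
}.

Definition L_bar {R : realType} (c : constants R) : R :=
  L_fx c + L_fy c * C_gxy c / mu_g c
  + C_fy c * (L_gxy c / mu_g c + L_gyy c * C_gxy c / mu_g c ^+ 2).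

Definition L_f {R : realType} (c : constants R) : R :=
  L_bar c + L_bar c * C_gxy c / mu_g c.

Definition L_y {R : realType} (c : constants R) : R := C_gxy c / mu_g c.

Definition L_K_sq {R : realType} (c : constants R) (K : nat) : R :=
  let q := 2 * mu_g c * L_g c - mu_g c ^+ 2 in
  2 * L_fx c ^+ 2
  + 6 * C_gxy c ^+ 2 * L_fy c ^+ 2 * K%:R / q
  + 6 * C_fy c ^+ 2 * L_gxy c ^+ 2 * K%:R / q
  + 6 * C_gxy c ^+ 2 * C_fy c ^+ 2 * L_gyy c ^+ 2 * K%:R ^+ 3
    / ((L_g c - mu_g c) ^+ 2 * q).

(* The prescribed real value, rounded up to a positive integer.  For
   [C_fy c = 0] the logarithm is -oo on paper and [ln 0 = 0] here; the result
   is 1 under both readings. *)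
Definition sample_number {R : realType} (c : constants R) (T : nat) : nat :=
  absz (Num.max (1 : int) (Num.ceil (L_g c / (2 * mu_g c)
    * ln (C_gxy c ^+ 2 * C_fy c ^+ 2 * T%:R / mu_g c ^+ 2)))).

Definition chat_beta {R : realType} (c : constants R) (mu_f : R) : R :=
  (8 * L_y c ^+ 2 + 8 * L_bar c ^+ 2 + 2 * mu_f) / mu_g c.

Definition mean_fun {R : realType} {d} {S : measurableType d}
    (pi : probability S R) {n m : nat} (F : S -> 'cV[R]_n -> 'cV[R]_m -> R)
    (x : 'cV[R]_n) (y : 'cV[R]_m) : R :=
  fine ('E_pi[fun s => F s x y])%E.

Definition mean_mx {R : realType} {d} {S : measurableType d}
    (pi : probability S R) {p q : nat} (A : S -> 'M[R]_(p, q)) : 'M[R]_(p, q) :=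
  \matrix_(i, j) fine ('E_pi[fun s => A s i j])%E.

Definition integrable_mx {R : realType} {d} {S : measurableType d}
    (pi : probability S R) {p q : nat} (A : S -> 'M[R]_(p, q)) : Prop :=
  forall i j, pi.-integrable [set: S] (fun s => (A s i j)%:E).

Definition unbiased {R : realType} {d} {S : measurableType d}
    (pi : probability S R) {n m p q : nat}
    (A : S -> 'cV[R]_n -> 'cV[R]_m -> 'M[R]_(p, q))
    (B : 'cV[R]_n -> 'cV[R]_m -> 'M[R]_(p, q)) : Prop :=
  forall x y, integrable_mx pi (fun s => A s x y) /\
              mean_mx pi (fun s => A s x y) = B x y.

Definition mutually_independent {R : realType} {d} {Omega : measurableType d}
    (P : probability Omega R) {I : choiceType} (F : I -> set_system Omega)
  : Prop :=
  forall (J : {fset I}) (E : I -> set Omega),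
    (forall i, i \in J -> F i (E i)) ->
    P (\bigcap_(i in [set` J]) E i) = (\prod_(i <- J) P (E i))%E.

Section Surrogate.
Context {R : realType} {n m : nat}.
Implicit Types (x : 'cV[R]_n) (y : 'cV[R]_m).

Definition surrogate (f g : 'cV[R]_n -> 'cV[R]_m -> R) x y : 'cV[R]_n :=
  grad_x f x y - hess_xy g x y *m invmx (hess_yy g x y) *m grad_y f x y.

Context {Xi Z : Type}.

(* [s] is a value of the random element (xi, (zeta^(0), ..., zeta^(K)), k);
   [inord i] is [i] for the indices in use, since k < K almost surely. *)
Definition estimator (F : Xi -> 'cV[R]_n -> 'cV[R]_m -> R)
    (G : Z -> 'cV[R]_n -> 'cV[R]_m -> R) (Lg : R) (K : nat)
    (s : (Xi * K.+1.-tuple Z * nat)%type) x y : 'cV[R]_n :=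
  let xi := s.1.1 in
  let zeta i := tnth s.1.2 (inord i) in
  let k := s.2 in
  grad_x (F xi) x y
  - (K%:R / Lg) *:
    (hess_xy (G (zeta 0%N)) x y
     *m (\big[mulmx/1%:M]_(1 <= i < k.+1)
           (1%:M - Lg^-1 *: hess_yy (G (zeta i)) x y))
     *m grad_y (F xi) x y).

End Surrogate.

(* [pibar] is the joint law of independent xi ~ pi_f, zeta^(i) ~ pi_g
   (i = 0, ..., K) and k uniform on {0, ..., K - 1}. *)
Definition draw_law {R : realType} {d1 d2} {Xi : measurableType d1}
    {Z : measurableType d2} (pi_f : probability Xi R) (pi_g : probability Z R)
    (K : nat) (pibar : probability (Xi * K.+1.-tuple Z * nat)%type R) : Prop :=
  forall (A : set Xi) (B : 'I_K.+1 -> set Z) (j : nat),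
    measurable A -> (forall i, measurable (B i)) ->
    pibar ((A `*` [set v | forall i, B i (tnth v i)]) `*` [set j])
    = (pi_f A * (\prod_(i < K.+1) pi_g (B i))
       * (if (j < K)%N then K%:R^-1 else 0)%:E)%E.

Definition bias {R : realType} {d} {S : measurableType d}
    (pibar : probability S R) {n m : nat}
    (est : S -> 'cV[R]_n -> 'cV[R]_m -> 'cV[R]_n)
    (target : 'cV[R]_n -> 'cV[R]_m -> 'cV[R]_n)
    (x : 'cV[R]_n) (y : 'cV[R]_m) : 'cV[R]_n :=
  mean_mx pibar (fun s => est s x y) - target x y.

(* The state before iteration t: (x_t, y_t), (x_{t-1}, y_{t-1}),
   h^f_{t-1} and h^g_{t-1}. *)
Record sustain_state (R : realType) (n m : nat) := SustainState {
  cur_x : 'cV[R]_n; cur_y : 'cV[R]_m;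
  prev_x : 'cV[R]_n; prev_y : 'cV[R]_m;
  prev_hf : 'cV[R]_n; prev_hg : 'cV[R]_m
}.

Section Sustain.
Context {R : realType} {n m : nat} {Z S : Type}.
Variable gradg : Z -> 'cV[R]_n -> 'cV[R]_m -> 'cV[R]_m.
Variable est : S -> 'cV[R]_n -> 'cV[R]_m -> 'cV[R]_n.
Variables alpha beta eta_f eta_g : nat -> R.
Variables (x0 : 'cV[R]_n) (y0 : 'cV[R]_m).

Definition sustain_step (t : nat) (z : Z) (s : S) (st : sustain_state R n m)
  : sustain_state R n m :=
  let: SustainState x y x' y' hf' hg' := st in
  let hg := eta_g t *: gradg z x y
            + (1 - eta_g t) *: (hg' + gradg z x y - gradg z x' y') in
  let hf := eta_f t *: est s x y
            + (1 - eta_f t) *: (hf' + est s x y - est s x' y') in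
  SustainState (x - alpha t *: hf) (y - beta t *: hg) x y hf hg.

Fixpoint sustain (zs : nat -> Z) (ss : nat -> S) (t : nat)
  : sustain_state R n m :=
  if t is t'.+1 then sustain_step t' (zs t') (ss t') (sustain zs ss t')
  else SustainState x0 y0 0 0 0 0.

End Sustain.

(* Main.v *)
Require Import Defs.
From HB Require Import structures.
From mathcomp Require Import all_boot all_order all_algebra finmap.
From mathcomp Require Import all_classical all_reals all_analysis.
From mathcomp Require Import measurable_realfun.
From mathcomp Require Import ring lra.

Set Implicit Arguments.
Unset Strict Implicit.
Unset Printing Implicit Defensive.

Import Order.TTheory GRing.Theory Num.Theory.
Import numFieldNormedType.Exports.

Local Open Scope classical_set_scope.
Local Open Scope ring_scope.

(** The proof follows a Lyapunov function,

      V = (ell x - ell_star) + |h - m (x, y)| ^ 2 + |y - ystar x| ^ 2,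

    where [m] is the mean of the stochastic estimator and [h] the recursive
    direction of the upper level.  One iteration multiplies its expectation by
    at most [1 - mu_f alpha] and adds [alpha] times the bracket of the final
    bound; summing the geometric series divides that bracket by [mu_f].

    The deterministic part rests on three facts.  The optimal value [ell] has
    gradient [surrogate f g x (ystar x)] ([is_derive_ell]); the derivative of
    [ystar] is avoided by subtracting from [f] the multiple of [grad_y g], which
    vanishes on the graph of [ystar], that cancels the [y] derivative.  The
    surrogate is Lipschitz ([surrogate_lip]), which yields the descent inequality
    ([ell_descent]) and controls the error made by replacing [ystar x] by [y].
    Strong convexity of [ell] bounds the optimality gap by the squared gradient
    ([ell_gradient_dominated]), and that of [g] makes the lower gradient step a
    contraction ([gradient_step_contracts]).

    The estimator truncates the Neumann series of the inverse Hessian at a random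
    place.  Peeling off its independent factors one by one
    ([mean_random_product]) shows that its mean contains the partial sum with
    [K] terms, so its bias is a geometric tail and the prescribed [K] makes the
    squared bias at most [1 / T] ([bias_sq_le]).  Since every factor
    contracts, the estimator is Lipschitz for each draw, and averaging the
    constant over the uniform index gives [L_K_sq] in mean square
    ([estimator_ms_lip]).

    In one iteration the fresh samples are integrated out with the past frozen
    ([freezing_pi_system]): first the draw of the estimator, where the momentum
    update contracts the error of the direction ([frozen_momentum]), then the
    sample of the lower level ([frozen_step]).  Young's inequality with a
    parameter of order [alpha] splits the error of the lower level from the drift
    of [ystar]; the negative multiple of [|h| ^ 2] in the descent inequality pays
    for that drift and for the displacement in the momentum error.  All
    integrands are nonnegative, so the integrals make sense before any moment
    is known to be finite.

    Sampled functions are regular only almost surely, and the iterates need not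
    be measurable on the exceptional set.  The argument is therefore run for
    modified samples that are regular everywhere.  The two runs agree off a null
    set, and the integral of a nonnegative function, measurable or not, does not
    see null sets ([ge0_le_integral_off_null]). *)

(** * Euclidean geometry of column vectors *)

Section Euclid.
Context {R : realType}.

Definition dot {n : nat} (u v : 'cV[R]_n) : R := \sum_i u i 0 * v i 0.

Section Vectors.
Context {n : nat}.
Implicit Types (u v w : 'cV[R]_n) (a : R).

Lemma dotC u v : dot u v = dot v u.
Proof. by apply: eq_bigr => i _; rewrite mulrC. Qed.

Lemma dotDl u v w : dot (u + v) w = dot u w + dot v w.
Proof. by rewrite -big_split; apply: eq_bigr => i _; rewrite mxE mulrDl. Qed.

Lemma dotDr u v w : dot u (v + w) = dot u v + dot u w.
Proof. by rewrite dotC dotDl !(dotC u). Qed.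

Lemma dotZl a u v : dot (a *: u) v = a * dot u v.
Proof. by rewrite mulr_sumr; apply: eq_bigr => i _; rewrite mxE mulrA. Qed.

Lemma dotZr a u v : dot u (a *: v) = a * dot u v.
Proof. by rewrite dotC dotZl dotC. Qed.

Lemma dotNl u v : dot (- u) v = - dot u v.
Proof. by rewrite -scaleN1r dotZl mulN1r. Qed.

Lemma dotNr u v : dot u (- v) = - dot u v.
Proof. by rewrite dotC dotNl dotC. Qed.

Lemma dotBl u v w : dot (u - v) w = dot u w - dot v w.
Proof. by rewrite dotDl dotNl. Qed.

Lemma dotBr u v w : dot u (v - w) = dot u v - dot u w.
Proof. by rewrite dotDr dotNr. Qed.

Lemma dot0l u : dot 0 u = 0.
Proof. by rewrite -(scale0r 0) dotZl mul0r. Qed.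

Lemma dot0r u : dot u 0 = 0.
Proof. by rewrite dotC dot0l. Qed.

Lemma dotv_ge0 u : 0 <= dot u u.
Proof. by apply: sumr_ge0 => i _; rewrite -expr2 sqr_ge0. Qed.

Lemma enorm_ge0 u : 0 <= enorm u.
Proof. exact: sqrtr_ge0. Qed.

Lemma enorm2 u : enorm u ^+ 2 = dot u u.
Proof.
rewrite sqr_sqrtr; last by apply: sumr_ge0 => i _; rewrite sqr_ge0.
by apply: eq_bigr => i _; rewrite expr2.
Qed.

Lemma enormE u : enorm u = Num.sqrt (dot u u).
Proof. by rewrite -enorm2 sqrtr_sqr ger0_norm ?enorm_ge0. Qed.

Lemma enormZ a u : enorm (a *: u) = `|a| * enorm u.
Proof.
by rewrite !enormE dotZl dotZr mulrA -expr2 sqrtrM ?sqr_ge0// sqrtr_sqr.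
Qed.

Lemma enormN u : enorm (- u) = enorm u.
Proof. by rewrite -scaleN1r enormZ normrN1 mul1r. Qed.

Lemma enormB u v : enorm (u - v) = enorm (v - u).
Proof. by rewrite -enormN opprB. Qed.

Lemma enorm0 : enorm (0 : 'cV[R]_n) = 0.
Proof. by rewrite enormE dot0l sqrtr0. Qed.

Lemma entry_le_enorm u i : `|u i 0| <= enorm u.
Proof.
rewrite enormE -sqrtr_sqr ler_sqrt ?dotv_ge0// /dot (bigD1 i)//= -expr2.
by rewrite lerDl sumr_ge0// => j _; rewrite -expr2 sqr_ge0.
Qed.

Lemma enorm_eq0 u : enorm u = 0 -> u = 0.
Proof.
move=> u0; apply/matrixP => i j; rewrite ord1 mxE.
by apply/eqP; rewrite -normr_le0 -u0 entry_le_enorm.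
Qed.

Lemma le_sqrt_mul (a k D : R) : 0 <= k -> 0 <= D ->
  0 <= a -> a ^+ 2 <= k * D ^+ 2 -> a <= Num.sqrt k * D.
Proof.
move=> k0 D0 a0; rewrite -[in X in _ -> X](ler_pXn2r (n := 2)) ?nnegrE ?mulr_ge0 ?sqrtr_ge0//.
by rewrite exprMn sqr_sqrtr.
Qed.

Lemma enorm_sqD u v :
  enorm (u + v) ^+ 2 = enorm u ^+ 2 + 2 * dot u v + enorm v ^+ 2.
Proof. by rewrite !enorm2 dotDl !dotDr (dotC v u); ring. Qed.

Lemma enorm_sqB u v :
  enorm (u - v) ^+ 2 = enorm u ^+ 2 - 2 * dot u v + enorm v ^+ 2.
Proof. by rewrite enorm_sqD enormN dotNr mulrN. Qed.

(** The discriminant of the nonnegative quadratic form [|u + a v| ^ 2]. *)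
Lemma dot_le u v : dot u v <= enorm u * enorm v.
Proof.
have [u0|u0] := eqVneq (enorm u) 0.
  by rewrite u0 (enorm_eq0 u0) dot0l mul0r.
have [v0|v0] := eqVneq (enorm v) 0.
  by rewrite v0 (enorm_eq0 v0) dot0r mulr0.
have ugt : 0 < enorm u by rewrite lt_def u0 enorm_ge0.
have vgt : 0 < enorm v by rewrite lt_def v0 enorm_ge0.
have := sqr_ge0 (enorm (enorm v *: u - enorm u *: v)).
rewrite enorm_sqB !enormZ dotZl dotZr !gtr0_norm// => h.
have {}h : 0 <= (enorm u * enorm v) * (enorm u * enorm v - dot u v) by lra.
by move: h; rewrite pmulr_rge0 ?mulr_gt0// subr_ge0.
Qed.

Lemma dot_abs_le u v : `|dot u v| <= enorm u * enorm v.
Proof. by rewrite ler_norml dot_le lerNl -dotNl -(enormN u) dot_le. Qed.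

Lemma enormD_le u v : enorm (u + v) <= enorm u + enorm v.
Proof.
rewrite -(ler_pXn2r (n := 2)) ?nnegrE ?addr_ge0 ?enorm_ge0//.
by rewrite enorm_sqD sqrrD -mulr_natl; have := dot_le u v; lra.
Qed.

Lemma enormB_le u v : enorm (u - v) <= enorm u + enorm v.
Proof. by rewrite (le_trans (enormD_le _ _))// enormN. Qed.

(** Young's inequality in the form used to split a perturbed square. *)
Lemma enorm_sqD_young u v a : 0 < a ->
  enorm (u + v) ^+ 2 <= (1 + a) * enorm u ^+ 2 + (1 + a^-1) * enorm v ^+ 2.
Proof.
move=> a0; rewrite enorm_sqD; set b := a^-1.
have ab : a * b = 1 by rewrite mulfV// gt_eqF.
have b0 : 0 < b by rewrite invr_gt0.
have h := mulr_ge0 (ltW b0) (sqr_ge0 (enorm (a *: u - v))).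
rewrite enorm_sqB enormZ gtr0_norm// dotZl exprMn in h.
have e : b * (a ^+ 2 * enorm u ^+ 2 - 2 * (a * dot u v) + enorm v ^+ 2)
  = (a * b) * a * enorm u ^+ 2 - 2 * (a * b) * dot u v + b * enorm v ^+ 2.
  by ring.
by rewrite e ab in h; lra.
Qed.

Lemma enorm_sqD2 u v :
  enorm (u + v) ^+ 2 <= 2 * enorm u ^+ 2 + 2 * enorm v ^+ 2.
Proof. by have := @enorm_sqD_young u v 1 ltr01; rewrite invr1; lra. Qed.

(** Bounding a vector by testing it replaces the operator norm of a transpose
    and lets scalar mean value arguments bound vector increments. *)
Lemma enorm_dual u (k : R) :
  0 <= k -> (forall v, dot u v <= k * enorm v) -> enorm u <= k.
Proof.
move=> k0 /(_ u); rewrite -enorm2.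
have [->//|u0] := eqVneq (enorm u) 0.
by rewrite expr2 ler_pM2r// lt_def u0 enorm_ge0.
Qed.

Lemma dot_delta u i : dot u (delta_mx i 0) = u i 0.
Proof.
rewrite /dot (bigD1 i)//= mxE !eqxx mulr1 big1 ?addr0// => j /negPf ji.
by rewrite mxE ji mulr0.
Qed.

Lemma enorm_delta i : enorm (delta_mx i 0 : 'cV[R]_n) = 1.
Proof. by rewrite enormE dot_delta mxE !eqxx sqrtr1. Qed.

End Vectors.

Lemma dot_mulmx n m (A : 'M[R]_(n, m)) (v : 'cV[R]_m) (u : 'cV[R]_n) :
  dot (A *m v) u = dot v (A^T *m u).
Proof.
rewrite /dot.
transitivity (\sum_i \sum_j A i j * v j 0 * u i 0).
  by apply: eq_bigr => i _; rewrite mxE mulr_suml.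
rewrite exchange_big; apply: eq_bigr => j _.
rewrite mxE mulr_sumr; apply: eq_bigr => i _; rewrite mxE; ring.
Qed.

(** ** Operator norm *)

Section Opnorm.
Context {n m : nat}.
Implicit Type A : 'M[R]_(n, m).

(** The crude bound by the sum of all entries makes the supremum that defines
    the operator norm a supremum of a bounded set. *)
Lemma opnorm_set_ub A :
  has_ubound [set enorm (A *m v) | v in [set v : 'cV[R]_m | enorm v <= 1]].
Proof.
exists (\sum_i \sum_j `|A i j|) => _ [v /= v1 <-].
apply: enorm_dual => [|u]; first by do 2 apply: sumr_ge0 => ? _.
rewrite mulr_suml; apply: ler_sum => i _; rewrite mxE !mulr_suml.
apply: ler_sum => j _; apply: (le_trans (ler_norm _)); rewrite !normrM -mulrA.
rewrite ler_wpM2l// -[leRHS]mul1r ler_pM ?entry_le_enorm//.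
by rewrite (le_trans (entry_le_enorm _ _)).
Qed.

Lemma enorm_mulmx A v : enorm (A *m v) <= opnorm A * enorm v.
Proof.
have [v0|v0] := eqVneq (enorm v) 0.
  by rewrite v0 mulr0 (enorm_eq0 v0) mulmx0 enorm0.
have vgt : 0 < enorm v by rewrite lt_def v0 enorm_ge0.
have : enorm (A *m ((enorm v)^-1 *: v)) <= opnorm A.
  apply: (ub_le_sup (opnorm_set_ub A)); exists ((enorm v)^-1 *: v) => //=.
  by rewrite enormZ gtr0_norm ?invr_gt0// mulVf.
by rewrite -scalemxAr enormZ gtr0_norm ?invr_gt0// ler_pdivrMl// mulrC.
Qed.

Lemma enorm_mulmx_le A v k : opnorm A <= k -> enorm (A *m v) <= k * enorm v.
Proof.
by move=> Ak; rewrite (le_trans (enorm_mulmx _ _))// ler_wpM2r ?enorm_ge0.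
Qed.

Lemma entry_le_opnorm A i j : `|A i j| <= opnorm A.
Proof.
have := enorm_mulmx A (delta_mx j 0); rewrite enorm_delta mulr1.
apply: le_trans; apply: le_trans (entry_le_enorm _ i).
rewrite mxE (bigD1 j)//= mxE !eqxx mulr1 big1 ?addr0// => l /negPf lj.
by rewrite mxE lj mulr0.
Qed.

End Opnorm.

(** Polarization: for a symmetric matrix the quadratic form controls the
    operator norm. *)
Lemma sym_quad_bound n (A : 'M[R]_n) (r : R) : A^T = A -> 0 <= r ->
  (forall v, `|dot v (A *m v)| <= r * enorm v ^+ 2) ->
  forall v, enorm (A *m v) <= r * enorm v.
Proof.
move=> symA r0 Aq.
have pol u v : dot u (A *m v) * 4 <= 2 * r * (enorm u ^+ 2 + enorm v ^+ 2).
  have := ler_normlW (Aq (u + v)); have := Aq (u - v).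
  rewrite ler_norml => /andP[+ _].
  rewrite (enorm_sqB u v) (enorm_sqD u v) !mulmxDr mulmxN !(dotDl, dotDr, dotNl, dotNr).
  have -> : dot v (A *m u) = dot u (A *m v) by rewrite dotC dot_mulmx symA.
  by lra.
move=> v; have [v0|v0] := eqVneq (enorm v) 0.
  by rewrite v0 mulr0 (enorm_eq0 v0) mulmx0 enorm0.
have vgt : 0 < enorm v by rewrite lt_def v0 enorm_ge0.
have [w0|w0] := eqVneq (enorm (A *m v)) 0.
  by rewrite w0 mulr_ge0 ?enorm_ge0.
have wgt : 0 < enorm (A *m v) by rewrite lt_def w0 enorm_ge0.
(* the test vector is A v rescaled to the length of v *)
have := pol ((enorm v / enorm (A *m v)) *: (A *m v)) v.
rewrite dotZl enormZ -enorm2 gtr0_norm ?divr_gt0//.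
rewrite divfK// expr2 mulrA divfK// => h.
have {}h : enorm v * (r * enorm v - enorm (A *m v)) >= 0 by lra.
by move: h; rewrite pmulr_rge0// subr_ge0.
Qed.

(** ** The product norm *)

Lemma enorm_pair_ge0 n m (x : 'cV[R]_n) (y : 'cV[R]_m) : 0 <= enorm_pair x y.
Proof. exact: sqrtr_ge0. Qed.

Lemma enorm_pair2 n m (x : 'cV[R]_n) (y : 'cV[R]_m) :
  enorm_pair x y ^+ 2 = enorm x ^+ 2 + enorm y ^+ 2.
Proof. by rewrite sqr_sqrtr// addr_ge0// sqr_ge0. Qed.

Lemma enorm_pair_le n m (x : 'cV[R]_n) (y : 'cV[R]_m) :
  enorm_pair x y <= enorm x + enorm y.
Proof.
rewrite -(ler_pXn2r (n := 2)) ?nnegrE ?addr_ge0 ?enorm_ge0 ?enorm_pair_ge0//.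
rewrite enorm_pair2 sqrrD -mulr_natl.
by have := mulr_ge0 (enorm_ge0 x) (enorm_ge0 y); lra.
Qed.

Lemma enorm_pair0l n m (y : 'cV[R]_m) : enorm_pair (0 : 'cV[R]_n) y = enorm y.
Proof.
by rewrite /enorm_pair enorm0 expr0n add0r sqrtr_sqr ger0_norm ?enorm_ge0.
Qed.

End Euclid.

(** * Differential calculus along segments *)

Section Calculus.
Context {R : realType}.

Section Lines.
Context {V : normedModType R}.
Implicit Types (Psi : V -> R) (z v w : V).

Lemma is_derive_line Psi z v (s : R) : differentiable Psi (z + s *: v) ->
  is_derive s 1 (fun r : R => Psi (z + r *: v)) ('D_v Psi (z + s *: v)).
Proof.
move=> dPsi.
have dl : is_diff s (fun r : R => z + r *: v) (fun r : R => r *: v).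
  have := is_diffD (is_diff_cst z s) (is_diff_scalel s v).
  by rewrite add0r.
have dc : differentiable (Psi \o (fun r : R => z + r *: v)) s.
  by apply: differentiable_comp => //; exact: ex_diff.
split; first exact/diff_derivable.
by rewrite deriveE// diff_comp//= diff_val scale1r deriveE.
Qed.

Lemma mean_value Psi z v : (forall z, differentiable Psi z) ->
  exists2 s : R, 0 <= s <= 1 & Psi (z + v) - Psi z = 'D_v Psi (z + s *: v).
Proof.
move=> dPsi; have dl (s : R) := is_derive_line (dPsi (z + s *: v)).
have ct : {within `[0, 1], continuous (fun r : R => Psi (z + r *: v))}.
  apply/continuous_subspaceT => s; apply/differentiable_continuous.
  by apply/derivable1_diffP; have [] := dl s.
have [s s01] := MVT ltr01 (fun s _ => dl s) ct.
rewrite scale1r scale0r addr0 subr0 mulr1 => ->.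
by exists s => //; move: s01; rewrite in_itv/= => /andP[? ?]; rewrite !ltW.
Qed.

(** The form for second differences: the intermediate point stays within a
    fixed multiple of the step [h]. *)
Lemma mean_value_scale Psi z v (h : R) : (forall z, differentiable Psi z) ->
  exists2 s : R, 0 <= s <= 1 &
    Psi (z + h *: v) - Psi z = h * 'D_v Psi (z + (s * h) *: v).
Proof.
move=> dPsi; have [s s01 ->] := mean_value z (h *: v) dPsi.
by exists s => //; rewrite !deriveE// linearZ scalerA.
Qed.

Lemma close_trans (a b p e : R) :
  `|p - a| <= e / 2 -> `|p - b| <= e / 2 -> `|a - b| <= e.
Proof.
move=> h1 h2; rewrite -(subrKA p) (le_trans (ler_normD _ _))// (distrC a).
by rewrite (splitr e) lerD.
Qed.

(** Both mixed derivatives at [z] are limits of the same second difference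
    quotients, which two applications of the mean value theorem turn into
    values of either mixed derivative at points that tend to [z]. *)
Lemma mixed_derivative_sym Psi v w z : twice_continuously_differentiable Psi ->
  'D_w ('D_v Psi) z = 'D_v ('D_w Psi) z.
Proof.
move=> [d1 d2 ct].
(* the mean value theorem in direction [u], then in direction [t] *)
have second u t (h : R) : exists2 q : V,
    (exists a b : R, [/\ 0 <= a <= 1, 0 <= b <= 1 &
       q = z + (a * h) *: u + (b * h) *: t]) &
    Psi (z + h *: u + h *: t) - Psi (z + h *: u) - Psi (z + h *: t) + Psi z
    = h ^+ 2 * 'D_t ('D_u Psi) q.
  have dt p : differentiable (fun q => Psi (q + h *: t)) p.
    by apply: (@differentiable_comp _ _ _ _ (fun q => q + h *: t) Psi).
  have dP p : differentiable (fun q => Psi (q + h *: t) - Psi q) p.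
    exact: differentiableB.
  have [a a01 e1] := mean_value_scale z u h dP.
  have [b b01 e2] := mean_value_scale (z + (a * h) *: u) t h (d2 u).
  exists (z + (a * h) *: u + (b * h) *: t); first by exists a, b.
  have -> : h ^+ 2 * 'D_t ('D_u Psi) (z + (a * h) *: u + (b * h) *: t)
      = h * ('D_u Psi (z + (a * h) *: u + h *: t) - 'D_u Psi (z + (a * h) *: u)).
    by rewrite e2 expr2 mulrA.
  have eD p : 'D_u (fun q => Psi (q + h *: t) - Psi q) p
      = 'D_u Psi (p + h *: t) - 'D_u Psi p.
    have dt' : derivable (fun q => Psi (q + h *: t)) p u by exact/diff_derivable.
    have d1' : derivable Psi p u by exact/diff_derivable.
    rewrite (deriveB dt' d1').
    apply: (congr1 (fun a => a - 'D_u Psi p)).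
    apply: (congr1 (fun F : R -> R => lim (F r @[r --> 0^']))).
    by apply/funext => r /=; rewrite addrA.
  by rewrite -eD -e1 opprB addrA addrAC.
have close u t (e : R) : 0 < e -> exists2 d : R, 0 < d & forall h : R,
    0 < h -> h < d -> forall a b : R, 0 <= a <= 1 -> 0 <= b <= 1 ->
    `|'D_t ('D_u Psi) (z + (a * h) *: u + (b * h) *: t) - 'D_t ('D_u Psi) z|
    <= e.
  move=> e0; have /cvgrPdist_le/(_ e e0) := ct u t z.
  move=> /nbhs_normP[r /= r0 hr].
  exists (r / (`|u| + `|t| + 1)); first by rewrite divr_gt0//.
  move=> h h0 hd a b /andP[a0 a1] /andP[b0 b1]; rewrite distrC; apply: hr => /=.
  rewrite -addrA opprD addrA subrr add0r normrN.
  rewrite (le_lt_trans (ler_normD _ _))// !normrZ !ger0_norm ?mulr_ge0 ?(ltW h0)//.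
  move: hd; rewrite ltr_pdivlMr//; apply: le_lt_trans.
  rewrite mulrDr mulr1 mulrDr -addrA lerD//.
    by rewrite ler_wpM2r// ler_piMl// ltW.
  by rewrite -[leLHS]addr0 lerD ?(ltW h0)// ler_wpM2r// ler_piMl// ltW.
(* one [h] serves both orders of differentiation *)
apply/eqP; rewrite -subr_eq0 -normr_le0; apply/ler_addgt0Pl => e e0.
have e2 : 0 < e / 2 by rewrite divr_gt0.
have [r1 r10 h1] := close v w _ e2.
have [r2 r20 h2] := close w v _ e2.
pose h := Num.min r1 r2 / 2.
have h0 : 0 < h by rewrite divr_gt0// lt_min r10.
have hlt : h < Num.min r1 r2 by rewrite ltr_pdivrMr// ltr_pMr ?lt_min ?r10// ltr1n.
have [_ [a [b [a01 b01 ->]]] s1] := second v w h.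
have [_ [a' [b' [a01' b01' ->]]] s2] := second w v h.
have eqs : h ^+ 2 * 'D_w ('D_v Psi) (z + (a * h) *: v + (b * h) *: w)
    = h ^+ 2 * 'D_v ('D_w Psi) (z + (a' * h) *: w + (b' * h) *: v).
  apply: etrans (esym s1) (etrans _ s2).
  congr (_ + Psi z); rewrite [RHS]addrAC.
  by congr (Psi _ - _ - _); rewrite addrAC.
have {}eqs := mulfI (lt0r_neq0 (exprn_gt0 2 h0)) eqs.
have [hr1 hr2] : h < r1 /\ h < r2 by apply/andP; rewrite -lt_min.
have {}h1 := h1 h h0 hr1 a b a01 b01.
have {}h2 := h2 h h0 hr2 a' b' a01' b01'.
rewrite addr0; apply: close_trans h1 _; rewrite eqs; exact: h2.
Qed.

(** Differentiability at [z] as an explicit estimate that is uniform in the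
    direction [v], which may then depend on the step. *)
Lemma differentiable_expand Psi z : differentiable Psi z ->
  forall e : R, 0 < e -> exists2 r : R, 0 < r & forall v, `|v| < r ->
    `|Psi (z + v) - Psi z - 'D_v Psi z| <= e * `|v|.
Proof.
move=> dPsi e e0; have /eqaddoP/(_ e e0)/nbhs_norm0P[r /= r0 hr] := diff_locally dPsi.
exists r => // v vr; have := hr v vr.
rewrite !fctE/= /shift/= deriveE// (addrC v).
by rewrite opprD addrA.
Qed.

End Lines.

Lemma is_derive_of_expand (phi : R -> R) (s D : R) :
  (forall e : R, 0 < e -> exists2 r : R, 0 < r & forall h, `|h| < r ->
    `|phi (s + h) - phi s - h * D| <= e * `|h|) ->
  is_derive s 1 phi D.
Proof.
move=> expd.
have cv : h^-1 *: (phi (h *: 1 + s) - phi s) @[h --> 0^'] --> D.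
  apply/cvgrPdist_le => e e0; have [r r0 hr] := expd e e0.
  near=> h.
  have h0 : h != 0 by near: h; exact: nbhs_dnbhs_neq.
  have hlt : `|h| < r by near: h; exact: dnbhs0_lt.
  have -> : D - h^-1 *: (phi (h *: 1 + s) - phi s)
      = - (h^-1 * (phi (s + h) - phi s - h * D)).
    by rewrite /GRing.scale/= mulr1 (addrC h); field.
  rewrite normrN normrM normfV ler_pdivrMl ?normr_gt0// [leRHS]mulrC.
  exact: hr.
split; first by apply/cvg_ex; exists D.
exact/cvg_lim.
Unshelve. all: by end_near. Qed.

(** The mean value theorem for [phi s - s dphi 0 -/+ M s ^ 2 / 2], so that no
    integral of the derivative is needed. *)
Lemma quadratic_bound (phi dphi : R -> R) (M : R) :
  (forall s : R, is_derive s 1 phi (dphi s)) ->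
  (forall s : R, 0 <= s <= 1 -> `|dphi s - dphi 0| <= M * s) ->
  `|phi 1 - phi 0 - dphi 0| <= M / 2.
Proof.
move=> dp Mp.
have key (k : R) : (k = 1 \/ k = -1) ->
    k * (phi 1 - phi 0 - dphi 0) <= M / 2.
  move=> k1.
  pose psi (s : R) := k * (phi s - s * dphi 0) - (M / 2) * s ^+ 2.
  have dpsi (s : R) : is_derive s 1 psi (k * (dphi s - dphi 0) - M * s).
    rewrite /psi (_ : (fun s => _) = k *: (phi - (dphi 0 *: id)) - (M / 2) *: (id ^+ 2)).
      by apply: is_derive_eq; rewrite /GRing.scale/= expr1; field.
    by apply/funext => r; rewrite !fctE/= /GRing.scale/= (mulrC r).
  have ct : {within `[0, 1], continuous psi}.
    apply/continuous_subspaceT => s; apply/differentiable_continuous.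
    by apply/derivable1_diffP; have [] := dpsi s.
  have [s s01] := MVT ltr01 (fun s _ => dpsi s) ct.
  rewrite /psi => e.
  have s01' : 0 <= s <= 1.
    by move: s01; rewrite in_itv/= => /andP[? ?]; rewrite !ltW.
  have : k * (dphi s - dphi 0) <= M * s.
    have := Mp s s01'; rewrite ler_norml => /andP[? ?].
    by case: k1 => ->; lra.
  by lra.
rewrite ler_norml; apply/andP; split.
  by have := key (-1) (or_intror erefl); lra.
by have := key 1 (or_introl erefl); lra.
Qed.

End Calculus.

(** * Gradients and Hessians of functions of two column vectors *)

Section Gradients.
Context {R : realType}.

Lemma norm_le_enorm n (u : 'cV[R]_n) : `|u| <= enorm u.
Proof.
rewrite [leLHS]mx_normrE; apply/bigmax_leP; split; first exact: enorm_ge0.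
by move=> [i j] _ /=; rewrite ord1 entry_le_enorm.
Qed.

Lemma norm_pair_le n m (u : 'cV[R]_n) (v : 'cV[R]_m) :
  `|(u, v)| <= enorm u + enorm v.
Proof.
rewrite prod_normE/= ge_max; apply/andP; split.
  by rewrite (le_trans (norm_le_enorm _))// lerDl enorm_ge0.
by rewrite (le_trans (norm_le_enorm _))// lerDr enorm_ge0.
Qed.

Lemma col_sum_delta n (u : 'cV[R]_n) : u = \sum_i u i 0 *: delta_mx i 0.
Proof.
by rewrite [LHS]matrix_sum_delta; apply: eq_bigr => i _; rewrite big_ord1.
Qed.

(** Small steps along [v] realize the directional derivative up to any
    tolerance; one-sided difference bounds hence pass to the derivative. *)
Lemma derive_small_step (V : normedModType R) (Psi : V -> R) z v (e : R) :
  differentiable Psi z -> 0 < e -> exists2 r : R, 0 < r & forall s : R,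
    0 < s -> s < r -> `|Psi (z + s *: v) - Psi z - s * 'D_v Psi z| <= s * e.
Proof.
move=> dPsi e0.
have v0 : 0 < `|v| + 1 by rewrite ltr_wpDl.
have [r r0 hr] := differentiable_expand dPsi (divr_gt0 e0 v0).
exists (r / (`|v| + 1)) => [|s s0 sr]; first exact: divr_gt0.
have := hr (s *: v); rewrite deriveE// linearZ/= -deriveE// normrZ gtr0_norm//.
move: sr; rewrite ltr_pdivlMr// => sr /(_ _)/le_trans; apply.
  by apply: le_lt_trans sr; rewrite ler_pM2l// lerDl.
rewrite mulrAC ler_pdivrMr// mulrCA -mulrA ler_pM2l// ler_pM2l// lerDl//.
Qed.

Lemma derive_le_of_difference (V : normedModType R) (Psi : V -> R) z v (k : R) :
  differentiable Psi z ->
  (forall s : R, 0 < s -> Psi (z + s *: v) - Psi z <= s * k) ->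
  'D_v Psi z <= k.
Proof.
move=> dPsi hk; apply/ler_addgt0Pr => e e0.
have [r r0 hr] := derive_small_step v dPsi e0.
have s0 : 0 < r / 2 by rewrite divr_gt0.
have sr : r / 2 < r by rewrite gtr_pMr// invf_lt1// ltr1n.
have := hr _ s0 sr; rewrite ler_norml => /andP[h _].
by rewrite -(ler_pM2l s0); have := hk _ s0; lra.
Qed.

Lemma derive_ge_of_difference (V : normedModType R) (Psi : V -> R) z v (k : R) :
  differentiable Psi z ->
  (forall s : R, 0 < s -> s * k <= Psi (z + s *: v) - Psi z) ->
  k <= 'D_v Psi z.
Proof.
move=> dPsi hk; apply/ler_addgt0Pr => e e0.
have [r r0 hr] := derive_small_step v dPsi e0.
have s0 : 0 < r / 2 by rewrite divr_gt0.
have sr : r / 2 < r by rewrite gtr_pMr// invf_lt1// ltr1n.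
have := hr _ s0 sr; rewrite ler_norml => /andP[_ h].
by rewrite -(ler_pM2l s0); have := hk _ s0; lra.
Qed.

Lemma strongly_convexE n (mu : R) (phi : 'cV[R]_n -> R) z d (s : R) :
  strongly_convex mu phi -> 0 <= s -> s <= 1 ->
  phi (z + s *: d) <= s * phi (z + d) + (1 - s) * phi z
    - mu / 2 * (s * (1 - s)) * enorm d ^+ 2.
Proof.
move=> sc s0 s1.
have : phi (s *: (z + d) + (1 - s) *: z)
    - mu / 2 * enorm (s *: (z + d) + (1 - s) *: z) ^+ 2
    <= s * (phi (z + d) - mu / 2 * enorm (z + d) ^+ 2)
       + (1 - s) * (phi z - mu / 2 * enorm z ^+ 2).
  exact: sc (Itv01 s0 s1) (z + d) z (in_setT _) (in_setT _).
have -> : s *: (z + d) + (1 - s) *: z = z + s *: d.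
  by apply/matrixP => i j; rewrite !mxE; ring.
rewrite !enorm_sqD enormZ ger0_norm// exprMn dotZr.
lra.
Qed.

(** A strongly convex function lies above the parabola on any first-order
    minorant of it. *)
Lemma strongly_convex_tangent n (mu : R) (phi : 'cV[R]_n -> R) z d (D : R) :
  strongly_convex mu phi ->
  (forall e : R, 0 < e -> exists2 r : R, 0 < r & forall s : R,
     0 < s -> s < r -> s * (D - e) <= phi (z + s *: d) - phi z) ->
  phi z + D + mu / 2 * enorm d ^+ 2 <= phi (z + d).
Proof.
move=> sc hD; apply/ler_addgt0Pr => e e0.
have e2 : 0 < e / 2 by rewrite divr_gt0.
have [r r0 hr] := hD _ e2.
pose k := `|mu / 2 * enorm d ^+ 2| + 1.
have k0 : 0 < k by rewrite ltr_wpDl.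
(* small enough for the expansion, the segment and the quadratic remainder *)
pose s := Num.min (r / 2) (Num.min 1 (e / 2 / k)).
have s0 : 0 < s by rewrite /s !lt_min ltr01 !divr_gt0.
have [sr2 s1 sk] : [/\ s <= r / 2, s <= 1 & s <= e / 2 / k].
  by rewrite /s; split; rewrite !ge_min lexx ?orbT.
have sr : s < r by apply: (le_lt_trans sr2); rewrite gtr_pMr// invf_lt1// ltr1n.
have h1 := hr s s0 sr.
have h2 := @strongly_convexE n mu phi z d s sc (ltW s0) s1.
rewrite ler_pdivlMr// in sk.
have h3 : s * (mu / 2 * enorm d ^+ 2) <= e / 2.
  by apply: (le_trans _ sk); rewrite ler_pM2l// (le_trans (ler_norm _))// lerDl.
have h4 : s * (phi z + D + mu / 2 * enorm d ^+ 2)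
    <= s * (phi (z + d) + e / 2 + s * (mu / 2 * enorm d ^+ 2)) by lra.
by move: h4; rewrite ler_pM2l//; lra.
Qed.

Section Pair.
Context {n m : nat}.
Implicit Types (f g : 'cV[R]_n -> 'cV[R]_m -> R) (x u : 'cV[R]_n).
Implicit Types (y v p : 'cV[R]_m).

(** Partial derivatives are directional derivatives on the product, where
    differentiability gives linearity in the direction. *)
Lemma derive_pairl (f : 'cV[R]_n -> 'cV[R]_m -> R) u x y :
  'D_(u, 0) (fun w : 'cV[R]_n * 'cV[R]_m => f w.1 w.2) (x, y)
  = 'D_u (f ^~ y) x.
Proof.
apply: (congr1 (fun F : R -> R => lim (F r @[r --> 0^']))).
by apply/funext => r /=; rewrite scaler0 add0r.
Qed.

Lemma derive_pairr (f : 'cV[R]_n -> 'cV[R]_m -> R) v x y :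
  'D_(0, v) (fun w : 'cV[R]_n * 'cV[R]_m => f w.1 w.2) (x, y)
  = 'D_v (f x) y.
Proof.
apply: (congr1 (fun F : R -> R => lim (F r @[r --> 0^']))).
by apply/funext => r /=; rewrite scaler0 add0r.
Qed.

Lemma pair_delta u v : (u, v) = \sum_i u i 0 *: (delta_mx i 0 : 'cV[R]_n, 0 : 'cV[R]_m)
  + \sum_j v j 0 *: (0 : 'cV[R]_n, delta_mx j 0 : 'cV[R]_m).
Proof.
have -> : \sum_i u i 0 *: (delta_mx i 0 : 'cV[R]_n, 0 : 'cV[R]_m) = (u, 0).
  rewrite {2}(col_sum_delta u); elim/big_rec2: _ => // i a b _ ->.
  by congr (_, _); rewrite /= ?scaler0 ?addr0.
have -> : \sum_j v j 0 *: (0 : 'cV[R]_n, delta_mx j 0 : 'cV[R]_m) = (0, v).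
  rewrite {2}(col_sum_delta v); elim/big_rec2: _ => // i a b _ ->.
  by congr (_, _); rewrite /= ?scaler0 ?addr0.
by congr (_, _); rewrite /= ?addr0 ?add0r.
Qed.

Lemma derive_pair (F : 'cV[R]_n * 'cV[R]_m -> R) z u v : differentiable F z ->
  'D_(u, v) F z = \sum_i u i 0 * 'D_(delta_mx i 0, 0) F z
    + \sum_j v j 0 * 'D_(0, delta_mx j 0) F z.
Proof.
move=> dF; rewrite deriveE// pair_delta linearD !linear_sum; congr (_ + _).
  by apply: eq_bigr => i _; rewrite linearZ deriveE.
by apply: eq_bigr => i _; rewrite linearZ deriveE.
Qed.

Lemma derive_grad f u v x y : differentiable_xy f ->
  'D_(u, v) (fun w => f w.1 w.2) (x, y)
  = dot (grad_x f x y) u + dot (grad_y f x y) v.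
Proof.
move=> df; rewrite derive_pair//; congr (_ + _); apply: eq_bigr => i _.
  by rewrite mxE derive_pairl mulrC.
by rewrite mxE derive_pairr mulrC.
Qed.

Section C2.
Variable g : 'cV[R]_n -> 'cV[R]_m -> R.
Hypothesis gC2 : twice_continuously_differentiable
  (fun w : 'cV[R]_n * 'cV[R]_m => g w.1 w.2).

Lemma C2_differentiable : differentiable_xy g.
Proof. by move=> z; case: gC2. Qed.

Lemma grad_y_derive j : (fun w : 'cV[R]_n * 'cV[R]_m => grad_y g w.1 w.2 j 0)
  = 'D_(0, delta_mx j 0) (fun w : 'cV[R]_n * 'cV[R]_m => g w.1 w.2).
Proof. by apply/funext => -[x y] /=; rewrite derive_pairr mxE. Qed.

Lemma grad_y_entry_differentiable j z :
  differentiable (fun w : 'cV[R]_n * 'cV[R]_m => grad_y g w.1 w.2 j 0) z.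
Proof. by rewrite grad_y_derive; case: gC2. Qed.

Lemma dot_grad_yE p : (fun w : 'cV[R]_n * 'cV[R]_m => dot p (grad_y g w.1 w.2))
  = \sum_j (p j 0 *: (fun w : 'cV[R]_n * 'cV[R]_m => grad_y g w.1 w.2 j 0)).
Proof.
by apply/funext => w; rewrite fct_sumE.
Qed.

Lemma dot_grad_y_differentiable p z :
  differentiable (fun w : 'cV[R]_n * 'cV[R]_m => dot p (grad_y g w.1 w.2)) z.
Proof.
rewrite dot_grad_yE; apply: differentiable_sum => j.
by apply: differentiableZ; exact: grad_y_entry_differentiable.
Qed.

(** For a fixed vector [p] the function [<p, grad_y g>] is a scalar function
    whose derivative carries both Hessian blocks. *)
Lemma derive_dot_grad_y p u v x y :
  'D_(u, v) (fun w => dot p (grad_y g w.1 w.2)) (x, y)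
  = dot (hess_xy g x y *m p) u + dot (hess_yy g x y *m p) v.
Proof.
rewrite derive_pair; last exact: dot_grad_y_differentiable.
have ex t : 'D_t (fun w : 'cV[R]_n * 'cV[R]_m => dot p (grad_y g w.1 w.2)) (x, y)
  = \sum_j p j 0 * 'D_t (fun w : 'cV[R]_n * 'cV[R]_m => grad_y g w.1 w.2 j 0) (x, y).
  have dj j : derivable (fun w : 'cV[R]_n * 'cV[R]_m => grad_y g w.1 w.2 j 0) (x, y) t.
    exact/diff_derivable/grad_y_entry_differentiable.
  rewrite dot_grad_yE derive_sum => [|j]; last exact: derivableZ.
  by apply: eq_bigr => j _; rewrite deriveZ.
congr (_ + _); apply: eq_bigr => i _; rewrite ex mulrC mxE; congr (_ * _).
  by apply: eq_bigr => j _; rewrite mxE (derive_pairl (fun x y => grad_y g x y j 0)) mulrC.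
by apply: eq_bigr => j _; rewrite mxE (derive_pairr (fun x y => grad_y g x y j 0)) mulrC.
Qed.

Lemma hess_yy_sym x y : (hess_yy g x y)^T = hess_yy g x y.
Proof.
apply/matrixP => i j; rewrite !mxE.
rewrite -(derive_pairr (fun x y => grad_y g x y i 0)).
rewrite -(derive_pairr (fun x y => grad_y g x y j 0)).
by rewrite !grad_y_derive mixed_derivative_sym.
Qed.

End C2.
End Pair.
End Gradients.

(** * Consequences of the regularity of the two levels *)

Section Levels.
Context {R : realType} {n m : nat}.
Variable c : constants R.
Hypotheses (L_fx_ge0 : 0 <= L_fx c) (L_fy_ge0 : 0 <= L_fy c).
Hypotheses (L_gxy_ge0 : 0 <= L_gxy c) (L_gyy_ge0 : 0 <= L_gyy c).
Hypotheses (C_gxy_gt0 : 0 < C_gxy c) (mu_g_gt0 : 0 < mu_g c).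
Hypothesis L_g_mu_g : 0 < L_g c - mu_g c.

Lemma L_g_gt0 : 0 < L_g c.
Proof. by have := L_g_mu_g; have := mu_g_gt0; lra. Qed.

Lemma L_y_ge0 : 0 <= L_y c.
Proof. by rewrite divr_ge0 ?ltW. Qed.

Section Lower.
Variable g : 'cV[R]_n -> 'cV[R]_m -> R.
Hypothesis gl : lower_level c g.

Let gC2 := lower_C2 gl.

Lemma grad_y_lip_y x y y' :
  enorm (grad_y g x y - grad_y g x y') <= L_g c * enorm (y - y').
Proof. by have := lower_lip gl x y x y'; rewrite subrr enorm_pair0l. Qed.

Lemma grad_y_lip_x x x' y :
  enorm (grad_y g x y - grad_y g x' y) <= C_gxy c * enorm (x - x').
Proof.
apply: enorm_dual => [|p]; first by rewrite mulr_ge0 ?enorm_ge0 ?ltW.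
rewrite dotC dotBr.
have [s _] := mean_value (x', y) (x - x', 0)
  (dot_grad_y_differentiable gC2 p).
rewrite /= (addrC x') subrK addr0 => ->.
have -> : (x', y) + s *: (x - x', 0 : 'cV[R]_m) = (x' + s *: (x - x'), y).
  by congr (_, _); rewrite /= scaler0 addr0.
rewrite derive_dot_grad_y// dot0r addr0 (le_trans (dot_le _ _))//.
rewrite [leRHS]mulrAC ler_wpM2r ?enorm_ge0// enorm_mulmx_le//.
exact: lower_bound gl _ _.
Qed.

Lemma grad_y_monotone x y y' :
  mu_g c * enorm (y - y') ^+ 2 <= dot (grad_y g x y - grad_y g x y') (y - y').
Proof.
have tangent z d : g x z + dot (grad_y g x z) d + mu_g c / 2 * enorm d ^+ 2
    <= g x (z + d).
  apply: strongly_convex_tangent (lower_convex gl x) _ => e e0.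
  have [r r0 hr] := derive_small_step (0, d) (C2_differentiable gC2 (x, z)) e0.
  exists r => // s s0 sr; have := hr s s0 sr.
  rewrite derive_grad; last exact: C2_differentiable.
  rewrite dot0r add0r /= scaler0 addr0 ler_norml => /andP[h _].
  by move: h; lra.
have h1 := tangent y' (y - y'); have h2 := tangent y (y' - y).
rewrite (addrC y') subrK in h1; rewrite (addrC y) subrK in h2.
rewrite -(opprB y y') dotNr enormN in h2.
rewrite dotBl; lra.
Qed.

(** Strong monotonicity of the gradient, differentiated along [v]. *)
Lemma hess_yy_ge x y v : mu_g c * enorm v ^+ 2 <= dot v (hess_yy g x y *m v).
Proof.
have := derive_dot_grad_y gC2 v 0 v x y; rewrite dot0r add0r dotC => <-.
apply: derive_ge_of_difference; first exact: dot_grad_y_differentiable.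
move=> s s0 /=; rewrite scaler0 addr0 -dotBr dotC.
have := grad_y_monotone x (y + s *: v) y.
rewrite (addrC y) addrK enormZ gtr0_norm// exprMn dotZr => h.
rewrite -(ler_pM2l s0); apply: le_trans h.
by rewrite le_eqVlt; apply/predU1P; left; ring.
Qed.

Lemma hess_yy_le x y v : dot v (hess_yy g x y *m v) <= L_g c * enorm v ^+ 2.
Proof.
have := derive_dot_grad_y gC2 v 0 v x y; rewrite dot0r add0r dotC => <-.
apply: derive_le_of_difference; first exact: dot_grad_y_differentiable.
move=> s s0 /=; rewrite scaler0 addr0 -dotBr (le_trans (dot_le _ _))//.
have := grad_y_lip_y x (y + s *: v) y.
rewrite (addrC y) addrK enormZ gtr0_norm// => h.
have := ler_wpM2l (enorm_ge0 v) h; move/le_trans; apply.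
by rewrite expr2 le_eqVlt; apply/predU1P; left; ring.
Qed.

(** One factor of the Neumann series: the spectrum of the symmetric matrix
    [hess_yy] lies in [mu_g, L_g]. *)
Lemma neumann_factor_contracts x y v :
  enorm ((1%:M - (L_g c)^-1 *: hess_yy g x y) *m v)
  <= (1 - mu_g c / L_g c) * enorm v.
Proof.
have L0 := L_g_gt0; have m0 := mu_g_gt0.
apply: sym_quad_bound.
- by rewrite linearB linearZ/= hess_yy_sym// trmx1.
- by rewrite subr_ge0 ler_pdivrMr// mul1r; have := L_g_mu_g; lra.
move=> {}v; rewrite mulmxBl mul1mx -scalemxAl dotBr dotZr -enorm2.
have h1 := hess_yy_ge x y v; have h2 := hess_yy_le x y v.
rewrite -(ler_pM2l (x := (L_g c)^-1)) ?invr_gt0// in h1.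
rewrite -(ler_pM2l (x := (L_g c)^-1)) ?invr_gt0// mulKf ?gt_eqF// in h2.
have e0 := sqr_ge0 (enorm v).
rewrite ler_norml; apply/andP; split.
  apply: (@le_trans _ _ 0); last by rewrite subr_ge0.
  rewrite oppr_le0 mulr_ge0// subr_ge0 ler_pdivrMr// mul1r.
  by have := L_g_mu_g; lra.
by rewrite mulrA (mulrC _ (mu_g c)) in h1; lra.
Qed.

Lemma hess_yy_enorm_ge x y v : mu_g c * enorm v <= enorm (hess_yy g x y *m v).
Proof.
have [->|v0] := eqVneq (enorm v) 0; first by rewrite mulr0 enorm_ge0.
have vgt : 0 < enorm v by rewrite lt_def v0 enorm_ge0.
rewrite -(ler_pM2l vgt); apply: le_trans (dot_le _ _).
by apply: le_trans (hess_yy_ge x y v); rewrite mulrCA expr2.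
Qed.

Lemma hess_yy_unit x y : hess_yy g x y \in unitmx.
Proof.
rewrite -row_free_unit -kermx_eq0; apply/eqP/row_matrixP => i.
rewrite row0; set r := row i _.
have r0 : r *m hess_yy g x y = 0 by rewrite -row_mul mulmx_ker row0.
suff : r^T = 0 by move/(congr1 trmx); rewrite trmxK trmx0.
apply/enorm_eq0/eqP; rewrite -normr_le0 ger0_norm ?enorm_ge0//.
have := hess_yy_enorm_ge x y r^T.
rewrite -(hess_yy_sym gC2) -trmx_mul r0 trmx0 enorm0.
by rewrite pmulr_rle0.
Qed.

Lemma inv_hess_yy_le x y v :
  enorm (invmx (hess_yy g x y) *m v) <= (mu_g c)^-1 * enorm v.
Proof.
rewrite ler_pdivlMl//.
have := hess_yy_enorm_ge x y (invmx (hess_yy g x y) *m v).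
by rewrite mulKVmx ?hess_yy_unit.
Qed.

Section LowerSolution.
Variable ystar : 'cV[R]_n -> 'cV[R]_m.
Hypothesis ystar_argmin : forall x y, g x (ystar x) <= g x y.

(** A directional derivative at a minimizer is nonnegative; the direction
    [- grad_y g] gives [- |grad_y g| ^ 2 >= 0]. *)
Lemma grad_y_ystar x : grad_y g x (ystar x) = 0.
Proof.
apply: enorm_eq0; apply/eqP; rewrite -sqrf_eq0 enorm2.
set G := grad_y _ _ _.
have : 0 <= dot G (- G).
  have df := C2_differentiable gC2.
  have := derive_grad 0 (- G) x (ystar x) df; rewrite dot0r add0r => <-.
  apply: derive_ge_of_difference; first exact: df.
  by move=> s s0 /=; rewrite mulr0 scaler0 addr0 subr_ge0.
by rewrite dotNr oppr_ge0 => h; rewrite eq_le h dotv_ge0.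
Qed.

Lemma grad_y_le_dist x y : enorm (grad_y g x y) <= L_g c * enorm (y - ystar x).
Proof. by have := grad_y_lip_y x y (ystar x); rewrite grad_y_ystar subr0. Qed.

(** At the two minimizers the gradients vanish, so strong monotonicity at [x]
    compares [ystar x - ystar x'] with the change of the gradient in [x]. *)
Lemma ystar_lip x x' :
  enorm (ystar x - ystar x') <= L_y c * enorm (x - x').
Proof.
have [->|v0] := eqVneq (enorm (ystar x - ystar x')) 0.
  by rewrite mulr_ge0 ?L_y_ge0 ?enorm_ge0.
have vgt : 0 < enorm (ystar x - ystar x') by rewrite lt_def v0 enorm_ge0.
have := grad_y_monotone x (ystar x) (ystar x').
rewrite grad_y_ystar -(grad_y_ystar x') => h.
have {}h := le_trans h (dot_le _ _).
have := ler_wpM2r (ltW vgt) (grad_y_lip_x x' x (ystar x')).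
rewrite (enormB x') => /(le_trans h).
by rewrite expr2 mulrA ler_pM2r// /L_y mulrAC ler_pdivlMr// mulrC.
Qed.

(** The cross term contributes [- 2 b mu_g] by strong monotonicity; the
    quadratic term [b ^ 2 L_g ^ 2 <= b mu_g] uses up half of it. *)
Lemma gradient_step_contracts x y (b : R) : 0 <= b -> b <= mu_g c / L_g c ^+ 2 ->
  enorm (y - b *: grad_y g x y - ystar x) ^+ 2
  <= (1 - b * mu_g c) * enorm (y - ystar x) ^+ 2.
Proof.
move=> b0 bL; have L0 := L_g_gt0.
rewrite addrAC (enorm_sqB (y - ystar x)) enormZ ger0_norm// exprMn dotZr.
have h1 := grad_y_monotone x y (ystar x).
rewrite grad_y_ystar subr0 dotC in h1.
have h2 : enorm (grad_y g x y) ^+ 2 <= L_g c ^+ 2 * enorm (y - ystar x) ^+ 2.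
  by rewrite -exprMn ler_pXn2r ?nnegrE ?mulr_ge0 ?enorm_ge0 ?(ltW L0)//;
    exact: grad_y_le_dist.
have {}h1 := ler_wpM2l b0 h1.
have {}h2 := ler_wpM2l (sqr_ge0 b) h2.
have h3 : b ^+ 2 * (L_g c ^+ 2 * enorm (y - ystar x) ^+ 2)
   <= b * mu_g c * enorm (y - ystar x) ^+ 2.
  rewrite mulrA ler_wpM2r ?sqr_ge0// expr2 -mulrA ler_wpM2l//.
  by rewrite -ler_pdivlMr ?exprn_gt0.
by lra.
Qed.

End LowerSolution.
End Lower.

Section Surrogate.
Variables f g : 'cV[R]_n -> 'cV[R]_m -> R.
Hypotheses (fu : upper_level c f) (gl : lower_level c g).

Let gC2 := lower_C2 gl.

Lemma C_fy_ge0 : 0 <= C_fy c.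
Proof. exact: le_trans (enorm_ge0 _) (upper_bound fu 0 0). Qed.

Lemma L_bar_ge0 : 0 <= L_bar c.
Proof.
have C0 := C_fy_ge0; have m0 := mu_g_gt0; have G0 := C_gxy_gt0.
by rewrite /L_bar !(addr_ge0, mulr_ge0, invr_ge0, exprn_ge0) ?(ltW m0) ?(ltW G0).
Qed.

Lemma L_fE : L_f c = L_bar c * (1 + L_y c).
Proof. by rewrite /L_f /L_y mulrDr mulr1 mulrA. Qed.

(** Telescoping one factor at a time, with
    [H^-1 - H'^-1 = H'^-1 (H' - H) H^-1]. *)
Lemma surrogate_split (a a' : 'cV[R]_n) (A A' : 'M[R]_(n, m)) (H H' : 'M[R]_m)
    (b b' : 'cV[R]_m) : H \in unitmx -> H' \in unitmx ->
  a - A *m invmx H *m b - (a' - A' *m invmx H' *m b')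
  = (a - a') - ((A - A') *m (invmx H *m b)
     + (A' *m (invmx H' *m ((H' - H) *m (invmx H *m b)))
        + A' *m (invmx H' *m (b - b')))).
Proof.
move=> HU HU'.
have -> : invmx H' *m ((H' - H) *m (invmx H *m b))
    = invmx H *m b - invmx H' *m b.
  by rewrite mulmxBl mulmxBr mulKmx// mulKVmx.
rewrite mulmxBl !mulmxBr !mulmxA.
move: (A *m _ *m b) (A' *m invmx H *m b) (A' *m invmx H' *m b)
  (A' *m invmx H' *m b') => u w v u'.
by apply/matrixP => i j; rewrite !mxE; ring.
Qed.

(** The three differences of [surrogate_split] and the one of [grad_x f] give
    the four summands of [L_bar]. *)
Lemma surrogate_lip x y x' y' :
  enorm (surrogate f g x y - surrogate f g x' y')
  <= L_bar c * enorm_pair (x - x') (y - y').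
Proof.
have D0 : 0 <= enorm_pair (x - x') (y - y') by exact: enorm_pair_ge0.
rewrite /surrogate; move: (upper_lip_x fu x y x' y') (upper_lip_y fu x y x' y').
move: (lower_lip_xy gl x y x' y') (lower_lip_yy gl x y x' y') (upper_bound fu x y).
move: (lower_bound gl x' y') (inv_hess_yy_le gl x' y') (inv_hess_yy_le gl x y).
move: (hess_yy_unit gl x y) (hess_yy_unit gl x' y').
move: (enorm_pair _ _) D0 => D D0.
move: (hess_xy g x y) (hess_xy g x' y') => A A'.
move: (hess_yy g x y) (hess_yy g x' y') => H H'.
move: (grad_y f x y) (grad_y f x' y') (grad_x f x y) (grad_x f x' y').
move=> b b' a a' HU HU' A'C hH' hH AA' HH' hb aa' bb'.
rewrite (surrogate_split a a' A A' b b' HU HU').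
have mi0 : 0 <= (mu_g c)^-1 by rewrite invr_ge0 ltW.
have C0 := C_fy_ge0; have G0 := ltW C_gxy_gt0.
have hHb : enorm (invmx H *m b) <= (mu_g c)^-1 * C_fy c.
  by rewrite (le_trans (hH _))// ler_wpM2l.
have hA' v : enorm (A' *m v) <= C_gxy c * enorm v.
  exact: enorm_mulmx_le.
rewrite (le_trans (enormB_le _ _))//.
have t1 : enorm ((A - A') *m (invmx H *m b))
    <= L_gxy c * D * ((mu_g c)^-1 * C_fy c).
  rewrite (le_trans (enorm_mulmx_le _ AA'))//.
  by rewrite ler_wpM2l// mulr_ge0.
have t2 : enorm (A' *m (invmx H' *m ((H' - H) *m (invmx H *m b))))
    <= C_gxy c * ((mu_g c)^-1 * (L_gyy c * D * ((mu_g c)^-1 * C_fy c))).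
  rewrite (le_trans (hA' _))// ler_wpM2l// (le_trans (hH' _))// ler_wpM2l//.
  rewrite -[H' - H]opprB mulNmx enormN.
  rewrite (le_trans (enorm_mulmx_le _ HH'))//.
  by rewrite ler_wpM2l// mulr_ge0.
have t3 : enorm (A' *m (invmx H' *m (b - b')))
    <= C_gxy c * ((mu_g c)^-1 * (L_fy c * D)).
  rewrite (le_trans (hA' _))// ler_wpM2l// (le_trans (hH' _))// ler_wpM2l//.
apply: (le_trans (lerD aa' (le_trans (enormD_le _ _)
  (lerD t1 (le_trans (enormD_le _ _) (lerD t2 t3)))))).
rewrite le_eqVlt; apply/predU1P; left; rewrite /L_bar; field.
by rewrite gt_eqF.
Qed.

Section Bilevel.
Variable ystar : 'cV[R]_n -> 'cV[R]_m.
Hypothesis ystar_argmin : forall x y, g x (ystar x) <= g x y.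
Variable ell : 'cV[R]_n -> R.
Hypothesis ell_def : forall x, ell x = f x (ystar x).

(** The gradient of [ell], by [is_derive_ell]. *)
Definition hgrad x := surrogate f g x (ystar x).

Lemma hgrad_surrogate_le x y :
  enorm (hgrad x - surrogate f g x y) <= L_bar c * enorm (y - ystar x).
Proof.
rewrite /hgrad enormB; have := surrogate_lip x y x (ystar x).
by rewrite (subrr x) enorm_pair0l.
Qed.

Lemma ystar_pair_le x d :
  enorm_pair d (ystar (x + d) - ystar x) <= (1 + L_y c) * enorm d.
Proof.
rewrite (le_trans (enorm_pair_le _ _))// mulrDl mul1r lerD2l.
have := ystar_lip gl ystar_argmin (x + d) x.
by rewrite (addrC x d) addrK.
Qed.

(** Adjoint argument: with [p = hess_yy^-1 grad_y f] frozen at the base point,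
    [Psi = f - <p, grad_y g>] agrees with [f] on the graph of [ystar], where
    [grad_y g] vanishes, and its derivative in the [y] directions is zero at
    the base point.  So the Lipschitz continuity of [ystar] is enough to
    differentiate [ell]: the derivative of [ystar] never appears. *)
Lemma is_derive_ell x d (s : R) :
  is_derive s 1 (fun s : R => ell (x + s *: d)) (dot (hgrad (x + s *: d)) d).
Proof.
set xs := x + s *: d; set ys := ystar xs.
pose p := invmx (hess_yy g xs ys) *m grad_y f xs ys.
pose Psi (w : 'cV[R]_n * 'cV[R]_m) := f w.1 w.2 - dot p (grad_y g w.1 w.2).
have df : differentiable (fun w => f w.1 w.2) (xs, ys) by exact: upper_diff fu _.
have dg : differentiable (fun w => dot p (grad_y g w.1 w.2)) (xs, ys).
  exact: dot_grad_y_differentiable.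
have dPsi : differentiable Psi (xs, ys) by exact: differentiableB.
have ellE z : ell z = Psi (z, ystar z).
  by rewrite /Psi/= (grad_y_ystar gl ystar_argmin) dot0r subr0.
have DPsi u v : 'D_(u, v) Psi (xs, ys) = dot (hgrad xs) u.
  have df' : derivable (fun w => f w.1 w.2) (xs, ys) (u, v).
    exact/diff_derivable.
  have dg' : derivable (fun w => dot p (grad_y g w.1 w.2)) (xs, ys) (u, v).
    exact/diff_derivable.
  rewrite (deriveB df' dg') derive_grad; last exact: upper_diff fu.
  rewrite derive_dot_grad_y// /p mulKVmx ?(hess_yy_unit gl)//.
  by rewrite /hgrad /surrogate -/ys -mulmxA dotBl; ring.
apply: is_derive_of_expand => e e0.
pose k := (1 + L_y c) * enorm d + enorm d + L_y c * enorm d + 1.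
have Ly0 := L_y_ge0; have d0 := enorm_ge0 d.
have Ld0 : 0 <= L_y c * enorm d by rewrite mulr_ge0.
have k0 : 0 < k by rewrite /k; lra.
have [r r0 hr] := differentiable_expand dPsi (divr_gt0 e0 k0).
exists (r / k) => [|h hrk]; first exact: divr_gt0.
pose v := ystar (xs + h *: d) - ys.
have vk : `|(h *: d, v)| <= `|h| * k.
  rewrite (le_trans (norm_pair_le _ _))//.
  have : enorm v <= L_y c * enorm (h *: d).
    have := ystar_lip gl ystar_argmin (xs + h *: d) xs.
    by rewrite (addrC xs) addrK (addrC _ xs).
  rewrite enormZ => hv.
  have : 0 <= `|h| * (1 + L_y c * enorm d + enorm d).
    by rewrite mulr_ge0//; lra.
  by rewrite /k; lra.
have := hr (h *: d, v); rewrite ltr_pdivlMr// in hrk.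
move=> /(_ (le_lt_trans vk hrk)).
have -> : (xs, ys) + (h *: d, v) = (xs + h *: d, ystar (xs + h *: d)).
  by congr (_, _); rewrite /v (addrC ys) subrK.
have -> : xs + h *: d = x + (s + h) *: d by rewrite /xs -addrA -scalerDl.
rewrite -!ellE DPsi dotZr => /le_trans; apply.
rewrite mulrAC ler_pdivrMr// -mulrA ler_wpM2l// ltW//.
Qed.

(** The quadratic bound along the segment, for a gradient [hgrad] that is
    Lipschitz with constant [L_f = L_bar (1 + L_y)]: the surrogate and then the
    curve [ystar] move with the base point. *)
Lemma ell_quadratic x d :
  `|ell (x + d) - ell x - dot (hgrad x) d| <= L_f c / 2 * enorm d ^+ 2.
Proof.
have := @quadratic_bound R (fun s => ell (x + s *: d))
  (fun s => dot (hgrad (x + s *: d)) d) (L_f c * enorm d ^+ 2)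
  (is_derive_ell x d).
rewrite scale1r scale0r addr0 mulrAC; apply => s /andP[s0 _].
rewrite -dotBl (le_trans (dot_abs_le _ _))// expr2 !mulrA mulrAC.
rewrite ler_wpM2r ?enorm_ge0//.
rewrite (le_trans (surrogate_lip _ _ _ _))// L_fE -!mulrA ler_wpM2l ?L_bar_ge0//.
rewrite (addrC x) addrK addrC (le_trans (ystar_pair_le _ _))//.
by rewrite enormZ ger0_norm// (mulrC _ s).
Qed.

Lemma ell_descent x d :
  ell (x + d) <= ell x + dot (hgrad x) d + L_f c / 2 * enorm d ^+ 2.
Proof. by have := ler_normlW (ell_quadratic x d); lra. Qed.

(** The Polyak-Lojasiewicz inequality: strong convexity puts [ell] above a
    parabola with tangent [hgrad x], and a minimum of the parabola bounds the
    value of [ell] at its minimizer. *)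
Lemma ell_gradient_dominated (mu ell_star : R) x :
  0 < mu -> strongly_convex mu ell -> (exists x, ell x = ell_star) ->
  2 * mu * (ell x - ell_star) <= enorm (hgrad x) ^+ 2.
Proof.
move=> mu0 sc [z <-]; pose d := z - x.
have : ell x + dot (hgrad x) d + mu / 2 * enorm d ^+ 2 <= ell (x + d).
  apply: strongly_convex_tangent sc _ => e e0.
  have k0 : 0 < `|L_f c / 2 * enorm d ^+ 2| + 1 by rewrite ltr_wpDl.
  exists (e / (`|L_f c / 2 * enorm d ^+ 2| + 1)) => [|s s0]; first exact: divr_gt0.
  rewrite ltr_pdivlMr// => se.
  have := ell_quadratic x (s *: d).
  rewrite dotZr enormZ (gtr0_norm s0) exprMn ler_norml => /andP[h _].
  have : s * (s * (L_f c / 2 * enorm d ^+ 2)) <= s * e.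
    rewrite ler_pM2l// (le_trans _ (ltW se))// ler_pM2l//.
    by rewrite (le_trans (ler_norm _))// lerDl.
  by lra.
have -> : x + d = z by rewrite /d addrC subrK.
(* completing the square: the parabola in [d] is minimal at [- hgrad x / mu] *)
have h := sqr_ge0 (enorm (hgrad x + mu *: d)).
rewrite enorm_sqD enormZ gtr0_norm// dotZr exprMn in h.
move=> /(ler_wpM2l (ltW mu0)); lra.
Qed.

End Bilevel.
End Surrogate.
End Levels.

(** * Measure-theoretic tools *)

Section LowerIntegral.
Local Open Scope ereal_scope.
Context {d} {T : measurableType d} {R : realType}.
Variable mu : {measure set T -> \bar R}.
Import HBNNSimple.

(** The integral of a nonnegative function is a supremum over the simple
    functions below it, so that it is monotone, up to a null set, without any
    measurability. *)
Lemma ge0_le_integral_off_null (N : set T) (f1 f2 : T -> \bar R) :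
  measurable N -> mu N = 0 -> (forall x, 0 <= f1 x) -> (forall x, 0 <= f2 x) ->
  (forall x, ~ N x -> f1 x <= f2 x) ->
  \int[mu]_x f1 x <= \int[mu]_x f2 x.
Proof.
move=> mN N0 f10 f20 f12; rewrite !ge0_integralTE//.
apply: ge_ereal_sup => _ [h /= hf1 <-].
have mCN := measurableC mN.
pose k := proj_nnsfun h mCN.
have -> : sintegral mu h = sintegral mu k.
  rewrite -!integralT_nnsfun; apply: ge0_ae_eq_integral => //.
  - exact/measurable_EFinP.
  - exact/measurable_EFinP.
  - by move=> x _; rewrite lee_fin.
  - by move=> x _; rewrite lee_fin.
  exists N; split => // x /= /not_implyP[_] hk.
  apply: contrapT => Nx; apply: hk.
  by rewrite mindicE mem_set// mulr1.
apply: ereal_sup_ubound; exists k => //= x.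
rewrite mindicE; case: (pselect (N x)) => Nx.
  by rewrite memNset ?mulr0//= => /(_ Nx).
by rewrite mem_set// mulr1 (le_trans (hf1 x))// f12.
Qed.

End LowerIntegral.

Section OffNull.
Context {R : realType} {d : measure_display} {S : measurableType d}.
Variables (pi : probability S R) (N : set S).
Hypotheses (mN : measurable N) (N0 : pi N = 0%E).

(** For arbitrary functions, by comparing the positive and the negative parts
    through [ge0_le_integral_off_null]. *)
Lemma integral_off_null (u v : S -> \bar R) : (forall s, ~ N s -> u s = v s) ->
  (\int[pi]_s u s = \int[pi]_s v s)%E.
Proof.
have half (a b : S -> \bar R) : (forall s, (0 <= a s)%E) -> (forall s, (0 <= b s)%E) ->
    (forall s, ~ N s -> a s = b s) -> (\int[pi]_s a s = \int[pi]_s b s)%E.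
  move=> a0 b0 ab; apply/eqP; rewrite eq_le; apply/andP; split.
    by apply: (ge0_le_integral_off_null mN N0) => // s /ab ->.
  by apply: (ge0_le_integral_off_null mN N0) => // s /ab ->.
move=> uv; rewrite integralE [RHS]integralE.
congr (_ - _)%E; apply: half => // s Ns.
- by rewrite !funeposE (uv s Ns).
- by rewrite !funenegE (uv s Ns).
Qed.

Lemma mean_mx_off_null p q (A B : S -> 'M[R]_(p, q)) :
  (forall s, ~ N s -> A s = B s) -> mean_mx pi A = mean_mx pi B.
Proof.
move=> AB; apply/matrixP => i j; rewrite !mxE !unlock; congr fine.
by apply: integral_off_null => s /AB ->.
Qed.

End OffNull.

Section ImageMeasure.
Context {d d' : measure_display} {T : measurableType d} {T' : measurableType d'}
  {R : realType}.
Variables (mu : {finite_measure set T -> \bar R}) (f : {mfun T >-> T'}).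

(** The pushforward with a finite-measure structure, which the uniqueness of
    product measures requires. *)
Definition image_measure : set T' -> \bar R := pushforward mu f.

Let mf (A : set T') : measurable A -> measurable (f @^-1` A).
Proof. by move=> mA; rewrite -[X in measurable X]setTI; exact: measurable_funP. Qed.

Let image_measure0 : image_measure set0 = 0%E.
Proof. exact: measure0. Qed.

Let image_measure_ge0 A : (0 <= image_measure A)%E.
Proof. exact: measure_ge0. Qed.

Let image_measure_sigma_additive : semi_sigma_additive image_measure.
Proof.
exact: (@measure_semi_sigma_additive _ _ _
  (pushforward mu f : {measure set T' -> \bar R})).
Qed.

HB.instance Definition _ := isMeasure.Build _ _ _ image_measure
  image_measure0 image_measure_ge0 image_measure_sigma_additive.

Let image_measure_fin : fin_num_fun image_measure.
Proof. by move=> A mA; apply: fin_num_measure; exact: mf. Qed.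

HB.instance Definition _ :=
  Measure_isFinite.Build _ _ _ image_measure image_measure_fin.

End ImageMeasure.

(** When [f] and [xi] are independent and [xi] has law [pi], integrating out
    [xi] with [f] frozen does not change the integral. *)
Section Freezing.
Local Open Scope ereal_scope.
Context {d d1 d' : measure_display} {Omega : measurableType d}
  {T1 : measurableType d1} {S : measurableType d'} {R : realType}.
Variables (mu : {finite_measure set Omega -> \bar R}) (pi : probability S R).
Variables (f : {mfun Omega >-> T1}) (xi : Omega -> S).
Hypothesis mxi : measurable_fun setT xi.
Hypothesis indep : forall E B, measurable E -> measurable B ->
  mu (f @^-1` E `&` xi @^-1` B) = mu (f @^-1` E) * pi B.

Let mgraph : measurable_fun setT (fun w : Omega => (f w, xi w)).
Proof. exact: measurable_fun_pair. Qed.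

Let graph : {mfun Omega >-> (T1 * S)%type} :=
  HB.pack (fun w : Omega => (f w, xi w)) (isMeasurableFun.Build _ _ _ _ _ mgraph).

Let graph_law (X : set (T1 * S)) : measurable X ->
  (image_measure mu f \x pi) X
  = image_measure mu graph X.
Proof. by move=> mX; apply: product_measure_unique => // A B mA mB; exact: indep. Qed.

Lemma freezing (Phi : T1 * S -> \bar R) :
  measurable_fun setT Phi -> (forall z, 0 <= Phi z) ->
  \int[mu]_w Phi (f w, xi w) = \int[mu]_w \int[pi]_s Phi (f w, s).
Proof.
move=> mPhi Phi0.
transitivity (\int[image_measure mu graph]_z Phi z).
  by rewrite /image_measure ge0_integral_pushforward.
transitivity (\int[image_measure mu f \x pi]_z Phi z).
  by apply: eq_measure_integral => X mX _; exact/esym/graph_law.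
rewrite fubini_tonelli1// /image_measure ge0_integral_pushforward//.
- exact: measurable_fun_fubini_tonelli_F.
- by move=> y _; exact: integral_ge0.
Qed.

(** For bounded functions of any sign, where Fubini replaces Tonelli. *)
Lemma indep_product (p : S -> R) (q : T1 -> R) (a b : R) :
  measurable_fun setT p -> measurable_fun setT q ->
  (forall s, `|p s| <= a)%R -> (forall w, `|q w| <= b)%R ->
  (\int[mu]_w (p (xi w) * q (f w)) = (\int[pi]_s p s) * (\int[mu]_w q (f w)))%R.
Proof.
move=> mp mq pa qb.
pose Phi (z : T1 * S) := (p z.2 * q z.1)%R.
have bint d0 (U : measurableType d0) (m : {finite_measure set U -> \bar R}) (h : U -> R) k :
    measurable_fun setT h -> (forall u, `|h u| <= k)%R ->
    m.-integrable setT (EFin \o h).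
  move=> mh hk; apply: measurable_bounded_integrable => //.
    by rewrite ltey_eq fin_num_measure.
  by exists k; split; [exact: num_real|move=> M kM u _ /=; rewrite (le_trans (hk u))// ltW].
have Phib z : (`|Phi z| <= a * b)%R by rewrite normrM ler_pM.
have mPhi : measurable_fun setT Phi.
  apply: measurable_funM; first exact: (measurableT_comp mp measurable_snd).
  exact: (measurableT_comp mq measurable_fst).
have iq : mu.-integrable setT (EFin \o (q \o f)).
  have mqf : measurable_fun setT (q \o f) := measurableT_comp mq (measurable_funP f).
  by apply: (bint _ _ mu (q \o f) b mqf) => w; exact: qb.
have ip : pi.-integrable setT (EFin \o p) by apply: (@bint _ _ _ _ a).
have ig : (image_measure mu graph).-integrable setT (EFin \o Phi).
  by apply: (@bint _ _ _ _ (a * b)%R).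
apply: EFin_inj; rewrite EFinM /Rintegral !fineK; last 3 first.
- by apply: integrable_fin_num.
- by apply: integrable_fin_num.
- apply: integrable_fin_num => //; apply: (@bint _ _ _ _ (a * b)%R) => //.
    exact: (measurableT_comp mPhi mgraph).
  by move=> w; exact: (Phib (f w, xi w)).
transitivity (\int[image_measure mu graph]_z (Phi z)%:E).
  have mE : measurable_fun setT (EFin \o Phi) by exact/measurable_EFinP.
  have mPg : measurable_fun setT (Phi \o graph) := measurableT_comp mPhi mgraph.
  have iE : mu.-integrable setT (EFin \o (Phi \o graph)).
    by apply: (bint _ _ mu _ (a * b)%R mPg) => w; exact: Phib.
  by rewrite /image_measure (integral_pushforward mgraph mE iE).
transitivity (\int[image_measure mu f \x pi]_z (Phi z)%:E).
  by apply: eq_measure_integral => X mX _; exact/esym/graph_law.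
rewrite -integral12_prod_meas1; last first.
  apply/integrableP; split; first exact/measurable_EFinP.
  rewrite (eq_measure_integral (image_measure mu graph)); last first.
    by move=> X mX _; exact: graph_law.
  by case/integrableP : ig.
transitivity (\int[image_measure mu f]_x ((\int[pi]_s (p s)%:E) * (q x)%:E)).
  apply: eq_integral => x _; rewrite /fubini_F /Phi/=.
  under eq_integral do rewrite EFinM.
  by rewrite integralZr.
rewrite -(fineK (integrable_fin_num measurableT ip)).
rewrite integralZl//; last exact: (bint _ _ _ _ b mq qb).
have mE : measurable_fun setT (EFin \o q) by exact/measurable_EFinP.
by rewrite /image_measure (integral_pushforward (measurable_funP f) mE iq).
Qed.

End Freezing.

(** Independence is easiest to verify on a pi-system [G0] that generates the
    sigma-algebra of the frozen variables. *)
Section PiSystem.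
Local Open Scope ereal_scope.
Context {d d' : measure_display} {Omega : measurableType d}
  {S : measurableType d'} {R : realType}.
Variables (mu : {finite_measure set Omega -> \bar R}) (pi : probability S R).
Variables (G0 : set (set Omega)) (xi : Omega -> S).
Hypothesis G0m : G0 `<=` measurable.
Hypothesis G0I : setI_closed G0.
Hypothesis G0T : G0 setT.
Hypothesis mxi : measurable_fun setT xi.
Hypothesis indep : forall E B, G0 E -> measurable B ->
  mu (E `&` xi @^-1` B) = mu E * pi B.

Local Notation T0 := (g_sigma_algebraType G0).

Lemma g_sigma_sub_measurable (E : set Omega) :
  <<s G0 >> E -> measurable E.
Proof. exact: smallest_sub (@sigma_algebra_measurable _ Omega) G0m E. Qed.

(** Both sides are finite measures in [E] that agree on a pi-system. *)
Lemma indep_g_sigma (E : set Omega) (B : set S) :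
  <<s G0 >> E -> measurable B -> mu (E `&` xi @^-1` B) = mu E * pi B.
Proof.
move=> sE mB.
have mxB : measurable (xi @^-1` B) by rewrite -[X in measurable X]setTI; exact: mxi.
pose H := [set A | measurable A /\ mu (A `&` xi @^-1` B) = mu A * pi B].
suff : <<s G0 >> `<=` H by move=> /(_ _ sE)[].
apply: lambda_system_subset => //; last by move=> A GA; split; [exact: G0m|exact: indep].
split => //.
- by split; [exact: measurableT | exact: indep].
- move=> A C AC [mA eA] [mC eC]; split; first exact: measurableD.
  have mAx := measurableI _ _ mA mxB; have mCx := measurableI _ _ mC mxB.
  have finA D : measurable D -> mu D < +oo.
    by move=> mD; rewrite ltey_eq fin_num_measure.
  rewrite (_ : (A `\` C) `&` _ = (A `&` xi @^-1` B) `\` (C `&` xi @^-1` B));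
    last first.
    by apply/seteqP; split => w /=; tauto.
  rewrite (measureD mAx mCx (finA _ mAx)).
  rewrite [A `&` _ `&` _](_ : _ = C `&` xi @^-1` B); last first.
    apply/seteqP; split => w /=; first by tauto.
    by move=> [Cw xw]; split => //; split => //; exact: AC.
  rewrite [X in X - _]eA [X in _ - X]eC (measureD mA mC (finA _ mA)) setIidr//.
  by rewrite muleBl// ?fin_num_adde_defr ?fin_num_measure.
- move=> A ndA HA; split; first by apply: bigcup_measurable => n _; case: (HA n).
  have mA n : measurable (A n) by case: (HA n).
  have ndI : nondecreasing_seq (fun n => A n `&` xi @^-1` B).
    by move=> p q pq; apply/subsetPset; apply: setSI; apply/subsetPset/ndA.
  have c1 : mu (A n `&` xi @^-1` B) @[n --> \oo]
      --> mu (\bigcup_n (A n `&` xi @^-1` B)).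
    apply: nondecreasing_cvg_mu => // [n|]; first exact: measurableI.
    by apply: bigcupT_measurable => n; exact: measurableI.
  have c2 : mu (A n) * pi B @[n --> \oo] --> mu (\bigcup_n A n) * pi B.
    apply: cvgeZr; first by rewrite fin_num_measure.
    apply: nondecreasing_cvg_mu => //.
    exact: bigcupT_measurable.
  have c3 : mu (A n `&` xi @^-1` B) @[n --> \oo] --> mu (\bigcup_n A n) * pi B.
    rewrite (_ : (fun n => _) = (fun n => mu (A n) * pi B))//.
    by apply/funext => n; exact: (HA n).2.
  rewrite setI_bigcupl; exact: cvg_unique c1 c3.
Qed.

(** What is measurable with respect to the past is measurable. *)
Lemma measurable_forget : measurable_fun setT (id : Omega -> T0).
Proof. by move=> _ A mA; rewrite setTI; exact: g_sigma_sub_measurable. Qed.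

Lemma freezing_pi_system (Phi : T0 * S -> \bar R) :
  measurable_fun setT Phi -> (forall z, 0 <= Phi z) ->
  \int[mu]_w Phi (w, xi w) = \int[mu]_w \int[pi]_s Phi (w, s).
Proof.
pose f : {mfun Omega >-> T0} :=
  HB.pack (id : Omega -> T0) (isMeasurableFun.Build _ _ _ _ _ measurable_forget).
move=> mPhi Phi0; apply: (@freezing _ _ _ _ _ _ _ mu pi f xi) => // E B mE mB.
exact: indep_g_sigma.
Qed.

Lemma indep_product_pi_system (p : S -> R) (q : T0 -> R) (a b : R) :
  measurable_fun setT p -> measurable_fun setT q ->
  (forall s, `|p s| <= a)%R -> (forall w, `|q w| <= b)%R ->
  (\int[mu]_w (p (xi w) * q w) = (\int[pi]_s p s) * (\int[mu]_w q w))%R.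
Proof.
pose f : {mfun Omega >-> T0} :=
  HB.pack (id : Omega -> T0) (isMeasurableFun.Build _ _ _ _ _ measurable_forget).
move=> mp mq pa qb; apply: (@indep_product _ _ _ _ _ _ _ mu pi f xi _ _ _ _ a b) => // E B mE mB.
exact: indep_g_sigma.
Qed.

End PiSystem.

(** * Joint measurability of functions that are continuous in one argument *)

Section Caratheodory.
Context {R : realType}.

(** Continuity in the Euclidean norms, so that the Lipschitz bounds apply
    to it directly. *)
Definition econtinuous {n m} (phi : 'cV[R]_n -> 'cV[R]_m -> R) :=
  forall x y (e : R), 0 < e -> exists2 r : R, 0 < r & forall x' y',
    enorm (x' - x) <= r -> enorm (y' - y) <= r -> `|phi x' y' - phi x y| <= e.

Lemma enorm_le_sum n (u : 'cV[R]_n) : enorm u <= \sum_i `|u i 0|.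
Proof.
rewrite {1}(col_sum_delta u); elim/big_rec2: _ => [|i a v _ h]; first by rewrite enorm0.
rewrite (le_trans (enormD_le _ _))// enormZ enorm_delta mulr1 lerD//.
Qed.

Lemma lipschitz_econtinuous n m (phi : 'cV[R]_n -> 'cV[R]_m -> R) (k : R) :
  0 <= k ->
  (forall x y x' y', `|phi x y - phi x' y'| <= k * enorm_pair (x - x') (y - y')) ->
  econtinuous phi.
Proof.
move=> k0 lip x y e e0; have k1 : 0 < k + 1 by rewrite ltr_wpDl.
exists (e / (k + 1) / 2) => [|x' y' hx hy]; first by rewrite !divr_gt0.
rewrite (le_trans (lip _ _ _ _))//.
apply: (@le_trans _ _ ((k + 1) * (e / (k + 1)))).
  rewrite ler_pM// ?enorm_pair_ge0 ?lerDl//.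
  by rewrite (le_trans (enorm_pair_le _ _))// [leRHS]splitr lerD.
by rewrite mulrC divfK// gt_eqF.
Qed.

Context {d d' : measure_display} {T : measurableType d} {S : measurableType d'}.

Lemma measurable_countable_case (I : countType) (c : T -> I) (psi : I -> S -> R) :
  (forall i, measurable (c @^-1` [set i])) ->
  (forall i, measurable_fun setT (psi i)) ->
  measurable_fun setT (fun z : T * S => psi (c z.1) z.2).
Proof.
move=> mc mpsi _ B mB; rewrite setTI.
rewrite [X in measurable X](_ : _ =
    \bigcup_i ((c @^-1` [set i]) `*` (psi i @^-1` B))).
  apply: countable_bigcupT_measurable => [|i]; first exact: countableP.
  by apply: measurableX => //; rewrite -[X in measurable X]setTI; exact: mpsi.
apply/seteqP; split => [[w s] /= Bz|[w s] [i _] [/= -> ]//].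
by exists (c w).
Qed.

Lemma measurable_grid n (x : T -> 'cV[R]_n) (k : nat) (a : 'cV[int]_n) :
  (forall i, measurable_fun setT (fun w => x w i 0)) ->
  measurable [set w | \col_i Num.floor (k.+1%:R * x w i 0) = a].
Proof.
move=> mx.
rewrite [X in measurable X](_ : _ = \bigcap_(i in [set: 'I_n])
  ((fun w => k.+1%:R * x w i 0) @^-1` `[(a i 0)%:~R, (a i 0 + 1)%:~R[%classic)).
  apply: fin_bigcap_measurable => // i _.
  rewrite -[X in measurable X]setTI.
  by apply: (measurable_funM (measurable_cst _) (mx i)).
apply/seteqP; split => w /=.
  by move=> <- i _ /=; rewrite mxE in_itv/= Num.Theory.floor_itv ?num_real.
move=> h; apply/matrixP => i j; rewrite ord1 mxE; apply: floor_def.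
by have := h i I; rewrite /= in_itv.
Qed.

(** Rounding [x] and [y] to a grid of mesh [1 / (k + 1)] leaves countably many
    values, for each of which measurability in [s] is assumed; continuity lets
    [k] tend to infinity. *)
Lemma caratheodory n m (x : T -> 'cV[R]_n) (y : T -> 'cV[R]_m)
    (phi : S -> 'cV[R]_n -> 'cV[R]_m -> R) :
  (forall i, measurable_fun setT (fun w => x w i 0)) ->
  (forall i, measurable_fun setT (fun w => y w i 0)) ->
  (forall u v, measurable_fun setT (fun s => phi s u v)) ->
  (forall s, econtinuous (phi s)) ->
  measurable_fun setT (fun z : T * S => phi z.2 (x z.1) (y z.1)).
Proof.
move=> mx my mphi cphi.
pose code p (k : nat) (u : 'cV[R]_p) : 'cV[int]_p :=
  \col_i Num.floor (k.+1%:R * u i 0).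
pose decode p (k : nat) (a : 'cV[int]_p) : 'cV[R]_p :=
  \col_i ((a i 0)%:~R / k.+1%:R).
have close p k (u : 'cV[R]_p) : enorm (decode p k (code p k u) - u) <= p%:R / k.+1%:R.
  rewrite (le_trans (enorm_le_sum _))//.
  rewrite -[X in X%:R / _](card_ord p) -sum1_card natr_sum mulr_suml.
  apply: ler_sum => i _; rewrite !mxE mul1r.
  have k0 : 0 < k.+1%:R :> R by rewrite ltr0n.
  rewrite -(ler_pM2l k0) mulfV ?gt_eqF// -{1}(gtr0_norm k0) -normrM.
  rewrite mulrBr mulrCA mulfV ?gt_eqF// mulr1.
  have /andP[h1 h2] := floor_itv (k.+1%:R * u i 0).
  rewrite intrD in h2.
  by rewrite ler_norml; apply/andP; split; lra.
apply: (@measurable_fun_cvg _ _ _ _ (fun k z =>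
   phi z.2 (decode n k (code n k (x z.1))) (decode m k (code m k (y z.1))))).
  move=> k.
  pose c w := (code n k (x w), code m k (y w)).
  pose psi (i : 'cV[int]_n * 'cV[int]_m) s := phi s (decode n k i.1) (decode m k i.2).
  apply: (@measurable_countable_case _ c psi) => [[a b]|[a b]]; last exact: mphi.
  rewrite [X in measurable X](_ : _ = [set w | code n k (x w) = a] `&`
     [set w | code m k (y w) = b]); last first.
    by apply/seteqP; split => w /= [e1 e2]; [split|congr (_, _)].
  by apply: measurableI; apply: measurable_grid.
move=> z _; apply/cvgrPdist_le => e e0.
have [r r0 hr] := cphi z.2 (x z.1) (y z.1) e e0.
near=> k.
have hk : (n + m)%:R / r <= k.+1%:R.
  near: k; exists (Num.truncn ((n + m)%:R / r)).+1 => // k /= hk.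
  rewrite ltW// (lt_le_trans (truncnS_gt _))// ler_nat.
  exact: leq_trans hk (leqnSn k).
rewrite ler_pdivrMr// mulrC -ler_pdivrMr ?ltr0n// in hk.
rewrite distrC; apply: hr.
  rewrite (le_trans (close _ _ _))// (le_trans _ hk)// ler_pM2r ?invr_gt0 ?ltr0n//.
  by rewrite ler_nat leq_addr.
rewrite (le_trans (close _ _ _))// (le_trans _ hk)// ler_pM2r ?invr_gt0 ?ltr0n//.
by rewrite ler_nat leq_addl.
Unshelve. all: by end_near. Qed.

End Caratheodory.

(** * Independence of the past and of a fresh sample *)

Section Past.
Context {R : realType} {d : measure_display} {Omega : measurableType d}.
Variables (P : probability Omega R) (I : choiceType) (F : I -> set_system Omega).
Hypothesis indep : mutually_independent P F.
Hypothesis FI : forall i, setI_closed (F i).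
Hypothesis FT : forall i, F i setT.
Hypothesis Fm : forall i E, F i E -> measurable E.

(** A pi-system that generates the sigma-algebra of the families with index
    in [A]. *)
Definition past (A : set I) : set (set Omega) :=
  [set E | exists (J : {fset I}) (E' : I -> set Omega),
    [/\ forall i, i \in J -> A i, forall i, F i (E' i) &
        E = \bigcap_(i in [set` J]) E' i]].

Lemma past_measurable A : past A `<=` measurable.
Proof.
move=> _ [J [E [_ FE ->]]].
by apply: fin_bigcap_measurable => // i _; exact: Fm.
Qed.

Lemma past_setT A : past A setT.
Proof.
exists fset0, (fun=> setT); split => //.
by apply/seteqP; split => // w _ i /=.
Qed.

Lemma past_setI A : setI_closed (past A).
Proof.
move=> _ _ [J1 [E1 [A1 F1 ->]]] [J2 [E2 [A2 F2 ->]]].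
exists (J1 `|` J2)%fset, (fun i =>
  (if i \in J1 then E1 i else setT) `&` (if i \in J2 then E2 i else setT)).
split => [i|i|].
- by rewrite in_fsetU => /orP[/A1|/A2].
- by apply: FI; case: ifP.
apply/seteqP; split => [w [h1 h2] i _|w h].
  by split; case: ifPn => // iJ; [exact: h1|exact: h2].
split => i /= iJ.
  by have := h i; rewrite /= in_fsetU iJ => /(_ isT)[].
by have := h i; rewrite /= in_fsetU iJ orbT => /(_ isT)[_].
Qed.

Lemma past_mem A i E : A i -> F i E -> past A E.
Proof.
move=> Ai FE.
exists [fset i]%fset, (fun j => if j == i then E else setT); split => [j|j|].
- by rewrite in_fset1 => /eqP ->.
- by case: eqP => [->|].
apply/seteqP; split => [w wE j /=|w /(_ i)/=].
  by rewrite in_fset1 => /eqP ->; rewrite eqxx.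
by rewrite in_fset1 eqxx; apply.
Qed.

Lemma past_subset A B : A `<=` B -> past A `<=` past B.
Proof.
by move=> AB _ [J [E [JA FE ->]]]; exists J, E; split => // i /JA/AB.
Qed.

(** Mutual independence, applied once to [i |` J] and once to [J]. *)
Lemma past_indep A i E C : ~ A i -> past A E -> F i C ->
  P (E `&` C) = (P E * P C)%E.
Proof.
move=> Ai [J [E' [JA FE ->]]] FC.
have iJ : i \notin J by apply/negP => /JA.
pose E1 j := if j == i then C else E' j.
have PJ : P (\bigcap_(j in [set` J]) E' j) = (\prod_(j <- J) P (E' j))%E.
  by apply: indep => j _; exact: FE.
have : P (\bigcap_(j in [set` (i |` J)%fset]) E1 j)
    = (\prod_(j <- (i |` J)%fset) P (E1 j))%E.
  by apply: indep => j _; rewrite /E1; case: eqP => [->|].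
have E1i : E1 i = C by rewrite /E1 eqxx.
have E1J : (\prod_(j <- J) P (E1 j) = \prod_(j <- J) P (E' j))%E.
  by apply: eq_big_seq => j jJ; rewrite /E1; case: eqP iJ => // <-; rewrite jJ.
rewrite big_fsetU1//= E1i E1J -PJ muleC => e.
rewrite -e; congr (P _); apply/seteqP; split => w /=.
  move=> [wE wC] j; rewrite /= in_fset1U /E1; case: eqP => //= _ jJ.
  exact: wE.
move=> h; split; last by have := h i; rewrite /= in_fset1U /E1 eqxx; apply.
move=> j jJ; have := h j; rewrite /= in_fset1U /E1 jJ orbT => /(_ isT).
by case: eqP iJ => // <-; rewrite jJ.
Qed.

End Past.

(** * Second moments of random vectors *)

Section IntegralBound.
Context {R : realType} {d : measure_display} {S : measurableType d}.
Variable pi : probability S R.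

Lemma integral_le_affine (u v w : S -> R) (a b k A B : R) :
  measurable_fun setT u -> measurable_fun setT v -> measurable_fun setT w ->
  (forall s, 0 <= u s) -> (forall s, 0 <= v s) -> (forall s, 0 <= w s) ->
  0 <= a -> 0 <= b -> 0 <= k ->
  (\int[pi]_s (u s)%:E <= A%:E)%E -> (\int[pi]_s (v s)%:E <= B%:E)%E ->
  (forall s, w s <= k + a * u s + b * v s) ->
  (\int[pi]_s (w s)%:E <= (k + a * A + b * B)%:E)%E.
Proof.
move=> mu mv mw u0 v0 w0 a0 b0 k0 uA vB h.
have mEu : measurable_fun setT (EFin \o u) by exact/measurable_EFinP.
have mEv : measurable_fun setT (EFin \o v) by exact/measurable_EFinP.
have mEw : measurable_fun setT (EFin \o w) by exact/measurable_EFinP.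
have pu s : (0 <= (u s)%:E)%E by rewrite lee_fin.
have pv s : (0 <= (v s)%:E)%E by rewrite lee_fin.
have pk : (0 <= k%:E)%E by rewrite lee_fin.
have pa : (0 <= a%:E)%E by rewrite lee_fin.
have pb : (0 <= b%:E)%E by rewrite lee_fin.
have mau : measurable_fun setT (fun s => a%:E * (u s)%:E)%E.
  by apply: emeasurable_funM.
have mbv : measurable_fun setT (fun s => b%:E * (v s)%:E)%E.
  by apply: emeasurable_funM.
have mka : measurable_fun setT (fun s => k%:E + a%:E * (u s)%:E)%E.
  by apply: emeasurable_funD.
apply: (@le_trans _ _ (\int[pi]_s (k%:E + a%:E * (u s)%:E + b%:E * (v s)%:E))%E).
  apply: ge0_le_integral => //.
  - by move=> s _; rewrite lee_fin.
  - exact: emeasurable_funD.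
  - by move=> s _; rewrite -!EFinM -!EFinD lee_fin.
rewrite ge0_integralD//; last 2 first.
- by move=> s _; rewrite adde_ge0// mule_ge0.
- by move=> s _; rewrite mule_ge0.
rewrite ge0_integralD//; last first.
- by move=> s _; rewrite mule_ge0.
rewrite integral_cst//= probability_setT mule1 !ge0_integralZl//.
by rewrite !EFinD !EFinM leeD// ?leeD// lee_wpmul2l.
Qed.

End IntegralBound.

Section SecondMoment.
Context {R : realType} {d : measure_display} {S : measurableType d}.
Variable pi : probability S R.

Lemma mean_mxE p q (A : S -> 'M[R]_(p, q)) i j :
  integrable_mx pi A -> (\int[pi]_s (A s i j)%:E)%E = (mean_mx pi A i j)%:E.
Proof.
by move=> iA; rewrite mxE unlock fineK//; exact: integrable_fin_num.
Qed.

Lemma integrable_mxD p q (A B : S -> 'M[R]_(p, q)) :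
  integrable_mx pi A -> integrable_mx pi B ->
  integrable_mx pi (fun s => A s + B s).
Proof.
move=> iA iB i j.
rewrite (_ : (fun s => _) = (fun s => (A s i j)%:E + (B s i j)%:E)%E).
  exact: integrableD.
by apply/funext => s; rewrite mxE.
Qed.

Lemma mean_mxD p q (A B : S -> 'M[R]_(p, q)) :
  integrable_mx pi A -> integrable_mx pi B ->
  mean_mx pi (fun s => A s + B s) = mean_mx pi A + mean_mx pi B.
Proof.
move=> iA iB; apply/matrixP => i j; apply: EFin_inj.
rewrite -mean_mxE; last exact: integrable_mxD.
rewrite mxE EFinD -!mean_mxE// -integralD//.
by apply: eq_integral => s _; rewrite mxE.
Qed.

Lemma integrable_mx_cst p q (a : 'M[R]_(p, q)) : integrable_mx pi (fun=> a).
Proof. by move=> i j; exact: finite_measure_integrable_cst. Qed.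

Lemma mean_mx_cst p q (a : 'M[R]_(p, q)) : mean_mx pi (fun=> a) = a.
Proof.
apply/matrixP => i j; apply: EFin_inj.
rewrite -mean_mxE; last exact: integrable_mx_cst.
by rewrite integral_cst//= probability_setT mule1.
Qed.

Lemma integrable_mxZ p q (A : S -> 'M[R]_(p, q)) (k : R) :
  integrable_mx pi A -> integrable_mx pi (fun s => k *: A s).
Proof.
move=> iA i j; rewrite (_ : (fun s => _) = (fun s => k%:E * (A s i j)%:E)%E).
  exact: integrableZl.
by apply/funext => s; rewrite mxE.
Qed.

Lemma mean_mxZ p q (A : S -> 'M[R]_(p, q)) (k : R) : integrable_mx pi A ->
  mean_mx pi (fun s => k *: A s) = k *: mean_mx pi A.
Proof.
move=> iA; apply/matrixP => i j; apply: EFin_inj.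
rewrite -mean_mxE; last exact: integrable_mxZ.
rewrite mxE EFinM -mean_mxE// -integralZl//.
by apply: eq_integral => s _; rewrite mxE.
Qed.

Lemma integrable_mxB p q (A B : S -> 'M[R]_(p, q)) :
  integrable_mx pi A -> integrable_mx pi B ->
  integrable_mx pi (fun s => A s - B s).
Proof.
move=> iA iB; have := integrable_mxD iA (integrable_mxZ (-1) iB).
by congr (integrable_mx _ _); apply/funext => s; rewrite scaleN1r.
Qed.

Lemma mean_mxB p q (A B : S -> 'M[R]_(p, q)) :
  integrable_mx pi A -> integrable_mx pi B ->
  mean_mx pi (fun s => A s - B s) = mean_mx pi A - mean_mx pi B.
Proof.
move=> iA iB; rewrite -scaleN1r -mean_mxZ// -mean_mxD//; last exact: integrable_mxZ.
by congr mean_mx; apply/funext => s; rewrite scaleN1r.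
Qed.

Lemma integrable_dot n (a : 'cV[R]_n) (X : S -> 'cV[R]_n) :
  integrable_mx pi X -> pi.-integrable setT (fun s => (dot a (X s))%:E).
Proof.
move=> iX; rewrite (_ : (fun s => _) = (fun s => \sum_i ((a i 0)%:E * (X s i 0)%:E))%E).
  by apply: integrable_sum => // i _; exact: integrableZl.
by apply/funext => s; rewrite /dot -sumEFin.
Qed.

Lemma mean_dot n (a : 'cV[R]_n) (X : S -> 'cV[R]_n) : integrable_mx pi X ->
  (\int[pi]_s (dot a (X s))%:E)%E = (dot a (mean_mx pi X))%:E.
Proof.
move=> iX.
transitivity (\int[pi]_s (\sum_i ((a i 0)%:E * (X s i 0)%:E)))%E.
  by apply: eq_integral => s _; rewrite /dot -sumEFin.
rewrite integral_sum//; last by move=> i; exact: integrableZl.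
rewrite /dot -sumEFin; apply: eq_bigr => i _.
by rewrite integralZl// mean_mxE.
Qed.

Lemma measurable_enorm2 d' (T : measurableType d') n (X : T -> 'cV[R]_n) :
  (forall i, measurable_fun setT (fun s => X s i 0)) ->
  measurable_fun setT (fun s => enorm (X s) ^+ 2).
Proof.
move=> mX; rewrite (_ : (fun s => _) = (fun s => \sum_i X s i 0 ^+ 2)).
  by apply: measurable_sum => i; exact: measurable_funX.
by apply/funext => s; rewrite enorm2; apply: eq_bigr => i _; rewrite expr2.
Qed.

Lemma measurable_integrable_mx p q (A : S -> 'M[R]_(p, q)) i j :
  integrable_mx pi A -> measurable_fun setT (fun s => A s i j).
Proof. by move=> /(_ i j)/measurable_int/measurable_EFinP. Qed.

(** A centered vector is orthogonal to constants. *)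
Lemma second_moment_shift n (a : 'cV[R]_n) (X : S -> 'cV[R]_n) :
  integrable_mx pi X -> mean_mx pi X = 0 ->
  (\int[pi]_s (enorm (X s) ^+ 2)%:E < +oo)%E ->
  (\int[pi]_s (enorm (a + X s) ^+ 2)%:E
   = (enorm a ^+ 2)%:E + \int[pi]_s (enorm (X s) ^+ 2)%:E)%E.
Proof.
move=> iX X0 Xfin.
have i2 : pi.-integrable setT (fun s => (enorm (X s) ^+ 2)%:E).
  apply/integrableP; split.
    by apply/measurable_EFinP/measurable_enorm2 => i; exact: measurable_integrable_mx.
  by under eq_integral do rewrite gee0_abs ?lee_fin ?sqr_ge0//.
transitivity (\int[pi]_s (((enorm a ^+ 2)%:E + (2 : R)%:E * (dot a (X s))%:E)
   + (enorm (X s) ^+ 2)%:E))%E.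
  by apply: eq_integral => s _; rewrite enorm_sqD !EFinD EFinM.
have ic : pi.-integrable setT (fun=> (enorm a ^+ 2)%:E).
  exact: finite_measure_integrable_cst.
have id2 : pi.-integrable setT (fun s => (2 : R)%:E * (dot a (X s))%:E)%E.
  by apply: integrableZl => //; exact: integrable_dot.
rewrite integralD//; last exact: integrableD.
rewrite integralD// integralZl//; last exact: integrable_dot.
rewrite mean_dot// X0 dot0r mule0 adde0.
by rewrite integral_cst//= probability_setT mule1.
Qed.

(** Bias-variance decomposition.  The bound on the second moment makes the
    centered one finite, as [second_moment_shift] requires. *)
Lemma second_moment_split n (X : S -> 'cV[R]_n) (v : R) :
  integrable_mx pi X ->
  (\int[pi]_s (enorm (X s) ^+ 2)%:E <= v%:E)%E ->
  (\int[pi]_s (enorm (X s) ^+ 2)%:E = (enorm (mean_mx pi X) ^+ 2)%:E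
    + \int[pi]_s (enorm (X s - mean_mx pi X) ^+ 2)%:E)%E.
Proof.
move=> iX Xv; set mu := mean_mx pi X.
have iC : integrable_mx pi (fun s => X s - mu).
  exact: integrable_mxB (integrable_mx_cst _).
have mC : mean_mx pi (fun s => X s - mu) = 0.
  by rewrite mean_mxB// ?mean_mx_cst ?subrr//; exact: integrable_mx_cst.
have mX n0 (Y : S -> 'cV[R]_n0) : integrable_mx pi Y ->
    measurable_fun setT (fun s => enorm (Y s) ^+ 2).
  by move=> iY; apply: measurable_enorm2 => i; exact: measurable_integrable_mx.
have k0 : 0 <= 2 * enorm mu ^+ 2 by rewrite mulr_ge0// sqr_ge0.
have := integral_le_affine (mX _ _ iX) (measurable_cst (0 : R)) (mX _ _ iC)
  (fun s => sqr_ge0 _) (fun=> lexx 0) (fun s => sqr_ge0 _) (ler0n R 2) (lexx 0) k0 Xv.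
rewrite integral0 => /(_ 0 (lexx _)) Cle.
have Cfin : (\int[pi]_s (enorm (X s - mu) ^+ 2)%:E < +oo)%E.
  apply: le_lt_trans (Cle _) (ltry _) => s.
  by rewrite (le_trans (enorm_sqD2 _ _))// enormN; lra.
rewrite -(second_moment_shift mu iC mC Cfin).
by apply: eq_integral => s _; rewrite addrC subrK.
Qed.

Lemma second_moment_centered n (X : S -> 'cV[R]_n) (v : R) :
  integrable_mx pi X ->
  (\int[pi]_s (enorm (X s) ^+ 2)%:E <= v%:E)%E ->
  (\int[pi]_s (enorm (X s - mean_mx pi X) ^+ 2)%:E <= v%:E)%E.
Proof.
move=> iX Xv; apply: le_trans (Xv); rewrite (second_moment_split iX Xv).
by rewrite leeDr// lee_fin sqr_ge0.
Qed.

Lemma enorm_mean_sq_le n (X : S -> 'cV[R]_n) (v : R) :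
  integrable_mx pi X ->
  (\int[pi]_s (enorm (X s) ^+ 2)%:E <= v%:E)%E ->
  enorm (mean_mx pi X) ^+ 2 <= v.
Proof.
move=> iX Xv; rewrite -lee_fin; apply: le_trans (Xv).
rewrite (second_moment_split iX Xv) leeDl//.
by apply: integral_ge0 => s _; rewrite lee_fin sqr_ge0.
Qed.

End SecondMoment.

(** * Products of contractions *)

Section Products.
Context {R : realType} {m : nat}.
Implicit Types (M : nat -> 'M[R]_m) (v : 'cV[R]_m) (r e : R).

Lemma prod_mulmx_ltn M a k : \big[mulmx/1%:M]_(a <= i < a + k.+1) M i
  = M a *m \big[mulmx/1%:M]_(a.+1 <= i < a.+1 + k) M i.
Proof. by rewrite big_ltn ?addnS ?addSn// ltnS leq_addr. Qed.

Lemma enorm_prod_le M r a k v :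
  0 <= r -> (forall i u, enorm (M i *m u) <= r * enorm u) ->
  enorm (\big[mulmx/1%:M]_(a <= i < a + k) M i *m v) <= r ^+ k * enorm v.
Proof.
move=> r0 Mr; elim: k a => [|k IH] a.
  by rewrite addn0 big_geq// mul1mx expr0 mul1r.
rewrite prod_mulmx_ltn -mulmxA (le_trans (Mr _ _))// exprS -mulrA.
by rewrite ler_wpM2l.
Qed.

(** Each of the [k] differences that replace one factor at a time has [k - 1]
    contractions besides it. *)
Lemma enorm_prod_sub_le M M' r e a k v :
  0 <= r -> 0 <= e -> (forall i u, enorm (M i *m u) <= r * enorm u) ->
  (forall i u, enorm (M' i *m u) <= r * enorm u) ->
  (forall i u, enorm ((M i - M' i) *m u) <= e * enorm u) ->
  enorm ((\big[mulmx/1%:M]_(a <= i < a + k) M i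
          - \big[mulmx/1%:M]_(a <= i < a + k) M' i) *m v)
  <= k%:R * r ^+ k.-1 * e * enorm v.
Proof.
move=> r0 e0 Mr Mr' Me; elim: k a => [|k IH] a.
  by rewrite addn0 !big_geq// subrr mul0mx enorm0 !mul0r.
rewrite !prod_mulmx_ltn; have {IH} := IH a.+1; have := enorm_prod_le a.+1 k v r0 Mr.
move: (\big[_/_]_(_ <= _ < _) M _) (\big[_/_]_(_ <= _ < _) M' _) => Q Q' hQ IH.
have -> : (M a *m Q - M' a *m Q') *m v
    = (M a - M' a) *m (Q *m v) + M' a *m ((Q - Q') *m v).
  by rewrite !mulmxBl !mulmxBr !mulmxA addrA subrK.
rewrite (le_trans (enormD_le _ _))//.
have h1 : enorm ((M a - M' a) *m (Q *m v)) <= r ^+ k * e * enorm v.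
  by rewrite (le_trans (Me _ _))// (mulrC _ e) -mulrA ler_wpM2l.
have h2 : enorm (M' a *m ((Q - Q') *m v)) <= k%:R * r ^+ k * e * enorm v.
  rewrite (le_trans (Mr' _ _))//; have := ler_wpM2l r0 IH; move/le_trans; apply.
  case: k {hQ IH h1} => [|k]; first by rewrite !mul0r mulr0.
  by rewrite /= exprS le_eqVlt; apply/predU1P; left; ring.
by rewrite /= -natr1 (le_trans (lerD h1 h2))// le_eqVlt; apply/predU1P; left; ring.
Qed.

End Products.

(** * Measurable matrices *)

Section MeasurableMx.
Context {R : realType} {d : measure_display} {T : measurableType d}.

Definition measurable_mx {p q} (A : T -> 'M[R]_(p, q)) :=
  forall i j, measurable_fun setT (fun s => A s i j).

Lemma measurable_mx_cst p q (a : 'M[R]_(p, q)) : measurable_mx (fun=> a).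
Proof. by move=> i j; exact: measurable_cst. Qed.

Lemma measurable_mxD p q (A B : T -> 'M[R]_(p, q)) :
  measurable_mx A -> measurable_mx B -> measurable_mx (fun s => A s + B s).
Proof.
move=> mA mB i j; rewrite (_ : (fun s => _) = (fun s => A s i j + B s i j)).
  exact: measurable_funD.
by apply/funext => s; rewrite mxE.
Qed.

Lemma measurable_mxZ p q (k : T -> R) (A : T -> 'M[R]_(p, q)) :
  measurable_fun setT k -> measurable_mx A -> measurable_mx (fun s => k s *: A s).
Proof.
move=> mk mA i j; rewrite (_ : (fun s => _) = (fun s => k s * A s i j)).
  exact: measurable_funM.
by apply/funext => s; rewrite mxE.
Qed.

Lemma measurable_mxN p q (A : T -> 'M[R]_(p, q)) :
  measurable_mx A -> measurable_mx (fun s => - A s).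
Proof.
move=> mA; rewrite (_ : (fun s => _) = (fun s => (-1) *: A s)).
  by apply: measurable_mxZ.
by apply/funext => s; rewrite scaleN1r.
Qed.

Lemma measurable_mxB p q (A B : T -> 'M[R]_(p, q)) :
  measurable_mx A -> measurable_mx B -> measurable_mx (fun s => A s - B s).
Proof. by move=> mA mB; apply: measurable_mxD => //; exact: measurable_mxN. Qed.

Lemma measurable_mxM p q r (A : T -> 'M[R]_(p, q)) (B : T -> 'M[R]_(q, r)) :
  measurable_mx A -> measurable_mx B -> measurable_mx (fun s => A s *m B s).
Proof.
move=> mA mB i j.
rewrite (_ : (fun s => _) = (fun s => \sum_l A s i l * B s l j)).
  by apply: measurable_sum => l; exact: measurable_funM.
by apply/funext => s; rewrite mxE.
Qed.

Lemma measurable_mx_prod m (M : nat -> T -> 'M[R]_m) a b :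
  (forall i, (a <= i < b)%N -> measurable_mx (M i)) ->
  measurable_mx (fun s => \big[mulmx/1%:M]_(a <= i < b) M i s).
Proof.
have [ba _|ab] := leqP b a.
  rewrite (_ : (fun s => _) = (fun=> 1%:M)); first exact: measurable_mx_cst.
  by apply/funext => s; rewrite big_geq.
have [k ->] : exists k, b = (a + k)%N by exists (b - a)%N; rewrite subnKC// ltnW.
elim: k a {b ab} => [|k IH] a mM.
  rewrite (_ : (fun s => _) = (fun=> 1%:M)); first exact: measurable_mx_cst.
  by apply/funext => s; rewrite addn0 big_geq.
rewrite (_ : (fun s => _) = (fun s => M a s *m
    \big[mulmx/1%:M]_(a.+1 <= i < a.+1 + k) M i s)); last first.
  by apply/funext => s; rewrite (prod_mulmx_ltn (fun i => M i s)).
apply: measurable_mxM; first by apply: mM; rewrite leqnn addnS ltnS leq_addr.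
by apply: IH => i /andP[h1 h2]; apply: mM; rewrite (ltnW h1) addnS -addSn.
Qed.

End MeasurableMx.

Lemma measurable_mx_enorm2 {R : realType} d (T : measurableType d) p (A : T -> 'cV[R]_p) :
  measurable_mx A -> measurable_fun setT (fun s => enorm (A s) ^+ 2).
Proof. by move=> mA; apply: measurable_enorm2 => i; exact: mA. Qed.

Lemma measurable_mx_comp {R : realType} d d' (T : measurableType d)
  (T' : measurableType d') p q (A : T' -> 'M[R]_(p, q)) (h : T -> T') :
  measurable_mx A -> measurable_fun setT h -> measurable_mx (fun s => A (h s)).
Proof. by move=> mA mh i j; exact: (measurableT_comp (mA i j) mh). Qed.

Section CaratheodoryMx.
Context {R : realType} {d d' : measure_display} {T : measurableType d}
  {S : measurableType d'} {n m p : nat}.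

Lemma caratheodory_mx (phi : S -> 'cV[R]_n -> 'cV[R]_m -> 'cV[R]_p)
    (x : T -> 'cV[R]_n) (y : T -> 'cV[R]_m) (s : T -> S) :
  (forall u v, measurable_mx (fun s => phi s u v)) ->
  (forall s i, econtinuous (fun u v => phi s u v i 0)) ->
  measurable_mx x -> measurable_mx y -> measurable_fun setT s ->
  measurable_mx (fun w => phi (s w) (x w) (y w)).
Proof.
move=> mphi cphi mx my ms i j; rewrite ord1.
have mj : measurable_fun setT
    (fun z : T * S => phi z.2 (x z.1) (y z.1) i 0).
  exact: (caratheodory (phi := fun s u v => phi s u v i 0)
    (fun i => mx i 0) (fun i => my i 0) (fun u v => mphi u v i 0) (fun s => cphi s i)).
have mg : measurable_fun setT (fun w : T => (w, s w)) by exact: measurable_fun_pair.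
exact: (measurableT_comp mj mg).
Qed.

End CaratheodoryMx.

(** * The joint law of one draw of the estimator *)

Section DrawLaw.
Context {R : realType} {d1 d2 : measure_display}.
Context {Xi : measurableType d1} {Z : measurableType d2}.
Variables (pi_f : probability Xi R) (pi_g : probability Z R) (K : nat).
Hypothesis K_gt0 : (0 < K)%N.
Local Notation S := (Xi * K.+1.-tuple Z * nat)%type.
Variable pibar : probability S R.
Hypothesis pibar_law : draw_law pi_f pi_g pibar.

Definition box (A : set Xi) (B : 'I_K.+1 -> set Z) (C : set nat) : set S :=
  (A `*` [set v | forall i, B i (tnth v i)]) `*` C.

Lemma measurable_zeta i : measurable_fun setT (fun s : S => tnth s.1.2 i).
Proof.
apply: (measurableT_comp (measurable_tnth i)).
exact: (measurableT_comp measurable_snd measurable_fst).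
Qed.

Lemma measurable_xi : measurable_fun setT (fun s : S => s.1.1).
Proof. exact: (measurableT_comp measurable_fst measurable_fst). Qed.

Lemma measurable_box A B C : measurable A -> (forall i, measurable (B i)) ->
  measurable (box A B C).
Proof.
move=> mA mB; apply: measurableX => //; apply: measurableX => //.
rewrite [X in measurable X](_ : _ =
  \bigcap_(i in [set: 'I_K.+1]) ((fun v : K.+1.-tuple Z => tnth v i) @^-1` B i)).
  apply: fin_bigcap_measurable => // i _.
  by rewrite -[X in measurable X]setTI; exact: measurable_tnth.
by apply/seteqP; split => v /= h i => [_|]; exact: h.
Qed.

Lemma boxI A B C A' B' C' : box A B C `&` box A' B' C'
  = box (A `&` A') (fun i => B i `&` B' i) (C `&` C').
Proof.
apply/seteqP; split => -[[x v] k] /=.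
  by move=> [[[? h] ?] [[? h'] ?]]; do ![split => //].
move=> [[[? ?] h] [? ?]]; split.
  by split => //; split => // i; case: (h i).
by split => //; split => // i; case: (h i).
Qed.

Lemma boxT : box setT (fun=> setT) setT = setT.
Proof. by apply/seteqP; split => // -[[]]. Qed.

(** The law of the index, written as a function of a set so that the law of
    the draw is a product on boxes with any third side. *)
Definition index_weight (C : set nat) : \bar R :=
  (\sum_(j < K) if (j : nat) \in C then K%:R^-1%:E else 0)%E.

Lemma index_weightT : index_weight setT = 1%E.
Proof.
rewrite /index_weight (eq_bigr (fun=> K%:R^-1%:E)) => [|j _]; last by rewrite in_setT.
rewrite sumEFin; congr (_%:E).
by rewrite sumr_const card_ord -[LHS]mulr_natl mulfV// pnatr_eq0 -lt0n.
Qed.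

Definition index_overflow : set S := [set s | (K <= s.2)%N].

Lemma measurable_index (C : set nat) : measurable [set s : S | C s.2].
Proof.
rewrite -[X in measurable X]setTI.
exact: (@measurable_snd _ _ (Xi * K.+1.-tuple Z)%type nat measurableT C).
Qed.

Lemma pibar_index j : (j < K)%N -> pibar [set s | s.2 = j :> nat] = K%:R^-1%:E.
Proof.
move=> jK; rewrite (_ : [set s | s.2 = j :> nat] = box setT (fun=> setT) [set j]).
  have := @pibar_law setT (fun=> setT) j measurableT (fun=> measurableT).
  rewrite jK probability_setT big1 ?mul1e => [|i _]; last exact: probability_setT.
  exact.
by apply/seteqP; split => -[[x v] k] //= [].
Qed.

Lemma pibar_split (E : set S) : measurable E ->
  (pibar (E `\` index_overflow) = \sum_(j < K) pibar (E `&` [set s | s.2 = j :> nat]))%E.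
Proof.
move=> mE; rewrite (_ : E `\` index_overflow
    = \big[setU/set0]_(j < K) (E `&` [set s | s.2 = j :> nat])).
  rewrite measure_bigsetU_ord// => [j|].
    by apply: measurableI => //; exact: (measurable_index [set j : nat]).
  apply/trivIsetP => i j _ _ /eqP ij; apply/seteqP; split => // s [[_ /= si] [_ /= sj]].
  by apply: ij; apply: val_inj; rewrite /= -si -sj.
rewrite -(bigcup_mkord K (fun j => E `&` [set s | s.2 = j :> nat])).
apply/seteqP; split => s /=.
  by move=> [Es /negP]; rewrite -ltnNge => sK; exists s.2.
move=> [j /= jK [Es sj]]; split => //; rewrite /index_overflow/= sj.
by apply/negP; rewrite -ltnNge.
Qed.

Lemma pibar_overflow : pibar index_overflow = 0%E.
Proof.
have mb : measurable index_overflow by exact: (measurable_index [set j | (K <= j)%N]).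
have : pibar (~` index_overflow) = 1%E.
  rewrite -setTD pibar_split// -index_weightT; apply: eq_bigr => j _.
  by rewrite setTI in_setT pibar_index.
rewrite probability_setC// => /eqP; rewrite -(fineK (fin_num_measure pibar _ mb)).
by rewrite -EFinB eqe subr_eq addrC -subr_eq subrr eq_sym => /eqP ->.
Qed.

(** The law is given on each value of the index; boxes with any set of indices
    follow by summation, because the values from [K] on are null. *)
Lemma pibar_box A B C : measurable A -> (forall i, measurable (B i)) ->
  pibar (box A B C) = (pi_f A * (\prod_(i < K.+1) pi_g (B i)) * index_weight C)%E.
Proof.
move=> mA mB; have mX := measurable_box C mA mB.
have mb : measurable index_overflow by exact: (measurable_index [set j | (K <= j)%N]).
rewrite (_ : pibar (box A B C) = pibar (box A B C `\` index_overflow)); last first.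
  have fX : (pibar (box A B C) < +oo)%E by rewrite ltey_eq fin_num_measure.
  have I0 : pibar (box A B C `&` index_overflow) = 0%E.
    apply/eqP; rewrite eq_le; apply/andP; split; last exact: measure_ge0.
    by rewrite -pibar_overflow; apply: le_measure; rewrite ?inE//; exact: measurableI.
  by rewrite (measureD mX mb fX) [X in (_ - X)%E]I0 sube0.
rewrite pibar_split//.
have ge0p : (0 <= pi_f A * \prod_(i < K.+1) pi_g (B i))%E.
  by apply: mule_ge0 => //; apply: prode_ge0 => i _.
rewrite /index_weight ge0_sume_distrr//; last first.
  by move=> j _; case: ifP => // _; rewrite lee_fin invr_ge0.
apply: eq_bigr => j _; case: ifPn => [|] jC.
  rewrite (_ : _ `&` _ = box A B [set (j : nat)]); last first.
    apply/seteqP; split => -[[x v] k] /= => [[[? _] ?]//|[? /= kj]].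
    by rewrite kj; split => //; split => //; rewrite inE in jC.
  by have := @pibar_law A B j mA mB; rewrite ltn_ord.
rewrite (_ : _ `&` _ = set0) ?measure0 ?mule0//.
apply/seteqP; split => // -[[x v] k] /= [[_ Ck] kj].
by move: jC; rewrite notin_setE -kj.
Qed.

(** These boxes form a pi-system for all the coordinates but [zeta^(i)], from
    which [zeta^(i)] is independent. *)
Definition boxes_off (i : 'I_K.+1) : set (set S) :=
  [set E | exists A B C, [/\ measurable A, forall l, measurable (B l),
    B i = setT & E = box A B C]].

(** The analogous pi-system for the coordinate [xi]. *)
Definition boxes_off_xi : set (set S) :=
  [set E | exists B C, (forall l, measurable (B l)) /\ E = box setT B C].

Lemma boxes_off_measurable i : boxes_off i `<=` measurable.
Proof. by move=> _ [A [B [C [mA mB _ ->]]]]; exact: measurable_box. Qed.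

Lemma boxes_off_setI i : setI_closed (boxes_off i).
Proof.
move=> _ _ [A [B [C [mA mB Bi ->]]]] [A' [B' [C' [mA' mB' Bi' ->]]]].
exists (A `&` A'), (fun l => B l `&` B' l), (C `&` C'); split.
- exact: measurableI.
- by move=> l; exact: measurableI.
- by rewrite Bi Bi' setIT.
- exact: boxI.
Qed.

Lemma boxes_off_setT i : boxes_off i setT.
Proof. by exists setT, (fun=> setT), setT; split => //; rewrite boxT. Qed.

Lemma boxes_off_indep i E B0 : boxes_off i E -> measurable B0 ->
  pibar (E `&` (fun s => tnth s.1.2 i) @^-1` B0) = (pibar E * pi_g B0)%E.
Proof.
move=> [A [B [C [mA mB Bi ->]]]] mB0.
pose B1 l := if l == i then B0 else B l.
rewrite (_ : _ `&` _ = box A B1 C); last first.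
  apply/seteqP; split => -[[x v] k] /=.
    move=> [[[? h] ?] h0]; split => //; split => // l.
    by rewrite /B1; case: eqP => [->|].
  move=> [[? h] ?]; split; last by have := h i; rewrite /B1 eqxx.
  split => //; split => // l; have := h l; rewrite /B1; case: eqP => // -> _.
  by rewrite Bi.
rewrite !pibar_box//; last by move=> l; rewrite /B1; case: eqP.
rewrite (bigD1 i)//= [in RHS](bigD1 i)//= {1}/B1 eqxx Bi probability_setT mul1e.
rewrite (eq_bigr (fun l => pi_g (B l))) => [|l /negPf li]; last by rewrite /B1 li.
by rewrite !muleA -(muleA _ _ (index_weight C)) muleAC muleC !muleA [in RHS]muleC !muleA.
Qed.

Lemma boxes_off_xi_measurable : boxes_off_xi `<=` measurable.
Proof. by move=> _ [B [C [mB ->]]]; exact: measurable_box. Qed.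

Lemma boxes_off_xi_setI : setI_closed boxes_off_xi.
Proof.
move=> _ _ [B [C [mB ->]]] [B' [C' [mB' ->]]].
exists (fun l => B l `&` B' l), (C `&` C'); split.
- by move=> l; exact: measurableI.
- by rewrite boxI setIT.
Qed.

Lemma boxes_off_xi_setT : boxes_off_xi setT.
Proof. by exists (fun=> setT), setT; split => //; rewrite boxT. Qed.

Lemma boxes_off_xi_indep E A0 : boxes_off_xi E -> measurable A0 ->
  pibar (E `&` (fun s => s.1.1) @^-1` A0) = (pibar E * pi_f A0)%E.
Proof.
move=> [B [C [mB ->]]] mA0.
rewrite (_ : _ `&` _ = box A0 B C); last first.
  by apply/seteqP; split => -[[x v] k] /= => [[[[_ ?] ?] ?]|[[? ?] ?]].
rewrite !pibar_box// probability_setT mul1e.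
by rewrite [in RHS]muleC muleA.
Qed.

Lemma pibar_xi A : measurable A -> pibar ((fun s => s.1.1) @^-1` A) = pi_f A.
Proof.
move=> mA; have := boxes_off_xi_indep boxes_off_xi_setT mA.
by rewrite setTI probability_setT mul1e.
Qed.

Lemma pibar_zeta i B : measurable B ->
  pibar ((fun s => tnth s.1.2 i) @^-1` B) = pi_g B.
Proof.
move=> mB; have := boxes_off_indep (boxes_off_setT i) mB.
by rewrite setTI probability_setT mul1e.
Qed.

Lemma boxes_off_measurable_xi i :
  measurable_fun setT (fun s : g_sigma_algebraType (boxes_off i) => (s : S).1.1).
Proof.
move=> _ A mA; rewrite setTI; apply: sub_sigma_algebra.
exists A, (fun=> setT), setT; split => //.
by apply/seteqP; split => -[[x v] k] //= [[]].
Qed.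

Lemma boxes_off_measurable_zeta i l : l != i ->
  measurable_fun setT (fun s : g_sigma_algebraType (boxes_off i) => tnth (s : S).1.2 l).
Proof.
move=> li _ B mB; rewrite setTI; apply: sub_sigma_algebra.
exists setT, (fun l' => if l' == l then B else setT), setT; split => //.
- by move=> l'; case: eqP.
- by rewrite eq_sym (negPf li).
apply/seteqP; split => -[[x v] k] /=.
  by move=> Bv; split => //; split => // l'; case: eqP => [->|].
by move=> [[_ h] _]; have := h l; rewrite eqxx.
Qed.

Lemma boxes_off_measurable_index i :
  measurable_fun setT (fun s : g_sigma_algebraType (boxes_off i) => (s : S).2).
Proof.
move=> _ C mC; rewrite setTI; apply: sub_sigma_algebra.
exists setT, (fun=> setT), C; split => //.
by apply/seteqP; split => -[[x v] k] //= [[]].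
Qed.

Lemma boxes_off_xi_measurable_index :
  measurable_fun setT (fun s : g_sigma_algebraType boxes_off_xi => (s : S).2).
Proof.
move=> _ C mC; rewrite setTI; apply: sub_sigma_algebra.
exists (fun=> setT), C; split => //.
by apply/seteqP; split => -[[x v] k] //= [[]].
Qed.

End DrawLaw.

(** * The stochastic estimator *)

Section Estimator.
Context {R : realType} {n m : nat}.
Variable c : constants R.
Hypotheses (L_fx_ge0 : 0 <= L_fx c) (L_fy_ge0 : 0 <= L_fy c).
Hypotheses (L_gxy_ge0 : 0 <= L_gxy c) (L_gyy_ge0 : 0 <= L_gyy c).
Hypotheses (C_gxy_gt0 : 0 < C_gxy c) (mu_g_gt0 : 0 < mu_g c).
Hypothesis L_g_mu_g : 0 < L_g c - mu_g c.

Let L0 : 0 < L_g c := L_g_gt0 mu_g_gt0 L_g_mu_g.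

Local Notation rho := (1 - mu_g c / L_g c).

Lemma rho_gt0 : 0 < rho.
Proof. by rewrite subr_gt0 ltr_pdivrMr// mul1r; have := L_g_mu_g; lra. Qed.

Lemma rho_lt1 : rho < 1.
Proof. by rewrite gtrBl divr_gt0. Qed.

Lemma enorm_sqD3 (u v w : 'cV[R]_n) : enorm (u + (v + w)) ^+ 2
  <= 3 * (enorm u ^+ 2 + enorm v ^+ 2 + enorm w ^+ 2).
Proof.
have := enorm_sqD u (v + w); rewrite (enorm_sqD v w) dotDr => ->.
have := sqr_ge0 (enorm (u - v)); have := sqr_ge0 (enorm (u - w)).
have := sqr_ge0 (enorm (v - w)); rewrite !enorm_sqB; lra.
Qed.

(** Squared Lipschitz constant of the estimator for a given index [k]. *)
Definition est_lip (K k : nat) : R :=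
  2 * L_fx c ^+ 2
  + 6 * (K%:R / L_g c) ^+ 2 * (C_gxy c ^+ 2 * L_fy c ^+ 2 * rho ^+ 2 ^+ k
     + C_fy c ^+ 2 * L_gxy c ^+ 2 * rho ^+ 2 ^+ k
     + C_gxy c ^+ 2 * C_fy c ^+ 2 * (L_gyy c / L_g c) ^+ 2
       * (k%:R * rho ^+ k.-1) ^+ 2).

Lemma est_lip_ge0 K k : 0 <= est_lip K k.
Proof.
have r2 : 0 <= rho ^+ 2 ^+ k by rewrite exprn_ge0// sqr_ge0.
rewrite /est_lip; move: (sqr_ge0 (L_fx c)) (sqr_ge0 (K%:R / L_g c)) r2.
move: (sqr_ge0 (C_gxy c)) (sqr_ge0 (L_fy c)) (sqr_ge0 (C_fy c)).
move: (sqr_ge0 (L_gxy c)) (sqr_ge0 (L_gyy c / L_g c)).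
move: (sqr_ge0 (k%:R * rho ^+ k.-1)); move: (_ ^+ 2 ^+ k) (L_fx c ^+ 2).
move: (_ ^+ 2) (C_gxy c ^+ 2) (L_fy c ^+ 2) (C_fy c ^+ 2) (L_gxy c ^+ 2).
move: (_ ^+ 2) (_ ^+ 2) => *.
by rewrite !(addr_ge0, mulr_ge0).
Qed.

(** Since [1 - rho ^ 2 = q / L_g ^ 2], the geometric sum of the [rho ^ (2 k)] is
    at most [L_g ^ 2 / q], and [k rho ^ (k - 1) <= K rho ^ k / rho] reduces the
    last term to the same sum.  The factor [1 / rho ^ 2] produces the
    [(L_g - mu_g) ^ 2] in the denominator of [L_K_sq]. *)
Lemma est_lip_average K : (0 < K)%N ->
  \sum_(k < K) K%:R^-1 * est_lip K k <= L_K_sq c K.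
Proof.
move=> K0; have K0' : 0 < K%:R :> R by rewrite ltr0n.
have r0 := rho_gt0; have r1 := rho_lt1.
pose q := 2 * mu_g c * L_g c - mu_g c ^+ 2.
have q0 : 0 < q.
  by rewrite /q expr2; have := mulr_gt0 mu_g_gt0 L_g_mu_g;
    have := mulr_gt0 mu_g_gt0 L0; lra.
have rq : 1 - rho ^+ 2 = q / L_g c ^+ 2 by rewrite /q; field; rewrite gt_eqF.
have geo : \sum_(k < K) rho ^+ 2 ^+ k <= L_g c ^+ 2 / q.
  have e : q / L_g c ^+ 2 * \sum_(k < K) rho ^+ 2 ^+ k = 1 - rho ^+ 2 ^+ K.
    by rewrite -rq -(opprB (rho ^+ 2) 1) mulNr -subrX1 opprB.
  have h : q / L_g c ^+ 2 * \sum_(k < K) rho ^+ 2 ^+ k <= 1.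
    by rewrite e gerBl exprn_ge0// sqr_ge0.
  rewrite ler_pdivlMr// mulrC.
  have L20 : 0 < L_g c ^+ 2 by rewrite exprn_gt0.
  by move: h; rewrite mulrAC ler_pdivrMr// mul1r.
have geo2 : \sum_(k < K) (k%:R * rho ^+ k.-1) ^+ 2
    <= K%:R ^+ 2 / rho ^+ 2 * (L_g c ^+ 2 / q).
  apply: (@le_trans _ _ (\sum_(k < K) K%:R ^+ 2 / rho ^+ 2 * rho ^+ 2 ^+ k)).
    apply: ler_sum => k _; case: k => [[|k] kK] /=.
      by rewrite mul0r expr0n/= mulr_ge0// ?exprn_ge0 ?divr_ge0 ?sqr_ge0.
    have -> : K%:R ^+ 2 / rho ^+ 2 * rho ^+ 2 ^+ k.+1 = K%:R ^+ 2 * (rho ^+ k) ^+ 2.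
      by rewrite (exprS (rho ^+ 2)) mulrA divfK ?expf_neq0 ?gt_eqF// -!exprM mulnC.
    rewrite exprMn ler_wpM2r ?sqr_ge0//.
    by rewrite ler_pXn2r ?nnegrE ?ler0n// ler_nat ltnW.
  by rewrite -mulr_sumr ler_wpM2l// divr_ge0 ?sqr_ge0.
rewrite -mulr_sumr ler_pdivrMl//.
set s1 := \sum_(k < K) _ in geo; set s2 := \sum_(k < K) _ in geo2.
have -> : \sum_(k < K) est_lip K k = K%:R * (2 * L_fx c ^+ 2)
    + 6 * (K%:R / L_g c) ^+ 2 * (C_gxy c ^+ 2 * L_fy c ^+ 2 * s1
     + C_fy c ^+ 2 * L_gxy c ^+ 2 * s1
     + C_gxy c ^+ 2 * C_fy c ^+ 2 * (L_gyy c / L_g c) ^+ 2 * s2).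
  rewrite /est_lip big_split/= sumr_const card_ord; congr (_ + _).
    by rewrite [RHS]mulr_natl.
  rewrite -mulr_sumr; congr (_ * _).
  by rewrite !big_split/= -!mulr_sumr.
have C2 : 0 <= C_gxy c ^+ 2 by exact: sqr_ge0.
have f2 : 0 <= C_fy c ^+ 2 by exact: sqr_ge0.
apply: (@le_trans _ _ (K%:R * (2 * L_fx c ^+ 2) + 6 * (K%:R / L_g c) ^+ 2
  * (C_gxy c ^+ 2 * L_fy c ^+ 2 * (L_g c ^+ 2 / q)
     + C_fy c ^+ 2 * L_gxy c ^+ 2 * (L_g c ^+ 2 / q)
     + C_gxy c ^+ 2 * C_fy c ^+ 2 * (L_gyy c / L_g c) ^+ 2
       * (K%:R ^+ 2 / rho ^+ 2 * (L_g c ^+ 2 / q))))).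
  rewrite lerD2l; apply: ler_wpM2l; first by rewrite mulr_ge0// sqr_ge0.
  have p2 (u v : R) : 0 <= u ^+ 2 * v ^+ 2 by rewrite mulr_ge0// sqr_ge0.
  apply: lerD; last by apply: ler_wpM2l => //; rewrite mulr_ge0// sqr_ge0.
  by apply: lerD; exact: ler_wpM2l.
rewrite /L_K_sq -/q le_eqVlt; apply/predU1P; left.
have -> : rho = (L_g c - mu_g c) / L_g c by field; rewrite gt_eqF.
by field; rewrite !gt_eqF.
Qed.

(** Changing one factor of [A Q b] at a time gives three differences; the
    constants [2] and [2 * 3 = 6] of [est_lip] come from squaring the sum of the
    first term and of these three. *)
Lemma enorm_sub_sq_mx (K k : nat) (D : R) (a a' : 'cV[R]_n) (A A' : 'M[R]_(n, m))
    (Q Q' : 'M[R]_m) (b b' : 'cV[R]_m) : 0 <= D -> 0 <= C_fy c ->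
  (forall u, enorm (Q *m u) <= rho ^+ k * enorm u) ->
  (forall u, enorm (Q' *m u) <= rho ^+ k * enorm u) ->
  (forall u, enorm ((Q - Q') *m u)
    <= k%:R * rho ^+ k.-1 * (L_gyy c / L_g c * D) * enorm u) ->
  opnorm (A - A') <= L_gxy c * D -> opnorm A' <= C_gxy c ->
  enorm b <= C_fy c -> enorm (a - a') <= L_fx c * D ->
  enorm (b - b') <= L_fy c * D ->
  enorm (a - (K%:R / L_g c) *: (A *m Q *m b)
    - (a' - (K%:R / L_g c) *: (A' *m Q' *m b'))) ^+ 2
  <= est_lip K k * D ^+ 2.
Proof.
move=> D0 C0 hQ hQ' hQQ AA' A'C bC aa' bb'.
have r0 := ltW rho_gt0; have G0 := ltW C_gxy_gt0.
have -> : a - (K%:R / L_g c) *: (A *m Q *m b)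
    - (a' - (K%:R / L_g c) *: (A' *m Q' *m b'))
  = (a - a') - (K%:R / L_g c) *: ((A - A') *m (Q *m b)
     + (A' *m ((Q - Q') *m b) + A' *m (Q' *m (b - b')))).
  have -> : (A - A') *m (Q *m b) + (A' *m ((Q - Q') *m b) + A' *m (Q' *m (b - b')))
      = A *m Q *m b - A' *m Q' *m b'.
    rewrite !mulmxBl !mulmxBr !mulmxA.
    move: (A *m Q *m b) (A' *m Q *m b) (A' *m Q' *m b) (A' *m Q' *m b') => *.
    by apply/matrixP => i j; rewrite !mxE; ring.
  move: (A *m Q *m b) (A' *m Q' *m b') => u w.
  by rewrite scalerBr; apply/matrixP => i j; rewrite !mxE; ring.
have sq (u w : R) : 0 <= u -> u <= w -> u ^+ 2 <= w ^+ 2.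
  by move=> u0 uw; rewrite ler_pXn2r ?nnegrE// (le_trans u0).
have t0 := sq _ _ (enorm_ge0 _) aa'.
have t1 : enorm ((A - A') *m (Q *m b)) ^+ 2
    <= (L_gxy c * D * (rho ^+ k * C_fy c)) ^+ 2.
  apply: sq; first exact: enorm_ge0.
  rewrite (le_trans (enorm_mulmx_le _ AA'))// ler_wpM2l ?mulr_ge0//.
  by rewrite (le_trans (hQ _))// ler_wpM2l// exprn_ge0.
have t2 : enorm (A' *m ((Q - Q') *m b)) ^+ 2
    <= (C_gxy c * (k%:R * rho ^+ k.-1 * (L_gyy c / L_g c * D) * C_fy c)) ^+ 2.
  apply: sq; first exact: enorm_ge0.
  rewrite (le_trans (enorm_mulmx_le _ A'C))// ler_wpM2l//.
  rewrite (le_trans (hQQ _))// ler_wpM2l// !mulr_ge0// ?exprn_ge0// invr_ge0 ltW//.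
have t3 : enorm (A' *m (Q' *m (b - b'))) ^+ 2
    <= (C_gxy c * (rho ^+ k * (L_fy c * D))) ^+ 2.
  apply: sq; first exact: enorm_ge0.
  rewrite (le_trans (enorm_mulmx_le _ A'C))// ler_wpM2l//.
  by rewrite (le_trans (hQ' _))// ler_wpM2l// exprn_ge0.
rewrite (le_trans (enorm_sqD2 _ _))// enormN enormZ exprMn real_normK ?num_real//.
have h3 := ler_wpM2l (sqr_ge0 (K%:R / L_g c)) (enorm_sqD3 ((A - A') *m (Q *m b))
  (A' *m ((Q - Q') *m b)) (A' *m (Q' *m (b - b')))).
have h4 := lerD t1 (lerD t2 t3).
have h5 := ler_wpM2l (sqr_ge0 (K%:R / L_g c)) h4.
rewrite /est_lip -!exprM (mulnC 2) !exprM.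
rewrite !exprMn in t0 h5 *.
lra.
Qed.

Section Sampled.
Context {Xi Z : Type}.
Variables (F : Xi -> 'cV[R]_n -> 'cV[R]_m -> R).
Variables (G : Z -> 'cV[R]_n -> 'cV[R]_m -> R).
Hypothesis F_upper : forall xi, upper_level c (F xi).
Hypothesis G_lower : forall z, lower_level c (G z).
Variable K : nat.

Definition neumann_factor (z : Z) x y : 'M[R]_m :=
  1%:M - (L_g c)^-1 *: hess_yy (G z) x y.

Local Notation est := (estimator F G (L_g c) (K := K)).

Lemma neumann_factor_le z x y v :
  enorm (neumann_factor z x y *m v) <= rho * enorm v.
Proof. exact: neumann_factor_contracts. Qed.

Lemma neumann_factor_sub_le z x y x' y' v :
  enorm ((neumann_factor z x y - neumann_factor z x' y') *m v)
  <= L_gyy c / L_g c * enorm_pair (x - x') (y - y') * enorm v.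
Proof.
rewrite /neumann_factor; move: (lower_lip_yy (G_lower z) x y x' y').
move: (hess_yy _ x y) (hess_yy _ x' y') (enorm_pair _ _) => H H' D HH'.
have -> : 1%:M - (L_g c)^-1 *: H - (1%:M - (L_g c)^-1 *: H')
    = - ((L_g c)^-1 *: (H - H')) by rewrite scalerBr opprD opprK opprB addrACA subrr add0r addrC.
rewrite mulNmx enormN -scalemxAl enormZ gtr0_norm ?invr_gt0//.
have := ler_wpM2l (ltW (_ : 0 < (L_g c)^-1)) (enorm_mulmx_le v HH').
by rewrite invr_gt0 => /(_ L0); rewrite mulrA mulrA (mulrC _ (L_gyy c)).
Qed.

Definition neumann_product (v : K.+1.-tuple Z) k x y : 'M[R]_m :=
  \big[mulmx/1%:M]_(1 <= i < k.+1) neumann_factor (tnth v (inord i)) x y.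

Lemma estE s x y : est s x y = grad_x (F s.1.1) x y
  - (K%:R / L_g c) *: (hess_xy (G (tnth s.1.2 (inord 0))) x y
      *m neumann_product s.1.2 s.2 x y *m grad_y (F s.1.1) x y).
Proof. by []. Qed.

Lemma neumann_product_le v k x y u :
  enorm (neumann_product v k x y *m u) <= rho ^+ k * enorm u.
Proof.
apply: (@enorm_prod_le _ _ _ rho 1 k); first exact: ltW rho_gt0.
by move=> i w; exact: neumann_factor_le.
Qed.

Lemma neumann_product_sub_le v k x y x' y' u :
  enorm ((neumann_product v k x y - neumann_product v k x' y') *m u)
  <= k%:R * rho ^+ k.-1 * (L_gyy c / L_g c * enorm_pair (x - x') (y - y'))
     * enorm u.
Proof.
apply: (@enorm_prod_sub_le _ _ _ _ rho _ 1 k).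
- exact: ltW rho_gt0.
- by rewrite mulr_ge0 ?enorm_pair_ge0// divr_ge0// ltW.
- by move=> i w; exact: neumann_factor_le.
- by move=> i w; exact: neumann_factor_le.
- by move=> i w; exact: neumann_factor_sub_le.
Qed.

(** A bound for each draw; its average over the index is at most [L_K_sq]. *)
Lemma est_sub_sq s x y x' y' :
  enorm (est s x y - est s x' y') ^+ 2
  <= est_lip K s.2 * enorm_pair (x - x') (y - y') ^+ 2.
Proof.
rewrite !estE; set z0 := tnth _ _; set xi := s.1.1.
exact: (enorm_sub_sq_mx K (enorm_pair_ge0 _ _) (C_fy_ge0 (F_upper xi))
  (neumann_product_le _ _ _ _) (neumann_product_le _ _ _ _)
  (neumann_product_sub_le _ _ _ _ _ _)
  (lower_lip_xy (G_lower z0) _ _ _ _) (lower_bound (G_lower z0) _ _)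
  (upper_bound (F_upper xi) _ _) (upper_lip_x (F_upper xi) _ _ _ _)
  (upper_lip_y (F_upper xi) _ _ _ _)).
Qed.

End Sampled.
End Estimator.

(** * Mean of a product of independent random matrices *)

Section BoundedMx.
Context {R : realType} {T : Type}.

Definition bounded_mx {p q} (A : T -> 'M[R]_(p, q)) :=
  exists k : R, forall s i j, `|A s i j| <= k.

Lemma bounded_mxM p q r (A : T -> 'M[R]_(p, q)) (B : T -> 'M[R]_(q, r)) :
  bounded_mx A -> bounded_mx B -> bounded_mx (fun s => A s *m B s).
Proof.
move=> [a hA] [b hB]; exists (\sum_(l < q) a * b) => s i j.
rewrite mxE (le_trans (ler_norm_sum _ _ _))//; apply: ler_sum => l _.
by rewrite normrM ler_pM.
Qed.

Lemma bounded_mxZ p q (k : T -> R) (A : T -> 'M[R]_(p, q)) :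
  (forall s, `|k s| <= 1) -> bounded_mx A -> bounded_mx (fun s => k s *: A s).
Proof.
move=> k1 [a hA]; exists a => s i j; rewrite mxE normrM.
rewrite -[leRHS]mul1r ler_pM//.
Qed.

Lemma bounded_mx_prod m (M : nat -> T -> 'M[R]_m) a b :
  (forall i, bounded_mx (M i)) ->
  bounded_mx (fun s => \big[mulmx/1%:M]_(a <= i < b) M i s).
Proof.
move=> hM.
have b1 : bounded_mx ((fun=> 1%:M) : T -> 'M[R]_m).
  by exists 1 => s i j; rewrite mxE normr_nat; case: (i == j).
have [ba|ab] := leqP b a.
  rewrite (_ : (fun s => _) = (fun=> 1%:M))//.
  by apply/funext => s; rewrite big_geq.
have [k ->] : exists k, b = (a + k)%N by exists (b - a)%N; rewrite subnKC// ltnW.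
elim: k a {b ab} => [|k IH] a.
  rewrite (_ : (fun s => _) = (fun=> 1%:M))//.
  by apply/funext => s; rewrite addn0 big_geq.
rewrite (_ : (fun s => _) = (fun s => M a s *m
    \big[mulmx/1%:M]_(a.+1 <= i < a.+1 + k) M i s)); last first.
  by apply/funext => s; rewrite (prod_mulmx_ltn (fun i => M i s)).
exact: bounded_mxM.
Qed.

End BoundedMx.

Lemma bounded_mx_comp {R : realType} (T T' : Type) p q (A : T' -> 'M[R]_(p, q))
  (h : T -> T') : bounded_mx A -> bounded_mx (fun s => A (h s)).
Proof. by move=> [k hk]; exists k => s. Qed.

Section MeanBounded.
Context {R : realType} {d : measure_display} {S : measurableType d}.
Variable pi : probability S R.

Lemma bounded_integrable_mx p q (A : S -> 'M[R]_(p, q)) :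
  measurable_mx A -> bounded_mx A -> integrable_mx pi A.
Proof.
move=> mA [k hk] i j.
have fin1 : (pi setT < +oo)%E by rewrite probability_setT ltry.
apply: (@measurable_bounded_integrable _ _ _ _ (fun s => A s i j)) => //.
exists k; split; first exact: num_real.
by move=> M kM s _ /=; rewrite (le_trans (hk _ _ _))// ltW.
Qed.

Lemma integrable_mx_sum p q (I : Type) (r : seq I) (A : I -> S -> 'M[R]_(p, q)) :
  (forall l, integrable_mx pi (A l)) ->
  integrable_mx pi (fun s => \sum_(l <- r) A l s).
Proof.
move=> iA; elim: r => [|l r IH].
  rewrite (_ : (fun s => _) = (fun=> 0)); first exact: integrable_mx_cst.
  by apply/funext => s; rewrite big_nil.
rewrite (_ : (fun s => _) = (fun s => A l s + \sum_(l <- r) A l s)).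
  exact: integrable_mxD.
by apply/funext => s; rewrite big_cons.
Qed.

Lemma mean_mx_sum p q (I : Type) (r : seq I) (A : I -> S -> 'M[R]_(p, q)) :
  (forall l, integrable_mx pi (A l)) ->
  mean_mx pi (fun s => \sum_(l <- r) A l s) = \sum_(l <- r) mean_mx pi (A l).
Proof.
move=> iA; elim: r => [|l r IH].
  rewrite big_nil (_ : (fun s => _) = (fun=> 0)); first exact: mean_mx_cst.
  by apply/funext => s; rewrite big_nil.
rewrite big_cons -IH -mean_mxD//; last exact: integrable_mx_sum.
by congr mean_mx; apply/funext => s; rewrite big_cons.
Qed.

Lemma integrable_mx_off_null p q (A B : S -> 'M[R]_(p, q)) (N : set S) :
  measurable N -> pi N = 0%E -> (forall s, ~ N s -> A s = B s) ->
  measurable_mx A -> integrable_mx pi B -> integrable_mx pi A.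
Proof.
move=> mN N0 AB mA iB i j; have /integrableP[mB fB] := iB i j.
apply/integrableP; split; first exact/measurable_EFinP.
by rewrite (integral_off_null mN N0 (v := fun s => `|(B s i j)%:E|%E)) => // s /AB ->.
Qed.

End MeanBounded.

Section Peel.
Context {R : realType} {d d' : measure_display} {S : measurableType d} {U : measurableType d'}.
Variables (mu : probability S R) (pi : probability U R) (G0 : set (set S)) (xi : S -> U).
Hypothesis G0m : G0 `<=` measurable.
Hypothesis G0I : setI_closed G0.
Hypothesis G0T : G0 setT.
Hypothesis mxi : measurable_fun setT xi.
Hypothesis indep : forall E B, G0 E -> measurable B ->
  mu (E `&` xi @^-1` B) = (mu E * pi B)%E.

(** Independent random matrices have multiplicative means; [Q] depends on the
    coordinates that the pi-system sees. *)
Lemma mean_peel p q r (A : U -> 'M[R]_(p, q)) (Q : S -> 'M[R]_(q, r)) :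
  measurable_mx A -> bounded_mx A ->
  measurable_mx (Q : g_sigma_algebraType G0 -> 'M[R]_(q, r)) -> bounded_mx Q ->
  mean_mx mu (fun s => A (xi s) *m Q s) = mean_mx pi A *m mean_mx mu Q.
Proof.
move=> mA [a hA] mQ0 [b hQ].
have mQ : measurable_mx Q.
  by apply: (@measurable_mx_comp _ _ _ S (g_sigma_algebraType G0) _ _ Q id mQ0);
    exact: measurable_forget.
have iA : integrable_mx pi A by apply: bounded_integrable_mx => //; exists a.
have iQ : integrable_mx mu Q by apply: bounded_integrable_mx => //; exists b.
have mAxi : measurable_mx (fun s => A (xi s)) by exact: measurable_mx_comp.
have iAQ : integrable_mx mu (fun s => A (xi s) *m Q s).
  apply: bounded_integrable_mx; first exact: measurable_mxM.
  by apply: bounded_mxM; [exists a|exists b].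
have iprod u v l : mu.-integrable setT (fun s => (A (xi s) u l * Q s l v)%:E).
  have fin1 : (mu setT < +oo)%E by rewrite probability_setT ltry.
  apply: (@measurable_bounded_integrable _ _ _ _ (fun s => A (xi s) u l * Q s l v)) => //.
  - by apply: measurable_funM; [exact: mAxi|exact: mQ].
  - exists (a * b); split; first exact: num_real.
    by move=> M kM s _ /=; rewrite (le_trans _ (ltW kM))// normrM ler_pM.
apply/matrixP => u v; apply: EFin_inj; rewrite -mean_mxE//.
transitivity (\int[mu]_s (\sum_l (A (xi s) u l * Q s l v)%:E))%E.
  by apply: eq_integral => s _; rewrite mxE sumEFin.
rewrite integral_sum// mxE -sumEFin; apply: eq_bigr => l _.
have := @indep_product_pi_system _ _ S U R mu pi G0 xi G0m G0I G0T mxi indep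
  (fun z => A z u l) (fun s => Q s l v) a b
  (mA u l) (mQ0 l v) (fun z => hA z u l) (fun s => hQ s l v).
rewrite /Rintegral => e.
rewrite !mxE unlock -e fineK//; exact: integrable_fin_num.
Qed.

End Peel.

Section MeanProduct.
Context {R : realType} {d1 d2 : measure_display}.
Context {Xi : measurableType d1} {Z : measurableType d2}.
Variables (pi_f : probability Xi R) (pi_g : probability Z R) (K : nat).
Hypothesis K_gt0 : (0 < K)%N.
Local Notation S := (Xi * K.+1.-tuple Z * nat)%type.
Variable pibar : probability S R.
Hypothesis pibar_law : draw_law pi_f pi_g pibar.

(** The end of the peeling, where only the gradient at [xi] and the condition
    that selects the value [j] of the index remain. *)
Lemma mean_peel_xi q (b : Xi -> 'cV[R]_q) (j : nat) : (j < K)%N ->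
  measurable_mx b -> bounded_mx b ->
  mean_mx pibar (fun s => (s.2 == j)%:R *: b s.1.1) = K%:R^-1 *: mean_mx pi_f b.
Proof.
move=> jK mb bb; pose Q (s : S) : 'M[R]_1 := const_mx (s.2 == j)%:R.
have QE u (s : S) : u *m Q s = (s.2 == j)%:R *: u :> 'cV[R]_q.
  by apply/matrixP => k l; rewrite mxE big_ord1 !mxE !ord1 mulrC.
have mind : measurable_fun setT (fun l : nat => (l == j)%:R : R) by [].
transitivity (mean_mx pibar (fun s => b s.1.1 *m Q s)).
  by congr mean_mx; apply/funext => s; rewrite QE.
rewrite (mean_peel (@boxes_off_xi_measurable _ _ Xi Z K) (@boxes_off_xi_setI _ _ Xi Z K)
  (@boxes_off_xi_setT _ _ Xi Z K) (@measurable_xi _ _ Xi Z K)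
  (boxes_off_xi_indep K_gt0 pibar_law) mb bb).
- apply/matrixP => k l; rewrite mxE big_ord1 !mxE !ord1 mulrC unlock; congr (_ * _).
  rewrite (_ : \int[pibar]_s (Q s 0 0)%:E = K%:R^-1%:E)%E//.
  transitivity (\int[pibar]_s (\1_[set s : S | s.2 = j] s)%:E)%E.
    apply: eq_integral => s _; rewrite mxE indicE; congr (_%:R%:E).
    by case: eqP => sj; [rewrite mem_set|rewrite memNset].
  rewrite integral_indic//; last exact: (measurable_index [set j]).
  by rewrite setIT; exact: (pibar_index pibar_law jK).
- move=> k l; rewrite (_ : (fun s => _) = fun s => (s.2 == j)%:R).
    exact: (measurableT_comp mind (@boxes_off_xi_measurable_index _ _ Xi Z K)).
  by apply/funext => s; rewrite mxE.
- by exists 1 => s k l; rewrite mxE normr_nat; case: (_ == _).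
Qed.

Let peel p q r (i : 'I_K.+1) (A : Z -> 'M[R]_(p, q)) (Q : S -> 'M[R]_(q, r)) :=
  @mean_peel _ _ _ S Z pibar pi_g _ _ (@boxes_off_measurable _ _ Xi Z K i)
    (@boxes_off_setI _ _ Xi Z K i) (@boxes_off_setT _ _ Xi Z K i)
    (@measurable_zeta _ _ Xi Z K i) (boxes_off_indep K_gt0 pibar_law (i := i)) p q r A Q.

Section Chain.
Context {n m : nat}.
Variables (a : Xi -> 'cV[R]_n) (b : Xi -> 'cV[R]_m).
Variables (A : Z -> 'M[R]_(n, m)) (M : Z -> 'M[R]_m).
Hypotheses (mb : measurable_mx b) (mA : measurable_mx A) (mM : measurable_mx M).
Hypotheses (bb : bounded_mx b) (bA : bounded_mx A) (bM : bounded_mx M).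

Let zeta (l : nat) (s : S) := tnth s.1.2 (inord l).

(** The last [k] factors of the product, on the event that the index is [j]. *)
Let chain j i k (s : S) : 'cV[R]_m := (s.2 == j)%:R *:
  (\big[mulmx/1%:M]_(i <= l < i + k) M (zeta l s) *m b s.1.1).

Let mind j : measurable_fun setT (fun l : nat => (l == j)%:R : R). Proof. by []. Qed.

Let measurable_chain j i k : measurable_mx (chain j i k).
Proof.
apply: measurable_mxZ.
  exact: (measurableT_comp (mind j) measurable_snd).
apply: measurable_mxM; last exact: (measurable_mx_comp mb (@measurable_xi _ _ Xi Z K)).
apply: (@measurable_mx_prod _ _ _ _ (fun l s => M (zeta l s))) => l _.
exact: (measurable_mx_comp mM (@measurable_zeta _ _ Xi Z K _)).
Qed.

Let bounded_chain j i k : bounded_mx (chain j i k).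
Proof.
apply: bounded_mxZ => [s|]; first by rewrite normr_nat; case: (_ == _).
apply: bounded_mxM; last exact: bounded_mx_comp.
apply: (@bounded_mx_prod _ _ _ (fun l s => M (zeta l s))) => l.
exact: (bounded_mx_comp (zeta l) bM).
Qed.

(** The chain from [i] on does not see the samples before [i]. *)
Let measurable_chain0 j i k l0 : (l0 < i)%N -> (i + k <= K.+1)%N ->
  measurable_mx (chain j i k : g_sigma_algebraType (boxes_off (inord l0)) -> _).
Proof.
move=> l0i ikK.
pose T0 : measurableType _ := g_sigma_algebraType (@boxes_off _ _ Xi Z K (inord l0)).
have mi : measurable_fun [set: T0] (fun s : T0 => ((s : S).2 == j)%:R : R).
  have m2 : measurable_fun [set: T0] (fun s : T0 => (s : S).2) :=
    @boxes_off_measurable_index _ _ Xi Z K (inord l0).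
  exact: (@measurableT_comp _ _ _ T0 nat R _ setT _ (mind j) m2).
apply: (measurable_mxZ mi).
apply: measurable_mxM.
  apply: (@measurable_mx_prod R _ T0 m (fun l (s : T0) => M (zeta l s))) => l /andP[il lik].
  apply: (measurable_mx_comp mM (h := fun s : T0 => zeta l s)); apply: boxes_off_measurable_zeta.
  have lK : (l < K.+1)%N := leq_trans lik ikK.
  apply/eqP => /(congr1 val); rewrite /= !inordK//.
    by move=> e; move: il; rewrite leqNgt e l0i.
  exact: ltn_trans (leq_trans l0i il) lK.
exact: (measurable_mx_comp mb (@boxes_off_measurable_xi _ _ Xi Z K _) (T := T0)).
Qed.

Let N := mean_mx pi_g M.
Let pow k : 'M[R]_m := iter k (mulmx N) 1%:M.

Let mean_chain j i k : (j < K)%N -> (i + k <= K.+1)%N ->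
  mean_mx pibar (chain j i k) = K%:R^-1 *: (pow k *m mean_mx pi_f b).
Proof.
move=> jK; elim: k i => [|k IH] i ikK.
  rewrite mul1mx -(mean_peel_xi jK mb bb); congr mean_mx.
  by apply/funext => s; rewrite /chain addn0 big_geq// mul1mx.
rewrite addnS -addSn in ikK.
transitivity (mean_mx pibar (fun s => M (tnth s.1.2 (inord i)) *m chain j i.+1 k s)).
  congr mean_mx; apply/funext => s.
  by rewrite /chain (prod_mulmx_ltn (fun l => M (zeta l s))) -scalemxAr mulmxA.
rewrite (peel mM bM)//; last exact: measurable_chain0.
by rewrite IH// -scalemxAr mulmxA.
Qed.

(** On [index = j] the random product has exactly [j] independent factors, so
    that its mean is the power [N ^ j]; the uniform index averages these powers.
    Only the event that the index is at least [K], which is null, escapes the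
    sum over [j]. *)
Lemma mean_random_product (kap : R) : integrable_mx pi_f a ->
  let est s := a s.1.1 - kap *: (A (tnth s.1.2 (inord 0))
     *m (\big[mulmx/1%:M]_(1 <= l < s.2.+1) M (tnth s.1.2 (inord l)))
     *m b s.1.1) in
  integrable_mx pibar est /\
  mean_mx pibar est = mean_mx pi_f a - (kap / K%:R) *:
    (mean_mx pi_g A *m \sum_(j < K) (pow j *m mean_mx pi_f b)).
Proof.
move=> ia est.
have ma : measurable_mx a by move=> u v; exact: measurable_integrable_mx.
have mX := @measurable_xi _ _ Xi Z K.
have iaS : integrable_mx pibar (fun s => a s.1.1) /\
    mean_mx pibar (fun s => a s.1.1) = mean_mx pi_f a.
  pose xi : {mfun S >-> Xi} :=
    HB.pack (fun s : S => s.1.1) (isMeasurableFun.Build _ _ _ _ _ mX).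
  have law (h : Xi -> \bar R) : (\int[image_measure pibar xi]_x h x = \int[pi_f]_x h x)%E.
    by apply: eq_measure_integral => X mXX _; exact: (pibar_xi K_gt0 pibar_law mXX).
  have iS : integrable_mx pibar (fun s => a s.1.1).
    move=> u v; have /integrableP[mh fh] := ia u v.
    apply/integrableP; split; first exact: (measurableT_comp mh mX).
    rewrite -law /image_measure ge0_integral_pushforward// in fh.
    exact: measurableT_comp.
  split => //; apply/matrixP => u v; apply: EFin_inj; rewrite -!mean_mxE//.
  have mau : measurable_fun setT (fun x => (a x u v)%:E) by have /integrableP[] := ia u v.
  by rewrite -law /image_measure (integral_pushforward mX mau (iS u v)).
pose W j s := A (tnth s.1.2 (inord 0)) *m chain j 1 j s.
have iW j : integrable_mx pibar (W j).
  apply: bounded_integrable_mx.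
    apply: measurable_mxM; last exact: measurable_chain.
    exact: (measurable_mx_comp mA (@measurable_zeta _ _ Xi Z K _)).
  apply: bounded_mxM; last exact: bounded_chain.
  exact: (bounded_mx_comp _ bA).
have eW j : (j < K)%N ->
    mean_mx pibar (W j) = K%:R^-1 *: (mean_mx pi_g A *m (pow j *m mean_mx pi_f b)).
  move=> jK; have jK1 : (1 + j <= K.+1)%N by rewrite add1n ltnS ltnW.
  rewrite /W (peel mA bA)//; last exact: measurable_chain0.
  by rewrite (mean_chain jK jK1) -scalemxAr.
have iB : integrable_mx pibar (fun s => a s.1.1 + (- kap) *: \sum_(j < K) W j s).
  by apply: integrable_mxD; [exact: iaS.1|apply/integrable_mxZ/integrable_mx_sum].
have mest : measurable_mx est.
  pose est' (k : nat) (s : Xi * K.+1.-tuple Z) := a s.1 - kap *: (A (tnth s.2 (inord 0))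
     *m (\big[mulmx/1%:M]_(1 <= l < k.+1) M (tnth s.2 (inord l))) *m b s.1).
  have mzl (l : 'I_K.+1) : measurable_fun setT (fun s : Xi * K.+1.-tuple Z => tnth s.2 l).
    exact: (measurableT_comp (measurable_tnth l) measurable_snd).
  have mest' k : measurable_mx (est' k).
    apply: measurable_mxB; first exact: (measurable_mx_comp ma measurable_fst).
    apply: measurable_mxZ => //; apply: measurable_mxM; last first.
      exact: (measurable_mx_comp mb measurable_fst).
    apply: measurable_mxM; first exact: (measurable_mx_comp mA (mzl _)).
    apply: (@measurable_mx_prod _ _ _ _
      (fun l (s : Xi * K.+1.-tuple Z) => M (tnth s.2 (inord l)))) => l _.
    exact: (measurable_mx_comp mM (mzl _)).
  move=> u v.
  have mcase : measurable_fun setT (fun z : nat * (Xi * K.+1.-tuple Z) => est' z.1 z.2 u v).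
    apply: (@measurable_countable_case _ _ _ _ _ nat id (fun k s => est' k s u v)).
      by [].
    by move=> k; exact: mest'.
  exact: (measurableT_comp mcase (@measurable_swap _ _ _ _)).
have mb0 : measurable (@index_overflow _ _ Xi Z K) by exact: (measurable_index [set j | (K <= j)%N]).
have AB s : ~ index_overflow s -> est s = a s.1.1 + (- kap) *: \sum_(j < K) W j s.
  move=> /negP; rewrite -ltnNge => sK; rewrite /est scaleNr; congr (_ - _ *: _).
  rewrite (bigD1 (Ordinal sK))//= /W /chain eqxx scale1r big1 ?addr0 => [|j /eqP js].
    by rewrite mulmxA.
  case: eqP => [sj|_]; last by rewrite scale0r mulmx0.
  by exfalso; apply: js; apply: val_inj.
have nb0 := pibar_overflow K_gt0 pibar_law.
split; first exact: (integrable_mx_off_null mb0 nb0 AB mest iB).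
rewrite (mean_mx_off_null mb0 nb0 AB) mean_mxD//; last first.
- by apply/integrable_mxZ/integrable_mx_sum.
- exact: iaS.1.
rewrite iaS.2 mean_mxZ; last exact: integrable_mx_sum.
rewrite mean_mx_sum// (eq_bigr _ (fun (j : 'I_K) _ => eW j (ltn_ord j))).
by rewrite -scaler_sumr scalerA -mulmx_sumr mulNr scaleNr.
Qed.

End Chain.
End MeanProduct.

(** * Bias and mean-square continuity of the estimator *)

Section EstimatorMoments.
Context {R : realType} {n m : nat}.
Variable c : constants R.
Hypotheses (L_fx_ge0 : 0 <= L_fx c) (L_fy_ge0 : 0 <= L_fy c).
Hypotheses (L_gxy_ge0 : 0 <= L_gxy c) (L_gyy_ge0 : 0 <= L_gyy c).
Hypotheses (C_gxy_gt0 : 0 < C_gxy c) (mu_g_gt0 : 0 < mu_g c).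
Hypothesis L_g_mu_g : 0 < L_g c - mu_g c.
Context {d1 d2 : measure_display} {Xi : measurableType d1} {Z : measurableType d2}.
Variables (pi_f : probability Xi R) (pi_g : probability Z R).
Variables (F : Xi -> 'cV[R]_n -> 'cV[R]_m -> R).
Variables (G : Z -> 'cV[R]_n -> 'cV[R]_m -> R).
Variables (f g : 'cV[R]_n -> 'cV[R]_m -> R).
Hypotheses (F_unbiased_x : unbiased pi_f (fun xi => grad_x (F xi)) (grad_x f))
  (F_unbiased_y : unbiased pi_f (fun xi => grad_y (F xi)) (grad_y f))
  (G_unbiased_xy : unbiased pi_g (fun z => hess_xy (G z)) (hess_xy g))
  (G_unbiased_yy : unbiased pi_g (fun z => hess_yy (G z)) (hess_yy g)).
Hypotheses (f_upper : upper_level c f) (g_lower : lower_level c g).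
Hypotheses (F_upper : forall xi, upper_level c (F xi))
  (G_lower : forall z, lower_level c (G z)).
Variable K : nat.
Hypothesis K_gt0 : (0 < K)%N.
Local Notation S := (Xi * K.+1.-tuple Z * nat)%type.
Variable pibar : probability S R.
Hypothesis pibar_law : draw_law pi_f pi_g pibar.

Local Notation est := (estimator F G (L_g c) (K := K)).
Local Notation rho := (1 - mu_g c / L_g c).

Let L0 : 0 < L_g c := L_g_gt0 mu_g_gt0 L_g_mu_g.

Section Point.
Variables (x : 'cV[R]_n) (y : 'cV[R]_m).

Let N : 'M[R]_m := 1%:M - (L_g c)^-1 *: hess_yy g x y.
Let pow k : 'M[R]_m := iter k (mulmx N) 1%:M.

Let integrable_factor : integrable_mx pi_g (fun z => neumann_factor c G z x y).
Proof.
have -> : (fun z => neumann_factor c G z x y)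
    = (fun z => 1%:M + (- (L_g c)^-1) *: hess_yy (G z) x y).
  by apply/funext => z; rewrite scaleNr.
apply: integrable_mxD; first exact: integrable_mx_cst.
exact/integrable_mxZ/(G_unbiased_yy x y).1.
Qed.

Let mean_factor : mean_mx pi_g (fun z => neumann_factor c G z x y) = N.
Proof.
have -> : (fun z => neumann_factor c G z x y)
    = (fun z => 1%:M + (- (L_g c)^-1) *: hess_yy (G z) x y).
  by apply/funext => z; rewrite scaleNr.
have iH := (G_unbiased_yy x y).1.
rewrite mean_mxD; [|exact: integrable_mx_cst|exact: integrable_mxZ].
by rewrite mean_mx_cst mean_mxZ// (G_unbiased_yy x y).2 scaleNr.
Qed.

Lemma estimator_mean : integrable_mx pibar (fun s => est s x y) /\
  mean_mx pibar (fun s => est s x y) = grad_x f x y - (L_g c)^-1 *: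
    (hess_xy g x y *m \sum_(j < K) (pow j *m grad_y f x y)).
Proof.
have mi p q d' (T : measurableType d') (P : probability T R) (A : T -> 'M[R]_(p, q)) :
    integrable_mx P A -> measurable_mx A.
  by move=> iA u v; exact: measurable_integrable_mx.
have bb : bounded_mx (fun xi => grad_y (F xi) x y).
  exists (C_fy c) => xi i j; rewrite ord1.
  by rewrite (le_trans (entry_le_enorm _ _))//; exact: upper_bound (F_upper xi) _ _.
have bA : bounded_mx (fun z => hess_xy (G z) x y).
  exists (C_gxy c) => z i j.
  by rewrite (le_trans (entry_le_opnorm _ _ _))//; exact: lower_bound (G_lower z) _ _.
have bM : bounded_mx (fun z => neumann_factor c G z x y).
  exists rho => z i j.
  have := neumann_factor_le mu_g_gt0 L_g_mu_g G_lower z x y (delta_mx j 0).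
  rewrite enorm_delta mulr1; apply: le_trans; apply: le_trans (entry_le_enorm _ i).
  by move: (neumann_factor _ _ _ _ _) => M; rewrite -colE mxE.
have [h1 h2] := mean_random_product K_gt0 pibar_law
  (mi _ _ _ _ _ _ (F_unbiased_y x y).1) (mi _ _ _ _ _ _ (G_unbiased_xy x y).1)
  (mi _ _ _ _ _ _ integrable_factor) bb bA bM (K%:R / L_g c) (F_unbiased_x x y).1.
split; first exact: h1.
rewrite [LHS]h2 (F_unbiased_x x y).2 (G_unbiased_xy x y).2 mean_factor.
by rewrite (F_unbiased_y x y).2 mulrAC mulfV ?mul1r// pnatr_eq0 -lt0n.
Qed.

Let pow_comm k : pow k *m N = pow k.+1.
Proof.
elim: k => [|k IH]; first by rewrite /pow /= mul1mx mulmx1.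
by rewrite {1}/pow iterS -mulmxA -/(pow k) IH.
Qed.

Let pow_le k v : enorm (pow k *m v) <= rho ^+ k * enorm v.
Proof.
elim: k => [|k IH]; first by rewrite /pow/= mul1mx expr0 mul1r.
rewrite /pow iterS -mulmxA -/(pow k).
rewrite (le_trans (neumann_factor_contracts mu_g_gt0 L_g_mu_g g_lower _ _ _))//.
by rewrite exprS -mulrA ler_wpM2l// ltW// rho_gt0.
Qed.

(** The partial sum [L_g^-1 (1 + N + ... + N ^ (K - 1))] of the Neumann series
    of the inverse Hessian telescopes, and what it misses is the tail
    [N ^ K H^-1]. *)
Lemma bias_tail : bias pibar est (surrogate f g) x y
  = hess_xy g x y *m (pow K *m (invmx (hess_yy g x y) *m grad_y f x y)).
Proof.
rewrite /bias estimator_mean.2 /surrogate.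
set H := hess_yy g x y; set v := grad_y f x y; set u := invmx H *m v.
have HU : H \in unitmx by exact: hess_yy_unit mu_g_gt0 _ g_lower _ _.
have vE : v = H *m u by rewrite mulKVmx.
have stepE j : (L_g c)^-1 *: (pow j *m v) = pow j *m u - pow j.+1 *m u.
  rewrite vE -pow_comm -mulmxBl -{2}(mulmx1 (pow j)) -mulmxBr /N -/H.
  by rewrite opprB addrC subrK -scalemxAr -scalemxAl !mulmxA.
have tele : (L_g c)^-1 *: (\sum_(j < K) (pow j *m v)) = u - pow K *m u.
  rewrite scaler_sumr (eq_bigr _ (fun (j : 'I_K) _ => stepE j)).
  elim: (K) => [|k IH]; first by rewrite big_ord0 mul1mx subrr.
  by rewrite big_ord_recr/= IH addrA subrK.
rewrite scalemxAr tele mulmxBr -mulmxA -/u.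
move: (hess_xy g x y *m u) (hess_xy g x y *m (pow K *m u)) (grad_x f x y).
by move=> w w' a; apply/matrixP => i j; rewrite !mxE; ring.
Qed.

Lemma bias_le : enorm (bias pibar est (surrogate f g) x y)
  <= C_gxy c * (rho ^+ K * ((mu_g c)^-1 * C_fy c)).
Proof.
rewrite bias_tail (le_trans (enorm_mulmx_le _ (lower_bound g_lower x y)))//.
rewrite ler_wpM2l ?(ltW C_gxy_gt0)// (le_trans (pow_le _ _))//.
rewrite ler_wpM2l ?exprn_ge0 ?(ltW (rho_gt0 _ _))//.
rewrite (le_trans (inv_hess_yy_le mu_g_gt0 g_lower _ _ _))//.
by rewrite ler_wpM2l ?invr_ge0 ?(ltW mu_g_gt0)//; exact: upper_bound f_upper x y.
Qed.

End Point.

(** Since [rho <= exp (- mu_g / L_g)], the prescribed number of samples makes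
    [rho ^ (2 K)] at most the reciprocal of the argument of the logarithm. *)
Lemma bias_sq_le (T : nat) x y : (1 <= T)%N -> K = sample_number c T ->
  enorm (bias pibar est (surrogate f g) x y) ^+ 2 <= T%:R^-1.
Proof.
move=> T1 KE; have T0 : 0 < T%:R :> R by rewrite ltr0n.
have C0 := C_fy_ge0 f_upper.
have r0 := rho_gt0 mu_g_gt0 L_g_mu_g.
have B0 := enorm_ge0 (bias pibar est (surrogate f g) x y).
have := bias_le x y; set B := enorm _ in B0 *.
have [->|Cn0] := eqVneq (C_fy c) 0.
  rewrite !mulr0 => B1; have -> : B = 0 by apply/eqP; rewrite eq_le B1.
  by rewrite expr0n invr_ge0 ltW.
have Cgt : 0 < C_fy c by rewrite lt_def Cn0.
move=> hB.
pose X := C_gxy c ^+ 2 * C_fy c ^+ 2 * T%:R / mu_g c ^+ 2.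
have X0 : 0 < X by rewrite divr_gt0 ?mulr_gt0 ?exprn_gt0.
have KX : L_g c / (2 * mu_g c) * ln X <= K%:R.
  rewrite KE /sample_number -/X; set z := Num.ceil _.
  have z1 : (1 <= Num.max (1 : int) z)%R by rewrite le_max lexx.
  rewrite natr_absz gtr0_norm ?(lt_le_trans _ z1)//.
  apply: (@le_trans _ _ (z%:~R)); first exact: Num.Theory.ceil_ge.
  by rewrite ler_int le_max lexx orbT.
have e1 : rho ^+ K ^+ 2 <= X^-1.
  have h : rho <= expR (- (mu_g c / L_g c)) by exact: expR_ge1Dx.
  rewrite -exprM (le_trans (y := expR (- (mu_g c / L_g c)) ^+ (K * 2)))//.
    by rewrite ler_pXn2r ?nnegrE ?expR_ge0 ?(ltW r0)// muln_gt0 K_gt0.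
  rewrite -expRM_natl -[X in _ <= X^-1]lnK ?posrE// -expRN ler_expR.
  rewrite natrM mulrN lerN2.
  have k0 : 0 < 2 * (mu_g c / L_g c) by rewrite mulr_gt0// divr_gt0.
  have := ler_wpM2l (ltW k0) KX.
  have -> : 2 * (mu_g c / L_g c) * (L_g c / (2 * mu_g c) * ln X) = ln X.
    by field; rewrite !gt_eqF.
  by lra.
have h2 : B ^+ 2 <= (C_gxy c * (rho ^+ K * ((mu_g c)^-1 * C_fy c))) ^+ 2.
  by rewrite ler_pXn2r ?nnegrE// (le_trans B0).
apply: (le_trans h2); rewrite exprMn (exprMn _ (rho ^+ K)) exprMn exprVn.
have q0 : 0 <= C_gxy c ^+ 2 * ((mu_g c ^+ 2)^-1 * C_fy c ^+ 2).
  apply: mulr_ge0; first exact: sqr_ge0.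
  by apply: mulr_ge0; rewrite ?invr_ge0; exact: sqr_ge0.
have := ler_wpM2l q0 e1.
have -> : C_gxy c ^+ 2 * ((mu_g c ^+ 2)^-1 * C_fy c ^+ 2) * X^-1 = T%:R^-1.
  by rewrite /X; field; rewrite !gt_eqF.
by apply: le_trans; rewrite le_eqVlt; apply/predU1P; left; ring.
Qed.

(** The pathwise bound depends on the draw through the index only, whose law
    is uniform. *)
Lemma estimator_ms_lip x y x' y' :
  (\int[pibar]_s (enorm (est s x y - est s x' y') ^+ 2)%:E
   <= (L_K_sq c K * enorm_pair (x - x') (y - y') ^+ 2)%:E)%E.
Proof.
set D := enorm_pair _ _ ^+ 2; have D0 : 0 <= D by exact: sqr_ge0.
have mj (j : nat) : measurable [set s : S | s.2 = j] by exact: (measurable_index [set j]).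
have w0 j : 0 <= est_lip c K j * D by rewrite mulr_ge0// est_lip_ge0.
have mb0 : measurable (@index_overflow _ _ Xi Z K).
  exact: (measurable_index [set j | (K <= j)%N]).
have mE (j : nat) : measurable_fun setT
    (EFin \o (\1_[set s : S | s.2 = j] : S -> R)).
  by apply/measurable_EFinP; exact: measurable_indic.
apply: (@le_trans _ _ (\int[pibar]_s
    \sum_(j < K) ((est_lip c K j * D)%:E * (\1_[set s : S | s.2 = j] s)%:E))%E).
  apply: (ge0_le_integral_off_null mb0 (pibar_overflow K_gt0 pibar_law)).
  - by move=> s; rewrite lee_fin sqr_ge0.
  - by move=> s; apply: sume_ge0 => j _; rewrite mule_ge0// lee_fin.
  move=> s /negP; rewrite -ltnNge => sK.
  rewrite (bigD1 (Ordinal sK))//= indicE mem_set// mule1.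
  rewrite -[leLHS]adde0; apply: leeD; last first.
    by apply: sume_ge0 => j _; rewrite mule_ge0// lee_fin.
  by rewrite lee_fin; exact: est_sub_sq.
rewrite ge0_integral_sum//; last 2 first.
- move=> j; apply: emeasurable_funM; first exact: measurable_cst.
  exact: mE.
- by move=> j s _; rewrite mule_ge0// lee_fin.
have term (j : 'I_K) : (\int[pibar]_s ((est_lip c K j * D)%:E
    * (\1_[set s : S | s.2 = j] s)%:E) = (est_lip c K j * D * K%:R^-1)%:E)%E.
  have i0 : (0 <= (est_lip c K j * D)%:E)%E by rewrite lee_fin.
  have i1 (s : S) : setT s -> (0 <= (\1_[set s : S | s.2 = j] s : R)%:E)%E.
    by rewrite lee_fin.
  rewrite (ge0_integralZl pibar measurableT (mE j) i1 i0).
  rewrite integral_indic// setIT.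
  by rewrite [X in (_ * X)%E](pibar_index pibar_law (ltn_ord j)) -EFinM.
rewrite (eq_bigr (fun j : 'I_K => (est_lip c K j * D * K%:R^-1)%:E)); last first.
  by move=> j _; exact: term.
rewrite sumEFin lee_fin.
have := ler_wpM2r D0 (est_lip_average mu_g_gt0 L_g_mu_g K_gt0).
rewrite mulr_suml; apply: le_trans; rewrite le_eqVlt; apply/predU1P; left.
by apply: eq_bigr => j _; ring.
Qed.

End EstimatorMoments.

(** * One step of the algorithm, with the past frozen *)

(** In the one-step inequality the three errors of the Lyapunov function and
    the squared length of the direction each get a coefficient.  The step-size
    conditions make the first three at most [1 - muf a] and the last one at
    most [0]. *)
Section StepSizes.
Context {R : realType}.
Variables (a mu muf L Ly Lf LK Lg ch : R).
Hypotheses (a0 : 0 < a) (mu0 : 0 < mu) (muf0 : 0 < muf) (L0 : 0 <= L)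
  (Ly0 : 0 <= Ly) (LK0 : 0 < LK) (Lg0 : 0 < Lg).
Hypothesis chE : ch * mu = 8 * Ly ^+ 2 + 8 * L ^+ 2 + 2 * muf.
Hypothesis LfE : Lf = L * (1 + Ly).
Hypothesis h1 : a * (muf + 1) <= 1.
Hypothesis h2 : a * (2 * mu * ch) <= 1.
Hypothesis h4 : a * (8 * LK + Lf) <= 1.
Hypothesis h5 : a * (4 * LK * Lg ^+ 2 * ch ^+ 2) <= L ^+ 2 + 2 * Ly ^+ 2.

(** The Young parameter for the drift of [ystar].  It is what the contraction
    [a (8 Ly ^ 2 + 8 L ^ 2 + 2 muf)] of the lower level leaves after paying
    [2 a L ^ 2] for the error of the direction, [a / 2 (L ^ 2 + 2 Ly ^ 2)] for
    the noise that the displacement of [y] adds to the momentum, and [a muf]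
    for the rate. *)
Definition young_slack : R := a * (7 * Ly ^+ 2 + 11 / 2 * L ^+ 2 + muf).

Lemma young_slack_gt0 : 0 < young_slack.
Proof.
by rewrite mulr_gt0//; have := sqr_ge0 Ly; have := sqr_ge0 L; have := muf0; lra.
Qed.

Lemma young_slack_le1 : young_slack <= 1.
Proof.
have e : a * (2 * mu * ch) = a * (2 * (ch * mu)) by ring.
have k2 := h2; rewrite e chE in k2; rewrite /young_slack.
have p1 := mulr_ge0 (ltW a0) (sqr_ge0 Ly); have p2 := mulr_ge0 (ltW a0) (sqr_ge0 L).
have p3 := mulr_gt0 a0 muf0; lra.
Qed.

Lemma distance_coefficient :
  2 * a * L ^+ 2 + 2 * LK * (ch * a) ^+ 2 * Lg ^+ 2
    + (1 + young_slack) * (1 - ch * a * mu) <= 1 - muf * a.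
Proof.
have e1 : 2 * LK * (ch * a) ^+ 2 * Lg ^+ 2
    = a / 2 * (a * (4 * LK * Lg ^+ 2 * ch ^+ 2)) by field.
have e2 : ch * a * mu = a * (ch * mu) by ring.
have := ler_wpM2l (ltW (divr_gt0 a0 (ltr0Sn R 1))) h5; rewrite -e1 e2 chE => k5.
have g0 := ltW young_slack_gt0.
have k : 0 <= young_slack * (a * (8 * Ly ^+ 2 + 8 * L ^+ 2 + 2 * muf)).
  rewrite mulr_ge0// mulr_ge0 ?(ltW a0)//.
  by have := sqr_ge0 Ly; have := sqr_ge0 L; have := muf0; lra.
move: k; rewrite /young_slack; lra.
Qed.

(** Young's inequality costs [1 / young_slack], but [Ly ^ 2 / young_slack] is
    at most [1 / (7 a)], so that the drift of [ystar] takes about [a / 7] of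
    the available [a / 2]; the step-size conditions keep the rest below what
    remains. *)
Lemma direction_coefficient :
  - (a / 2) + Lf * a ^+ 2 / 2 + 2 * LK * a ^+ 2
    + (1 + young_slack^-1) * Ly ^+ 2 * a ^+ 2 <= 0.
Proof.
have e : a * (2 * mu * ch) = a * (2 * (ch * mu)) by ring.
have k2 := h2; rewrite e chE in k2; have k4 := h4.
have u0 := mulr_ge0 (ltW a0) (sqr_ge0 L); have v0 := mulr_ge0 (ltW a0) (sqr_ge0 Ly).
have a1 : a <= 1 by have := mulr_gt0 a0 muf0; have := h1; lra.
have q0 : 0 < 7 * Ly ^+ 2 + 11 / 2 * L ^+ 2 + muf.
  by have := sqr_ge0 Ly; have := sqr_ge0 L; have := muf0; lra.
(* the constant 7 is the coefficient of [Ly ^ 2] in [young_slack] *)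
have young : young_slack^-1 * Ly ^+ 2 * a ^+ 2 <= a / 7.
  have -> : young_slack^-1 * Ly ^+ 2 * a ^+ 2
      = a * (Ly ^+ 2 / (7 * Ly ^+ 2 + 11 / 2 * L ^+ 2 + muf)).
    rewrite /young_slack; move: (_ + muf) q0 => q q0.
    by field; rewrite !gt_eqF.
  rewrite ler_pM2l// ler_pdivrMr//.
  by have := sqr_ge0 Ly; have := sqr_ge0 L; have := muf0; lra.
have aLf : a * Lf <= 1 / 8 + 5 / 2 * (a * L ^+ 2) + 1 / 2 * (a * Ly ^+ 2).
  (* [2 L (1 / 4) <= L ^ 2 + 1 / 16] and [2 L Ly <= L ^ 2 + Ly ^ 2] make [a Lf] small,
     because [a L ^ 2] and [a Ly ^ 2] are at most [1 / 16] by [h2] *)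
  have s1 := mulr_ge0 (ltW a0) (sqr_ge0 (L - 1 / 4)).
  have s2 := mulr_ge0 (ltW a0) (sqr_ge0 (L - Ly)).
  by rewrite LfE; lra.
have muf1 := mulr_gt0 a0 muf0.
have key : - (1 / 2) + a * Lf / 2 + 2 * (a * LK) + a * Ly ^+ 2 + 1 / 7 <= 0 by lra.
have := mulr_ge0 (ltW a0) (_ : 0 <= - (- (1 / 2) + a * Lf / 2 + 2 * (a * LK) + a * Ly ^+ 2 + 1 / 7)).
rewrite oppr_ge0 => /(_ key); lra.
Qed.

(** With [e = (muf + 1) a] between [0] and [1], [(1 - e) ^ 2 <= 1 - e]. *)
Lemma momentum_coefficient : a + (1 - (muf + 1) * a) ^+ 2 <= 1 - muf * a.
Proof.
have e0 : 0 <= (muf + 1) * a by rewrite mulr_ge0 ?(ltW a0)//; have := muf0; lra.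
have e1 : (muf + 1) * a <= 1 by rewrite mulrC.
have := mulr_ge0 e0 (_ : 0 <= 1 - (muf + 1) * a); rewrite subr_ge0 => /(_ e1).
by lra.
Qed.

End StepSizes.

Section Sustain.
Context {R : realType} {n m : nat}.
Variables (c : constants R) (mu_f sigma_f sigma_g : R).
Hypotheses (L_fx_ge0 : 0 <= L_fx c) (L_fy_ge0 : 0 <= L_fy c).
Hypotheses (L_gxy_ge0 : 0 <= L_gxy c) (L_gyy_ge0 : 0 <= L_gyy c).
Hypotheses (C_gxy_gt0 : 0 < C_gxy c) (mu_g_gt0 : 0 < mu_g c).
Hypotheses (L_g_mu_g : 0 < L_g c - mu_g c) (mu_f_gt0 : 0 < mu_f).
Variables (f g : 'cV[R]_n -> 'cV[R]_m -> R).
Hypotheses (f_upper : upper_level c f) (g_lower : lower_level c g).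
Variable ystar : 'cV[R]_n -> 'cV[R]_m.
Hypothesis ystar_argmin : forall x y, g x (ystar x) <= g x y.
Variable ell : 'cV[R]_n -> R.
Hypothesis ell_def : forall x, ell x = f x (ystar x).
Variable ell_star : R.
Hypothesis ell_star_min : (exists x, ell x = ell_star) /\ forall x, ell_star <= ell x.
Hypothesis ell_convex : strongly_convex mu_f ell.

Context {d d' : measure_display} {Z : measurableType d} {S : measurableType d'}.
Variables (pi_g : probability Z R) (pibar : probability S R).
Variables (Gam : Z -> 'cV[R]_n -> 'cV[R]_m -> 'cV[R]_m).
Variables (E : S -> 'cV[R]_n -> 'cV[R]_m -> 'cV[R]_n) (LK T : R).
Hypothesis Gam_unbiased : unbiased pi_g Gam (grad_y g).
Hypothesis Gam_variance : forall x y,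
  (\int[pi_g]_z (enorm (Gam z x y - grad_y g x y) ^+ 2)%:E <= (sigma_g ^+ 2)%:E)%E.
Hypothesis Gam_continuous : forall z i, econtinuous (fun x y => Gam z x y i 0).
Hypothesis E_integrable : forall x y, integrable_mx pibar (fun s => E s x y).
Hypothesis E_continuous : forall s i, econtinuous (fun x y => E s x y i 0).

Definition emean x y : 'cV[R]_n := mean_mx pibar (fun s => E s x y).

Hypothesis E_variance : forall x y,
  (\int[pibar]_s (enorm (E s x y - emean x y) ^+ 2)%:E <= (sigma_f ^+ 2)%:E)%E.
Hypothesis E_ms_lip : forall x y x' y',
  (\int[pibar]_s (enorm (E s x y - E s x' y') ^+ 2)%:E
   <= (LK * enorm_pair (x - x') (y - y') ^+ 2)%:E)%E.
Hypothesis E_bias : forall x y, enorm (emean x y - surrogate f g x y) ^+ 2 <= T^-1.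
Hypothesis LK0 : 0 < LK.

Let Gam_measurable x y : measurable_mx (fun z => Gam z x y).
Proof. by move=> i j; apply: measurable_integrable_mx; exact: (Gam_unbiased x y).1. Qed.

Let E_measurable x y : measurable_mx (fun s => E s x y).
Proof. by move=> i j; exact: measurable_integrable_mx. Qed.

(** Recursive momentum: the error contracts by [1 - eta] and picks up the
    sampling noise and the displacement of the iterates. *)
Lemma frozen_momentum x y x' y' h (eta : R) : 0 <= eta -> eta <= 1 ->
  (\int[pibar]_s (enorm (E s x' y' + (1 - eta) *: (h - E s x y) - emean x' y') ^+ 2)%:E
   <= ((1 - eta) ^+ 2 * enorm (h - emean x y) ^+ 2 + 2 * eta ^+ 2 * sigma_f ^+ 2
       + 2 * LK * (enorm (x' - x) ^+ 2 + enorm (y' - y) ^+ 2))%:E)%E.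
Proof.
move=> e0 e1; pose D2 := enorm (x' - x) ^+ 2 + enorm (y' - y) ^+ 2.
pose Y s := E s x' y' - E s x y.
pose X s := eta *: (E s x' y' - emean x' y') + (1 - eta) *: (Y s - mean_mx pibar Y).
have iE := E_integrable.
have iY : integrable_mx pibar Y by exact: integrable_mxB.
have mYE : mean_mx pibar Y = emean x' y' - emean x y by exact: mean_mxB.
have iC n0 (A : S -> 'cV[R]_n0) : integrable_mx pibar A ->
    integrable_mx pibar (fun s => A s - mean_mx pibar A) /\
    mean_mx pibar (fun s => A s - mean_mx pibar A) = 0.
  move=> iA; have ic := @integrable_mx_cst _ _ _ pibar _ _ (mean_mx pibar A).
  by split; [exact: integrable_mxB|rewrite mean_mxB// mean_mx_cst subrr].
have [i1 m1] := iC _ _ (iE x' y'); have [i2 m2] := iC _ _ iY.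
have iX : integrable_mx pibar X.
  by apply: integrable_mxD; exact: integrable_mxZ.
have mX : mean_mx pibar X = 0.
  rewrite mean_mxD; [|exact: integrable_mxZ..].
  by rewrite !mean_mxZ// m1 m2 !scaler0 addr0.
have meas n0 (A : S -> 'cV[R]_n0) : integrable_mx pibar A ->
    measurable_fun setT (fun s => enorm (A s) ^+ 2).
  by move=> iA; apply: measurable_enorm2 => i; exact: measurable_integrable_mx.
have XB : (\int[pibar]_s (enorm (X s) ^+ 2)%:E
    <= (0 + 2 * eta ^+ 2 * sigma_f ^+ 2 + 2 * (LK * D2))%:E)%E.
  apply: (@integral_le_affine _ _ _ _ (fun s => enorm (E s x' y' - emean x' y') ^+ 2)
    (fun s => enorm (Y s - mean_mx pibar Y) ^+ 2)).
  - exact: meas.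
  - exact: meas.
  - exact: meas.
  - by move=> s; rewrite sqr_ge0.
  - by move=> s; rewrite sqr_ge0.
  - by move=> s; rewrite sqr_ge0.
  - by rewrite mulr_ge0// sqr_ge0.
  - by [].
  - by [].
  - exact: E_variance.
  - apply: second_moment_centered => //.
    by rewrite /D2 -enorm_pair2; exact: E_ms_lip.
  move=> s; rewrite (le_trans (enorm_sqD2 _ _))// !enormZ !exprMn !real_normK ?num_real//.
  have q1 : (1 - eta) ^+ 2 <= 1 by rewrite expr_le1 ?subr_ge0// gerBl.
  have := ler_wpM2r (sqr_ge0 (enorm (Y s - mean_mx pibar Y))) q1.
  by lra.
have Xfin := le_lt_trans XB (ltry _).
have := second_moment_shift ((1 - eta) *: (h - emean x y)) iX mX Xfin.
have -> : (\int[pibar]_s (enorm ((1 - eta) *: (h - emean x y) + X s) ^+ 2)%:E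
    = \int[pibar]_s (enorm (E s x' y' + (1 - eta) *: (h - E s x y) - emean x' y') ^+ 2)%:E)%E.
  apply: eq_integral => s _; congr ((enorm _ ^+ 2)%:E); rewrite /X mYE /Y.
  by apply/matrixP => i j; rewrite !mxE; ring.
move=> ->; rewrite enormZ exprMn real_normK ?num_real//.
rewrite -[X in (_ <= (X)%:E)%E]addrA EFinD leeD2l// (le_trans XB)// lee_fin.
by rewrite /D2; lra.
Qed.

(** The three errors that the algorithm has to control: the optimality gap,
    the error of the recursive direction as an estimate of the mean of the
    estimator (its noise, without its bias), and the error of the lower
    iterate. *)
Definition lyapunov x y h : R := (ell x - ell_star) + enorm (h - emean x y) ^+ 2
  + enorm (y - ystar x) ^+ 2.

Lemma lyapunov_ge0 x y h : 0 <= lyapunov x y h.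
Proof.
apply: addr_ge0 (sqr_ge0 _); apply: addr_ge0 (sqr_ge0 _).
by rewrite subr_ge0; case: ell_star_min.
Qed.

Lemma direction_error x y h :
  enorm (hgrad f g ystar x - h) ^+ 2 <= 4 * L_bar c ^+ 2 * enorm (y - ystar x) ^+ 2
    + 4 * T^-1 + 2 * enorm (h - emean x y) ^+ 2.
Proof.
set G := hgrad f g ystar x; set s := surrogate f g x y; set e := h - emean x y.
have -> : G - h = ((G - s) - (emean x y - s)) - e.
  by rewrite /e; apply/matrixP => i j; rewrite !mxE; ring.
have h1 := enorm_sqD2 ((G - s) - (emean x y - s)) (- e).
have h2 := enorm_sqD2 (G - s) (- (emean x y - s)).
rewrite !enormN in h1 h2.
have h3 : enorm (G - s) ^+ 2 <= L_bar c ^+ 2 * enorm (y - ystar x) ^+ 2.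
  rewrite -exprMn ler_pXn2r ?nnegrE ?enorm_ge0//.
    exact: (hgrad_surrogate_le L_gxy_ge0 L_gyy_ge0 C_gxy_gt0 mu_g_gt0 f_upper g_lower).
  rewrite mulr_ge0 ?enorm_ge0//.
  exact: (L_bar_ge0 L_fx_ge0 L_fy_ge0 L_gxy_ge0 L_gyy_ge0 C_gxy_gt0 mu_g_gt0 f_upper).
have h4 : enorm (emean x y - s) ^+ 2 <= T^-1 by exact: E_bias.
by move: h1 h2 h3 h4; lra.
Qed.

(** The stochastic gradient is unbiased, so its noise is orthogonal to [v]. *)
Lemma noise_moment x y (v : 'cV[R]_m) (k : R) :
  (\int[pi_g]_z (enorm (v + k *: (Gam z x y - grad_y g x y)) ^+ 2)%:E
   <= (enorm v ^+ 2 + k ^+ 2 * sigma_g ^+ 2)%:E)%E.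
Proof.
have [iG mG] := Gam_unbiased x y.
have ic := @integrable_mx_cst _ _ _ pi_g _ _ (grad_y g x y).
have iN : integrable_mx pi_g (fun z => Gam z x y - grad_y g x y).
  exact: integrable_mxB.
have mN : mean_mx pi_g (fun z => Gam z x y - grad_y g x y) = 0.
  by rewrite mean_mxB// mean_mx_cst mG subrr.
have ikN : integrable_mx pi_g (fun z => k *: (Gam z x y - grad_y g x y)).
  exact: integrable_mxZ.
have mkN : mean_mx pi_g (fun z => k *: (Gam z x y - grad_y g x y)) = 0.
  by rewrite mean_mxZ// mN scaler0.
have mN2 : measurable_fun setT (fun z => enorm (Gam z x y - grad_y g x y) ^+ 2).
  by apply: measurable_enorm2 => i; exact: measurable_integrable_mx.
have kB : (\int[pi_g]_z (enorm (k *: (Gam z x y - grad_y g x y)) ^+ 2)%:E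
    <= (k ^+ 2 * sigma_g ^+ 2)%:E)%E.
  under eq_integral do rewrite enormZ exprMn real_normK ?num_real// EFinM.
  rewrite ge0_integralZl//.
  - by rewrite (EFinM (k ^+ 2)); apply: lee_wpmul2l => //; rewrite lee_fin sqr_ge0.
  - exact/measurable_EFinP.
  - by move=> z _; rewrite lee_fin sqr_ge0.
  - by rewrite lee_fin sqr_ge0.
rewrite (second_moment_shift v ikN mkN (le_lt_trans kB (ltry _))).
by rewrite EFinD leeD2l.
Qed.

Variables (alpha ch : R).
Hypothesis alpha_gt0 : 0 < alpha.
Hypothesis chE : ch = chat_beta c mu_f.
Hypothesis h1 : alpha * (mu_f + 1) <= 1.
Hypothesis h2 : alpha * (2 * mu_g c * ch) <= 1.
Hypothesis h3 : ch * alpha <= mu_g c / L_g c ^+ 2.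
Hypothesis h4 : alpha * (8 * LK + L_f c) <= 1.
Hypothesis h5 : alpha * (4 * LK * L_g c ^+ 2 * ch ^+ 2) <= L_bar c ^+ 2 + 2 * L_y c ^+ 2.
Hypothesis T_ge0 : 0 <= T.
Local Notation eta := ((mu_f + 1) * alpha).
Local Notation Phi := lyapunov.

Definition step_const : R := 2 / T + ((2 * ch ^+ 2 + 8 * ch ^+ 2 * LK) * sigma_g ^+ 2
  + 2 * (mu_f + 1) ^+ 2 * sigma_f ^+ 2) * alpha.

(** The bound on the Lyapunov function after one step that remains once the
    fresh draw of the estimator has been integrated out. *)
Definition half_step x y h z : R :=
  let x' := x - alpha *: h in let y' := y - (ch * alpha) *: Gam z x y in
  (ell x' - ell_star)
  + ((1 - eta) ^+ 2 * enorm (h - emean x y) ^+ 2 + 2 * eta ^+ 2 * sigma_f ^+ 2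
     + 2 * LK * (enorm (x' - x) ^+ 2 + enorm (y' - y) ^+ 2))
  + enorm (y' - ystar x') ^+ 2.

(** The descent inequality, the Polyak-Lojasiewicz inequality and the
    contraction of the lower gradient step, added up with the coefficients of
    the previous section. *)
Lemma frozen_step x y h :
  (\int[pi_g]_z (half_step x y h z)%:E
   <= ((1 - mu_f * alpha) * Phi x y h + alpha * step_const)%:E)%E.
Proof.
have L0 := L_g_gt0 mu_g_gt0 L_g_mu_g.
have Ly0 := L_y_ge0 C_gxy_gt0 mu_g_gt0.
have Lb0 : 0 <= L_bar c.
  exact: (L_bar_ge0 L_fx_ge0 L_fy_ge0 L_gxy_ge0 L_gyy_ge0 C_gxy_gt0 mu_g_gt0 f_upper).
have chE' : ch * mu_g c = 8 * L_y c ^+ 2 + 8 * L_bar c ^+ 2 + 2 * mu_f.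
  by rewrite chE /chat_beta divfK// gt_eqF.
have ch0 : 0 <= ch.
  by rewrite -(pmulr_lge0 _ mu_g_gt0) chE'; have := sqr_ge0 (L_y c);
    have := sqr_ge0 (L_bar c); have := mu_f_gt0; lra.
have Lf := L_fE c.
pose gam := young_slack alpha mu_f (L_bar c) (L_y c).
have gam0 : 0 < gam by exact: young_slack_gt0.
have gam1 : gam <= 1 by exact: (@young_slack_le1 _ _ (mu_g c) _ _ _ ch).
have cD := @distance_coefficient _ alpha (mu_g c) mu_f (L_bar c) (L_y c) LK (L_g c)
  ch alpha_gt0 mu_f_gt0 chE' h5.
have cH := @direction_coefficient _ alpha (mu_g c) mu_f (L_bar c) (L_y c) (L_f c) LK
  ch alpha_gt0 mu_f_gt0 chE' Lf h1 h2 h4.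
have cE := momentum_coefficient alpha_gt0 mu_f_gt0 h1.
rewrite -/gam in cD cH.
set b := ch * alpha; have b0 : 0 <= b by rewrite mulr_ge0// ltW.
set x' := x - alpha *: h.
set D := enorm (y - ystar x) ^+ 2; set H := enorm h ^+ 2.
set Ee := enorm (h - emean x y) ^+ 2.
have D0 : 0 <= D by exact: sqr_ge0.
have H0 : 0 <= H by exact: sqr_ge0.
have Ee0 : 0 <= Ee by exact: sqr_ge0.
have ex0 : 0 <= ell x' - ell_star by rewrite subr_ge0; case: ell_star_min.
have gi0 : 0 < gam^-1 by rewrite invr_gt0.
(* everything in the half step that does not depend on the sample [z] *)
pose k0 := (ell x' - ell_star) + (1 - eta) ^+ 2 * Ee + 2 * eta ^+ 2 * sigma_f ^+ 2
  + 2 * LK * (alpha ^+ 2 * H) + (1 + gam^-1) * (L_y c ^+ 2 * (alpha ^+ 2 * H)).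
have k00 : 0 <= k0.
  have aH : 0 <= alpha ^+ 2 * H by rewrite mulr_ge0// sqr_ge0.
  apply: addr_ge0; last first.
    by rewrite mulr_ge0 ?addr_ge0 ?(ltW gi0)// mulr_ge0// sqr_ge0.
  apply: addr_ge0; last by rewrite mulr_ge0// mulr_ge0// ltW.
  apply: addr_ge0; last by rewrite mulr_ge0 ?sqr_ge0// mulr_ge0// sqr_ge0.
  by apply: addr_ge0 => //; rewrite mulr_ge0// sqr_ge0.
have mG : measurable_mx (fun z => Gam z x y) by exact: Gam_measurable.
have mb : measurable_mx (fun z => y - b *: Gam z x y).
  by apply: measurable_mxB; [exact: measurable_mx_cst|exact: measurable_mxZ].
have mu1 : measurable_fun setT (fun z => enorm (Gam z x y) ^+ 2) by exact: measurable_mx_enorm2.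
have mv1 : measurable_fun setT (fun z => enorm (y - b *: Gam z x y - ystar x) ^+ 2).
  by apply: measurable_mx_enorm2; apply: measurable_mxB => //; exact: measurable_mx_cst.
have mw : measurable_fun setT (half_step x y h).
  rewrite /half_step -/b -/x' -/Ee.
  apply: measurable_funD; last first.
    by apply: measurable_mx_enorm2; apply: measurable_mxB => //; exact: measurable_mx_cst.
  apply: measurable_funD => //; apply: measurable_funD => //.
  apply: measurable_funM => //; apply: measurable_funD => //.
  by apply: measurable_mx_enorm2; apply: measurable_mxB => //; exact: measurable_mx_cst.
have xx : enorm (x' - x) ^+ 2 = alpha ^+ 2 * H.
  by rewrite /x' addrAC subrr add0r enormN enormZ exprMn real_normK ?num_real.
have uA : (\int[pi_g]_z (enorm (Gam z x y) ^+ 2)%:E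
    <= (L_g c ^+ 2 * D + sigma_g ^+ 2)%:E)%E.
  have := noise_moment x y (grad_y g x y) 1; under eq_integral do rewrite scale1r addrC subrK.
  move/le_trans; apply; rewrite expr1n mul1r lee_fin lerD2r -exprMn.
  rewrite ler_pXn2r ?nnegrE ?mulr_ge0 ?enorm_ge0 ?(ltW L0)//.
  exact: (grad_y_le_dist g_lower ystar_argmin).
have vB : (\int[pi_g]_z (enorm (y - b *: Gam z x y - ystar x) ^+ 2)%:E
    <= ((1 - b * mu_g c) * D + b ^+ 2 * sigma_g ^+ 2)%:E)%E.
  have := noise_moment x y (y - b *: grad_y g x y - ystar x) (- b).
  have -> : (\int[pi_g]_z (enorm (y - b *: grad_y g x y - ystar x
      + - b *: (Gam z x y - grad_y g x y)) ^+ 2)%:E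
      = \int[pi_g]_z (enorm (y - b *: Gam z x y - ystar x) ^+ 2)%:E)%E.
    apply: eq_integral => z _; congr ((enorm _ ^+ 2)%:E).
    by apply/matrixP => i j; rewrite !mxE; ring.
  move/le_trans; apply; rewrite sqrrN lee_fin lerD2r.
  exact: (gradient_step_contracts mu_g_gt0 L_g_mu_g g_lower ystar_argmin).
have pw z : half_step x y h z <= k0 + 2 * LK * b ^+ 2 * enorm (Gam z x y) ^+ 2
    + (1 + gam) * enorm (y - b *: Gam z x y - ystar x) ^+ 2.
  rewrite /half_step -/b -/x' -/Ee xx.
  have -> : y - b *: Gam z x y - y = - (b *: Gam z x y) by rewrite addrAC subrr add0r.
  have bG : enorm (- (b *: Gam z x y)) ^+ 2 = b ^+ 2 * enorm (Gam z x y) ^+ 2.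
    by rewrite enormN enormZ exprMn real_normK ?num_real.
  rewrite bG.
  have := enorm_sqD_young (y - b *: Gam z x y - ystar x) (ystar x - ystar x') gam0.
  rewrite addrA subrK.
  have : enorm (ystar x - ystar x') ^+ 2 <= L_y c ^+ 2 * (alpha ^+ 2 * H).
    have q := ystar_lip C_gxy_gt0 mu_g_gt0 g_lower ystar_argmin x x'.
    rewrite (enormB x) in q.
    rewrite -xx -exprMn.
    have q0 := le_trans (enorm_ge0 _) q.
    by rewrite ler_pXn2r ?nnegrE ?enorm_ge0.
  have gg : 0 <= 1 + gam^-1 by rewrite addr_ge0// ltW.
  move/(ler_wpM2l gg); rewrite /k0; lra.
apply: le_trans (integral_le_affine mu1 mv1 mw _ _ _ _ _ k00 uA vB pw) _.
- by move=> z; exact: sqr_ge0.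
- by move=> z; exact: sqr_ge0.
- move=> z; rewrite /half_step -/b -/x' -/Ee.
  apply: addr_ge0 (sqr_ge0 _); apply: addr_ge0 => //; apply: addr_ge0; last first.
    by rewrite mulr_ge0 ?addr_ge0 ?sqr_ge0// mulr_ge0// ltW.
  by rewrite addr_ge0// mulr_ge0 ?sqr_ge0// mulr_ge0// sqr_ge0.
- by rewrite mulr_ge0 ?sqr_ge0// mulr_ge0// ltW.
- by rewrite addr_ge0// ltW.
rewrite lee_fin.
have desc := ell_descent L_fx_ge0 L_fy_ge0 L_gxy_ge0 L_gyy_ge0 C_gxy_gt0 mu_g_gt0
  f_upper g_lower ystar_argmin ell_def x (- (alpha *: h)).
rewrite -/x' dotNr dotZr enormN enormZ exprMn real_normK ?num_real// -/H in desc.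
have pl := ell_gradient_dominated L_fx_ge0 L_fy_ge0 L_gxy_ge0 L_gyy_ge0 C_gxy_gt0
  mu_g_gt0 f_upper g_lower ystar_argmin ell_def x mu_f_gt0 ell_convex ell_star_min.1.
have de := direction_error x y h.
rewrite enorm_sqB -/H -/D -/Ee in de.
have {}de := ler_wpM2l (ltW alpha_gt0) de.
have {}pl := ler_wpM2l (ltW alpha_gt0) pl.
have {}cD := ler_wpM2r D0 cD.
have {}cH := ler_wpM2r H0 cH; rewrite mul0r in cH.
have {}cE := ler_wpM2r Ee0 cE.
have bs0 : 0 <= b ^+ 2 * sigma_g ^+ 2 by rewrite mulr_ge0// sqr_ge0.
have gs := ler_wpM2r bs0 gam1.
have ks := mulr_ge0 (ltW LK0) bs0.
rewrite /k0 /lyapunov /step_const -/D -/Ee.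
rewrite /b in bs0 gs ks *.
lra.
Qed.

(** * The iterates and the recursion in expectation *)

(** Jensen's inequality applied to the mean-square Lipschitz bound. *)
Lemma emean_lipschitz x y x' y' :
  enorm (emean x y - emean x' y') <= Num.sqrt LK * enorm_pair (x - x') (y - y').
Proof.
have iD := integrable_mxB (E_integrable x y) (E_integrable x' y').
have eD := mean_mxB (E_integrable x y) (E_integrable x' y').
have sq := enorm_mean_sq_le iD (E_ms_lip x y x' y'); rewrite eD in sq.
exact: le_sqrt_mul (ltW LK0) (enorm_pair_ge0 _ _) (enorm_ge0 _) sq.
Qed.

Let emean_continuous i : econtinuous (fun x y => emean x y i 0).
Proof.
apply: (lipschitz_econtinuous (sqrtr_ge0 LK)) => x y x' y'.
apply: le_trans (emean_lipschitz x y x' y').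
by have := entry_le_enorm (emean x y - emean x' y') i; rewrite !mxE.
Qed.

Let ystar_continuous i : econtinuous (fun x (y : 'cV[R]_m) => ystar x i 0).
Proof.
apply: (lipschitz_econtinuous (L_y_ge0 C_gxy_gt0 mu_g_gt0)) => x y x' y'.
have h := entry_le_enorm (ystar x - ystar x') i; rewrite !mxE in h.
apply: le_trans h _; apply: le_trans (ystar_lip C_gxy_gt0 mu_g_gt0 g_lower ystar_argmin _ _) _.
rewrite ler_wpM2l ?(L_y_ge0 C_gxy_gt0 mu_g_gt0)//.
rewrite -(ler_pXn2r (n := 2)) ?nnegrE ?enorm_ge0 ?enorm_pair_ge0//.
by rewrite enorm_pair2 lerDl sqr_ge0.
Qed.

Let ell_continuous : econtinuous (fun x (y : 'cV[R]_m) => ell x).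
Proof.
move=> x y e e0; set G := hgrad f g ystar x.
have Lf0 : 0 <= L_f c.
  rewrite L_fE; apply: mulr_ge0; last by rewrite addr_ge0// (L_y_ge0 C_gxy_gt0 mu_g_gt0).
  exact: (L_bar_ge0 L_fx_ge0 L_fy_ge0 L_gxy_ge0 L_gyy_ge0 C_gxy_gt0 mu_g_gt0 f_upper).
pose k := enorm G + L_f c / 2 + 1.
have G0 := enorm_ge0 G.
have k0 : 0 < k by rewrite ltr_wpDl// addr_ge0// divr_ge0.
exists (Num.min 1 (e / k)) => [|x' _ hx _]; first by rewrite lt_min ltr01 divr_gt0.
have := ell_quadratic L_fx_ge0 L_fy_ge0 L_gxy_ge0 L_gyy_ge0 C_gxy_gt0 mu_g_gt0
  f_upper g_lower ystar_argmin ell_def x (x' - x).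
rewrite (addrC x) subrK -/G => q.
have dG := dot_abs_le G (x' - x).
move: hx; rewrite le_min => /andP[hx1 hxe]; rewrite ler_pdivlMr// in hxe.
set r := enorm (x' - x) in q dG hx1 hxe; have r0 : 0 <= r by exact: enorm_ge0.
have r2 : r ^+ 2 <= r by rewrite expr2 ler_piMl.
have tri := ler_normD (ell x' - ell x - dot G (x' - x)) (dot G (x' - x)).
rewrite subrK in tri; apply: (le_trans tri); apply: (le_trans (lerD q dG)).
have := ler_wpM2l (divr_ge0 Lf0 (ler0n R 2)) r2.
by move: hxe; rewrite /k; lra.
Qed.

Let measurable_const_case (dT : measure_display) (Om : measurableType dT) (p : nat)
    (phi : 'cV[R]_n -> 'cV[R]_m -> 'cV[R]_p) (x : Om -> 'cV[R]_n) (y : Om -> 'cV[R]_m) :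
  (forall i, econtinuous (fun u v => phi u v i 0)) ->
  measurable_mx x -> measurable_mx y -> measurable_mx (fun w => phi (x w) (y w)).
Proof.
move=> cphi mx my.
apply: (@caratheodory_mx _ _ _ Om Om _ _ _ (fun=> phi) x y id) => //.
by move=> u v; exact: measurable_mx_cst.
Qed.

Let measurable_ell (dT : measure_display) (Om : measurableType dT) (x : Om -> 'cV[R]_n) :
  measurable_mx x -> measurable_fun setT (fun w => ell (x w)).
Proof.
move=> mx.
have h : measurable_mx (fun w => (ell (x w))%:M : 'M[R]_1).
  apply: (@measurable_const_case _ Om 1 (fun u _ => (ell u)%:M) x (fun=> 0)) => //.
    move=> i; rewrite ord1.
    rewrite (_ : (fun u v => _) = (fun u (v : 'cV[R]_m) => ell u))//.
    by apply/funext => u; apply/funext => v; rewrite mxE eqxx mulr1n.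
have -> : (fun w => ell (x w)) = (fun w => ((ell (x w))%:M : 'M[R]_1) 0 0).
  by apply/funext => w; rewrite mxE eqxx mulr1n.
exact: h.
Qed.

Lemma measurable_lyapunov (dT : measure_display) (Om : measurableType dT)
    (x : Om -> 'cV[R]_n) (y : Om -> 'cV[R]_m) (h : Om -> 'cV[R]_n) :
  measurable_mx x -> measurable_mx y -> measurable_mx h ->
  measurable_fun setT (fun w => Phi (x w) (y w) (h w)).
Proof.
move=> mx my mh; rewrite /lyapunov.
apply: measurable_funD; last first.
  apply: measurable_mx_enorm2; apply: measurable_mxB => //.
  exact: (@measurable_const_case _ Om m (fun u _ => ystar u) x y).
apply: measurable_funD.
  by apply: measurable_funB => //; exact: measurable_ell.
apply: measurable_mx_enorm2; apply: measurable_mxB => //.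
exact: (@measurable_const_case _ Om n emean x y).
Qed.

Context {dO : measure_display} {Omega : measurableType dO}.
Variables (P : probability Omega R).
Variables (zeta : nat -> {RV P >-> Z}) (xibar : nat -> {RV P >-> S}).
Hypothesis zeta_law : forall t A, measurable A -> distribution P (zeta t) A = pi_g A.
Hypothesis xibar_law : forall t A, measurable A -> distribution P (xibar t) A = pibar A.

Definition sample_events (i : nat + nat) : set_system Omega :=
  match i with
  | inl t => preimage_set_system [set: Omega] (zeta t) measurable
  | inr t => preimage_set_system [set: Omega] (xibar t) measurable
  end.

Hypothesis indep : mutually_independent P sample_events.
Variables (x0 : 'cV[R]_n) (y0 : 'cV[R]_m).

Local Notation run w := (sustain Gam E (fun=> alpha) (fun=> ch * alpha)
  (fun t => if t == 0%N then 1 else eta) (fun=> 1)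
  x0 y0 (fun t => zeta t w) (fun t => xibar t w)).

Definition x_at t w := cur_x (run w t).
Definition y_at t w := cur_y (run w t).
(** The state before step [t] stores the direction of step [t - 1]. *)
Definition dir_at t w := prev_hf (run w t.+1).

Lemma x_atS t w : x_at t.+1 w = x_at t w - alpha *: dir_at t w.
Proof. by rewrite /x_at /dir_at /=; case: (run w t). Qed.

Lemma y_atS t w : y_at t.+1 w = y_at t w - (ch * alpha) *: Gam (zeta t w) (x_at t w) (y_at t w).
Proof.
rewrite /y_at /x_at /=; case: (run w t) => x y x' y' hf hg /=.
by rewrite subrr scale0r addr0 scale1r.
Qed.

Lemma dir_at0 w : dir_at 0 w = E (xibar 0 w) x0 y0.
Proof. by rewrite /dir_at /= subrr scale0r addr0 scale1r. Qed.

Lemma dir_atS t w : dir_at t.+1 w = E (xibar t.+1 w) (x_at t.+1 w) (y_at t.+1 w)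
  + (1 - eta) *: (dir_at t w - E (xibar t.+1 w) (x_at t w) (y_at t w)).
Proof.
rewrite /dir_at /x_at /y_at /=; case: (run w t) => x y x' y' hf hg /=.
set x1 := x - _; set y1 := y - _; set e1 := E _ x1 y1; set e0 := E _ x y.
set h := _ + _ *: (hf + _ - _).
by apply/matrixP => i j; rewrite !mxE; ring.
Qed.

Let sample_eventsI i : setI_closed (sample_events i).
Proof.
case: i => t _ _ [A mA <-] [B mB <-];
  by exists (A `&` B); [exact: measurableI|rewrite !setTI preimage_setI].
Qed.

Let sample_eventsT i : sample_events i setT.
Proof. by case: i => t; exists setT => //; rewrite setTI preimage_setT. Qed.

Let sample_eventsm i A : sample_events i A -> measurable A.
Proof. by case: i => t [B mB <-]; exact: measurable_funP. Qed.

(** Iteration [t] draws [zeta_t] for the lower level and [xibar_t] for the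
    upper one, but the direction [dir_at t] depends on [xibar_t] and not on
    [zeta_t].  The two kinds of samples are hence counted separately. *)
Definition before (a b : nat) : set (nat + nat) :=
  [set i | match i with inl k => (k < a)%N | inr k => (k < b)%N end].

Local Notation pst a b := (past sample_events (before a b)).
Local Notation Tm a b := (g_sigma_algebraType (pst a b)).

Lemma measurable_before_zeta a b t : (t < a)%N ->
  measurable_fun setT (zeta t : Tm a b -> Z).
Proof.
move=> ta _ B mB; apply: sub_sigma_algebra; apply: (@past_mem _ _ _ _ sample_eventsT _ (inl t)) => //.
by exists B.
Qed.

Lemma measurable_before_xibar a b t : (t < b)%N ->
  measurable_fun setT (xibar t : Tm a b -> S).
Proof.
move=> ta _ B mB; apply: sub_sigma_algebra; apply: (@past_mem _ _ _ _ sample_eventsT _ (inr t)) => //.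
by exists B.
Qed.

Lemma measurable_before_mono a b a' b' : (a <= a')%N -> (b <= b')%N ->
  measurable_fun setT (id : Tm a' b' -> Tm a b).
Proof.
move=> aa bb _ B mB; rewrite setTI preimage_id.
apply: (sub_sigma_algebra2 (M := pst a b)) mB.
by apply: past_subset => -[k|k] /= kk; exact: leq_trans kk _.
Qed.

Let measurable_mono p a b a' b' (A : Omega -> 'cV[R]_p) : (a <= a')%N -> (b <= b')%N ->
  measurable_mx (A : Tm a b -> _) -> measurable_mx (A : Tm a' b' -> _).
Proof.
by move=> aa bb mA; exact: (measurable_mx_comp mA (measurable_before_mono aa bb)).
Qed.

Lemma iterates_measurable t :
  [/\ measurable_mx (x_at t : Tm t t -> _), measurable_mx (y_at t : Tm t t -> _)
    & measurable_mx (dir_at t : Tm t t.+1 -> _)].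
Proof.
elim: t => [|t [mx my mh]].
  split; [exact: measurable_mx_cst|exact: measurable_mx_cst|].
  rewrite (_ : dir_at 0 = fun w => E (xibar 0 w) x0 y0); last first.
    by apply/funext => w; exact: dir_at0.
  exact: (measurable_mx_comp (E_measurable x0 y0) (@measurable_before_xibar 0 1 0 isT)).
have mx' : measurable_mx (x_at t.+1 : Tm t.+1 t.+1 -> _).
  rewrite (_ : x_at t.+1 = fun w => x_at t w - alpha *: dir_at t w); last first.
    by apply/funext => w; exact: x_atS.
  apply: measurable_mxB; first exact: (measurable_mono _ _ mx).
  by apply: measurable_mxZ => //; exact: (measurable_mono _ _ mh).
have my' : measurable_mx (y_at t.+1 : Tm t.+1 t.+1 -> _).
  rewrite (_ : y_at t.+1 = fun w => y_at t w
      - (ch * alpha) *: Gam (zeta t w) (x_at t w) (y_at t w)); last first.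
    by apply/funext => w; exact: y_atS.
  apply: measurable_mxB; first exact: (measurable_mono _ _ my).
  apply: measurable_mxZ => //.
  apply: (@caratheodory_mx _ _ _ (Tm t.+1 t.+1) Z _ _ _ Gam) => //.
  - exact: (measurable_mono _ _ mx).
  - exact: (measurable_mono _ _ my).
  - exact: measurable_before_zeta.
split => //.
rewrite (_ : dir_at t.+1 = fun w => E (xibar t.+1 w) (x_at t.+1 w) (y_at t.+1 w)
  + (1 - eta) *: (dir_at t w - E (xibar t.+1 w) (x_at t w) (y_at t w))); last first.
  by apply/funext => w; exact: dir_atS.
have mxi : measurable_fun setT (xibar t.+1 : Tm t.+1 t.+2 -> S).
  exact: measurable_before_xibar.
apply: measurable_mxD.
  apply: (@caratheodory_mx _ _ _ (Tm t.+1 t.+2) S _ _ _ E) => //.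
  - exact: (measurable_mono _ _ mx').
  - exact: (measurable_mono _ _ my').
apply: measurable_mxZ => //; apply: measurable_mxB; first exact: (measurable_mono _ _ mh).
apply: (@caratheodory_mx _ _ _ (Tm t.+1 t.+2) S _ _ _ E) => //.
- exact: (measurable_mono (leqnSn t) (leqW (leqnSn t)) mx).
- exact: (measurable_mono (leqnSn t) (leqW (leqnSn t)) my).
Qed.

(** The sample [xibar_b] is independent of the samples before it. *)
Let freeze_xibar a b (F : Tm a b * S -> \bar R) :
  measurable_fun setT F -> (forall z, (0 <= F z)%E) ->
  (\int[P]_w F (w, xibar b w) = \int[P]_w \int[pibar]_s F (w, s))%E.
Proof.
move=> mF F0; apply: (freezing_pi_system (mu := P)) => //.
- exact: (past_measurable sample_eventsm).
- exact: (past_setI sample_eventsI).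
- exact: (past_setT sample_eventsT).
move=> A B pA mB; rewrite -(xibar_law b mB).
apply: (past_indep indep (A := before a b) (i := inr b)) => //=.
  by rewrite ltnn.
by exists B => //; rewrite setTI.
Qed.

Let freeze_zeta a b (F : Tm a b * Z -> \bar R) :
  measurable_fun setT F -> (forall z, (0 <= F z)%E) ->
  (\int[P]_w F (w, zeta a w) = \int[P]_w \int[pi_g]_z F (w, z))%E.
Proof.
move=> mF F0; apply: (freezing_pi_system (mu := P)) => //.
- exact: (past_measurable sample_eventsm).
- exact: (past_setI sample_eventsI).
- exact: (past_setT sample_eventsT).
move=> A B pA mB; rewrite -(zeta_law a mB).
apply: (past_indep indep (A := before a b) (i := inl a)) => //=.
  by rewrite ltnn.
by exists B => //; rewrite setTI.
Qed.

Let lyapunov_integral x y (h : S -> 'cV[R]_n) (B : R) : measurable_mx h ->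
  (\int[pibar]_s (enorm (h s - emean x y) ^+ 2)%:E <= B%:E)%E ->
  (\int[pibar]_s (Phi x y (h s))%:E
   <= ((ell x - ell_star) + B + enorm (y - ystar x) ^+ 2)%:E)%E.
Proof.
move=> mh hB.
have mu1 : measurable_fun setT (fun s => enorm (h s - emean x y) ^+ 2).
  by apply: measurable_enorm2 => i; apply: (measurable_mxB mh (measurable_mx_cst _)).
have mw1 : measurable_fun setT (fun s => Phi x y (h s)).
  by apply: measurable_lyapunov => //; exact: measurable_mx_cst.
have k0 : 0 <= ell x - ell_star + enorm (y - ystar x) ^+ 2.
  by apply: addr_ge0 (sqr_ge0 _); rewrite subr_ge0; case: ell_star_min.
have := integral_le_affine (a := 1) (b := 0) (B := 0) mu1 (measurable_cst (0 : R)) mw1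
  (fun s => sqr_ge0 _) (fun=> lexx 0) (fun s => lyapunov_ge0 x y _) ler01 (lexx 0) k0 hB.
rewrite integral0 lexx => /(_ isT) int.
apply: le_trans (int _) _ => [s|]; first by rewrite /lyapunov; lra.
by rewrite lee_fin; lra.
Qed.

(** The first direction is the estimator itself, so that its error is a
    variance. *)
Lemma lyapunov_start :
  (\int[P]_w (Phi (x_at 0 w) (y_at 0 w) (dir_at 0 w))%:E
   <= (ell x0 - ell_star + sigma_f ^+ 2 + enorm (y0 - ystar x0) ^+ 2)%:E)%E.
Proof.
pose F (z : Tm 0 0 * S) := (Phi x0 y0 (E z.2 x0 y0))%:E.
have mE2 : measurable_mx (fun z : Tm 0 0 * S => E z.2 x0 y0).
  exact: (measurable_mx_comp (E_measurable x0 y0) measurable_snd).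
have mF : measurable_fun setT F.
  apply/measurable_EFinP; apply: measurable_lyapunov => //; exact: measurable_mx_cst.
have F0 z : (0 <= F z)%E by rewrite lee_fin lyapunov_ge0.
rewrite (_ : (\int[P]_w _ = \int[P]_w F (w, xibar 0 w))%E); last first.
  by apply: eq_integral => w _; rewrite dir_at0.
rewrite (freeze_xibar mF F0) -[leLHS]/(\int[P]_w cst
  (\int[pibar]_s (Phi x0 y0 (E s x0 y0))%:E) w)%E integral_cst//= probability_setT mule1.
exact: lyapunov_integral.
Qed.

Local Notation hstep := half_step.
Local Notation M := step_const.

Let eta_ge0 : 0 <= eta.
Proof. by rewrite mulr_ge0 ?(ltW alpha_gt0)// addr_ge0// ltW. Qed.

Let eta_le1 : eta <= 1. Proof. by have := h1; rewrite mulrC. Qed.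

Let hstep_ge0 x y h z : 0 <= hstep x y h z.
Proof.
have p0 := mulr_ge0 (ler0n R 2) (ltW LK0).
rewrite /half_step; apply: addr_ge0 (sqr_ge0 _); apply: addr_ge0.
  by rewrite subr_ge0; case: ell_star_min.
apply: addr_ge0; last by apply: (mulr_ge0 p0); apply: addr_ge0; exact: sqr_ge0.
apply: addr_ge0; apply: mulr_ge0; try exact: sqr_ge0.
by apply: mulr_ge0 => //; exact: sqr_ge0.
Qed.

Let measurable_hstep (dT : measure_display) (Om : measurableType dT)
    (x : Om -> 'cV[R]_n) (y : Om -> 'cV[R]_m) (h : Om -> 'cV[R]_n) (z : Om -> Z) :
  measurable_mx x -> measurable_mx y -> measurable_mx h -> measurable_fun setT z ->
  measurable_fun setT (fun w => hstep (x w) (y w) (h w) (z w)).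
Proof.
move=> mx my mh mz; rewrite /half_step.
have mx' : measurable_mx (fun w => x w - alpha *: h w).
  by apply: measurable_mxB => //; exact: measurable_mxZ.
have my' : measurable_mx (fun w => y w - (ch * alpha) *: Gam (z w) (x w) (y w)).
  apply: measurable_mxB => //; apply: measurable_mxZ => //.
  exact: (@caratheodory_mx _ _ _ Om Z _ _ _ Gam).
apply: measurable_funD; last first.
  apply: measurable_mx_enorm2; apply: measurable_mxB => //.
  exact: (@measurable_const_case _ Om m (fun u _ => ystar u) _ y).
apply: measurable_funD.
  by apply: measurable_funB => //; exact: measurable_ell.
apply: measurable_funD; last first.
  apply: measurable_funM => //.
  by apply: measurable_funD; apply: measurable_mx_enorm2; exact: measurable_mxB.
apply: measurable_funD => //; apply: measurable_funM => //.
apply: measurable_mx_enorm2; apply: measurable_mxB => //.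
exact: (@measurable_const_case _ Om n emean x y).
Qed.

(** [xibar_(t+1)] is integrated out with the iterates of time [t + 1] and the
    direction of time [t] frozen. *)
Let momentum_step t :
  (\int[P]_w (Phi (x_at t.+1 w) (y_at t.+1 w) (dir_at t.+1 w))%:E
   <= \int[P]_w (hstep (x_at t w) (y_at t w) (dir_at t w) (zeta t w))%:E)%E.
Proof.
have [mx' my' _] := iterates_measurable t.+1; have [mx my mh] := iterates_measurable t.
pose h' s w := E s (x_at t.+1 w) (y_at t.+1 w) + (1 - eta) *: (dir_at t w - E s (x_at t w) (y_at t w)).
pose F (z : Tm t.+1 t.+1 * S) := (Phi (x_at t.+1 z.1) (y_at t.+1 z.1) (h' z.2 z.1))%:E.
have fst_mx p (A : Omega -> 'cV[R]_p) : measurable_mx (A : Tm t.+1 t.+1 -> _) ->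
    measurable_mx (fun z : Tm t.+1 t.+1 * S => A z.1).
  by move=> mA; exact: (measurable_mx_comp mA measurable_fst).
have mF : measurable_fun setT F.
  have m1 := fst_mx _ _ mx'; have m2 := fst_mx _ _ my'.
  apply/measurable_EFinP; apply: measurable_lyapunov => //.
  apply: measurable_mxD.
    exact: (@caratheodory_mx _ _ _ (Tm t.+1 t.+1 * S)%type S _ _ _ E).
  apply: measurable_mxZ => //; apply: measurable_mxB.
    exact: (fst_mx _ _ (measurable_mono _ _ mh)).
  apply: (@caratheodory_mx _ _ _ (Tm t.+1 t.+1 * S)%type S _ _ _ E) => //.
  - exact: (fst_mx _ _ (measurable_mono _ _ mx)).
  - exact: (fst_mx _ _ (measurable_mono _ _ my)).
have F0 z : (0 <= F z)%E by rewrite lee_fin lyapunov_ge0.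
rewrite (_ : (\int[P]_w _ = \int[P]_w F (w, xibar t.+1 w))%E); last first.
  by apply: eq_integral => w _; rewrite dir_atS.
rewrite (freeze_xibar mF F0).
apply: (ge0_le_integral_off_null measurable0 (measure0 P)) => [w|w|w _].
- by apply: integral_ge0 => s _; exact: F0.
- by rewrite lee_fin.
rewrite /F /=; set x1 := x_at t.+1 w; set y1 := y_at t.+1 w.
have mh1 : measurable_mx (fun s => h' s w).
  apply: measurable_mxD; first exact: E_measurable.
  by apply: measurable_mxZ => //; apply: measurable_mxB => //; exact: measurable_mx_cst.
apply: le_trans (lyapunov_integral mh1
  (frozen_momentum (x_at t w) (y_at t w) x1 y1 (dir_at t w) eta_ge0 eta_le1)) _.
by rewrite lee_fin /half_step -x_atS -y_atS -/x1 -/y1; lra.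
Qed.

Let M0 : 0 <= M.
Proof.
have L0 := ltW LK0.
rewrite /step_const; apply: addr_ge0; first by rewrite divr_ge0.
apply: mulr_ge0 (ltW alpha_gt0); apply: addr_ge0.
  apply: mulr_ge0 (sqr_ge0 _); apply: addr_ge0; last apply: mulr_ge0 => //.
    by apply: mulr_ge0 => //; exact: sqr_ge0.
  by apply: mulr_ge0 => //; exact: sqr_ge0.
by apply: mulr_ge0 (sqr_ge0 _); apply: mulr_ge0 => //; exact: sqr_ge0.
Qed.

Let mua : 0 <= 1 - mu_f * alpha.
Proof. by have := h1; have := alpha_gt0; lra. Qed.

(** [zeta_t] is integrated out with the iterates and the direction of time [t]
    frozen. *)
Let lyapunov_step t (A : R) :
  (\int[P]_w (Phi (x_at t w) (y_at t w) (dir_at t w))%:E <= A%:E)%E ->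
  (\int[P]_w (Phi (x_at t.+1 w) (y_at t.+1 w) (dir_at t.+1 w))%:E
   <= ((1 - mu_f * alpha) * A + alpha * M)%:E)%E.
Proof.
move=> EA; apply: (le_trans (momentum_step t)).
have [mx my mh] := iterates_measurable t.
pose F (z : Tm t t.+1 * Z) := (hstep (x_at t z.1) (y_at t z.1) (dir_at t z.1) z.2)%:E.
have fst_mx p (A' : Omega -> 'cV[R]_p) : measurable_mx (A' : Tm t t.+1 -> _) ->
    measurable_mx (fun z : Tm t t.+1 * Z => A' z.1).
  by move=> mA; exact: (measurable_mx_comp mA measurable_fst).
have mx1 : measurable_mx (x_at t : Tm t t.+1 -> _) by exact: (measurable_mono _ _ mx).
have my1 : measurable_mx (y_at t : Tm t t.+1 -> _) by exact: (measurable_mono _ _ my).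
have mF : measurable_fun setT F.
  apply/measurable_EFinP; apply: measurable_hstep => //; exact: fst_mx.
have F0 z : (0 <= F z)%E by rewrite lee_fin.
rewrite -[leLHS]/(\int[P]_w F (w, zeta t w))%E (freeze_zeta mF F0).
have mforget p (A' : Omega -> 'cV[R]_p) : measurable_mx (A' : Tm t t.+1 -> _) ->
    measurable_mx A'.
  move=> mA; apply: (@measurable_mx_comp _ _ _ Omega (Tm t t.+1) _ _ A' id mA).
  have mf := measurable_forget (past_measurable sample_eventsm (A := before t t.+1)).
  exact: mf.
have mPhi : measurable_fun setT (fun w => Phi (x_at t w) (y_at t w) (dir_at t w)).
  by apply: measurable_lyapunov; exact: mforget.
have aM : 0 <= alpha * M by rewrite mulr_ge0// ltW.
have mW : measurable_fun setT (fun w => (1 - mu_f * alpha) * Phi (x_at t w) (y_at t w) (dir_at t w)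
    + alpha * M).
  by apply: measurable_funD => //; exact: measurable_funM.
have P0 w : 0 <= Phi (x_at t w) (y_at t w) (dir_at t w) by exact: lyapunov_ge0.
have := integral_le_affine (b := 0) (B := 0) mPhi (measurable_cst (0 : R)) mW
  P0 (fun=> lexx 0) (fun s => addr_ge0 (mulr_ge0 mua (P0 s)) aM) mua (lexx 0) aM EA.
rewrite integral0 lexx => /(_ isT) h.
apply: le_trans (le_trans (h _) _) => [|s|].
- apply: (ge0_le_integral_off_null measurable0 (measure0 P)) => [w|w|w _].
  + by apply: integral_ge0 => s _; exact: F0.
  + by rewrite lee_fin addr_ge0// mulr_ge0.
  rewrite /F; move: (x_at t w) (y_at t w) (dir_at t w) => x y h'.
  exact: frozen_step.
- by move: (Phi _ _ _) (M) => p q; lra.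
by rewrite lee_fin; move: (M) => q; lra.
Qed.

Lemma lyapunov_bound t :
  (\int[P]_w (Phi (x_at t w) (y_at t w) (dir_at t w))%:E
   <= ((1 - mu_f * alpha) ^+ t
        * (ell x0 - ell_star + sigma_f ^+ 2 + enorm (y0 - ystar x0) ^+ 2)
       + (1 - (1 - mu_f * alpha) ^+ t) * (M / mu_f))%:E)%E.
Proof.
elim: t => [|t IH].
  by rewrite expr0 mul1r subrr mul0r addr0; exact: lyapunov_start.
apply: le_trans (lyapunov_step IH) _; rewrite lee_fin (exprS _ t) le_eqVlt; apply/orP; left.
apply/eqP; move: (_ ^+ t) (M) (_ + enorm _ ^+ 2) => r M' D.
by field; rewrite gt_eqF.
Qed.

Lemma expected_gap_bound t :
  (\int[P]_w (ell (x_at t w) - ell_star)%:E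
   <= ((1 - mu_f * alpha) ^+ t
        * (ell x0 - ell_star + sigma_f ^+ 2 + enorm (y0 - ystar x0) ^+ 2)
       + 1 / mu_f * M)%:E)%E.
Proof.
apply: (le_trans (le_trans _ (lyapunov_bound t))).
  apply: (ge0_le_integral_off_null measurable0 (measure0 P)) => [w|w|w _].
  - by rewrite lee_fin subr_ge0; case: ell_star_min.
  - by rewrite lee_fin lyapunov_ge0.
  rewrite lee_fin /lyapunov -addrA lerDl.
  by apply: addr_ge0; exact: sqr_ge0.
rewrite lee_fin lerD2l [1 / _ * _]mulrC mul1r ler_piMl ?divr_ge0 ?(ltW mu_f_gt0)//.
by rewrite gerBl exprn_ge0.
Qed.

End Sustain.

(** * Passing to samples that are regular everywhere *)

Section Patch.
Context {R : realType} {d : measure_display} {S : measurableType d}.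
Variables (pi : probability S R) (N : set S).
Hypotheses (mN : measurable N) (N0 : pi N = 0%E).

(** Samples without the required regularity are replaced by the expected
    function, which has it; being negligible, they do not affect the means. *)
Lemma unbiased_patch n m p q
    (D : ('cV[R]_n -> 'cV[R]_m -> R) -> 'cV[R]_n -> 'cV[R]_m -> 'M[R]_(p, q))
    (H : S -> 'cV[R]_n -> 'cV[R]_m -> R) (h : 'cV[R]_n -> 'cV[R]_m -> R) :
  unbiased pi (fun s => D (H s)) (D h) ->
  unbiased pi (fun s => D (if s \in N then h else H s)) (D h).
Proof.
move=> uH x y; have [iH mH] := uH x y; rewrite -[in X in _ /\ _ = X]mH.
have off s : ~ N s -> D (if s \in N then h else H s) x y = D (H s) x y.
  by move=> Ns; rewrite memNset.
split; last exact: (mean_mx_off_null mN N0).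
apply: (integrable_mx_off_null mN N0 off) => // i j.
have -> : (fun s => D (if s \in N then h else H s) x y i j)
    = (fun s => \1_N s * D h x y i j + \1_(~` N) s * D (H s) x y i j).
  apply/funext => s; rewrite !indicE in_setC; case: ifP => _ /=; ring.
have mi : measurable_fun setT (fun s => D (H s) x y i j) by exact: measurable_integrable_mx.
by apply: measurable_funD; apply: measurable_funM => //; apply: measurable_indic => //;
  exact: measurableC.
Qed.

End Patch.

Lemma ae_null_set {R : realType} {d : measure_display} {S : measurableType d}
    (pi : probability S R) (Q : S -> Prop) : {ae pi, forall s, Q s} ->
  exists N, [/\ measurable N, pi N = 0%E & forall s, ~ N s -> Q s].
Proof.
by move=> [N [mN N0 QN]]; exists N; split=> // s Ns; apply: contrapT => /QN.
Qed.

Lemma sustain_ext {R : realType} {n m : nat} {Z S : Type}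
    (D D' : Z -> 'cV[R]_n -> 'cV[R]_m -> 'cV[R]_m)
    (E E' : S -> 'cV[R]_n -> 'cV[R]_m -> 'cV[R]_n) (a b ef eg : nat -> R) x0 y0 zs ss t :
  (forall t, D (zs t) = D' (zs t)) -> (forall t, E (ss t) = E' (ss t)) ->
  sustain D E a b ef eg x0 y0 zs ss t = sustain D' E' a b ef eg x0 y0 zs ss t.
Proof. by move=> DD EE; elim: t => //= t ->; rewrite /sustain_step DD EE. Qed.

Lemma estimator_ext {R : realType} {n m : nat} {Xi Z : Type}
    (F F' : Xi -> 'cV[R]_n -> 'cV[R]_m -> R) (G G' : Z -> 'cV[R]_n -> 'cV[R]_m -> R)
    (Lg : R) (K : nat) (s : (Xi * K.+1.-tuple Z * nat)%type) :
  F s.1.1 = F' s.1.1 -> (forall i, G (tnth s.1.2 i) = G' (tnth s.1.2 i)) ->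
  estimator F G Lg s = estimator F' G' Lg s.
Proof.
move=> FF GG; apply/funext => x; apply/funext => y; rewrite /estimator FF.
pose Phi (u : 'I_K.+1 -> 'cV[R]_n -> 'cV[R]_m -> R) := grad_x (F' s.1.1) x y - (K%:R / Lg) *:
  (hess_xy (u (inord 0)) x y *m
   (\big[mulmx/1%:M]_(1 <= i < s.2.+1) (1%:M - Lg^-1 *: hess_yy (u (inord i)) x y))
   *m grad_y (F' s.1.1) x y).
have GG' : (fun i => G (tnth s.1.2 i)) = (fun i => G' (tnth s.1.2 i)) by exact/funext.
exact: (congr1 Phi GG').
Qed.

Theorem theorem3p3 (R : realType) (d_up d_lo : nat)
  (* constants *)
  (c : constants R) (mu_f sigma_f sigma_g : R)
  (L_fx_ge0 : 0 <= L_fx c) (L_fy_ge0 : 0 <= L_fy c)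
  (L_gxy_ge0 : 0 <= L_gxy c) (L_gyy_ge0 : 0 <= L_gyy c)
  (C_gxy_gt0 : 0 < C_gxy c) (mu_g_gt0 : 0 < mu_g c)
  (L_g_mu_g : 0 < L_g c - mu_g c) (mu_f_gt0 : 0 < mu_f)
  (sigma_f_ge0 : 0 <= sigma_f) (sigma_g_ge0 : 0 <= sigma_g)
  (* sampled and expected functions *)
  (d1 d2 : measure_display) (Xi : measurableType d1) (Z : measurableType d2)
  (pi_f : probability Xi R) (pi_g : probability Z R)
  (F : Xi -> 'cV[R]_d_up -> 'cV[R]_d_lo -> R)
  (G : Z -> 'cV[R]_d_up -> 'cV[R]_d_lo -> R)
  (f g : 'cV[R]_d_up -> 'cV[R]_d_lo -> R)
  (F_int : forall x y, pi_f.-integrable [set: Xi] (fun xi => (F xi x y)%:E))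
  (G_int : forall x y, pi_g.-integrable [set: Z] (fun z => (G z x y)%:E))
  (f_def : f = mean_fun pi_f F) (g_def : g = mean_fun pi_g G)
  (F_unbiased_x : unbiased pi_f (fun xi => grad_x (F xi)) (grad_x f))
  (F_unbiased_y : unbiased pi_f (fun xi => grad_y (F xi)) (grad_y f))
  (G_unbiased_y : unbiased pi_g (fun z => grad_y (G z)) (grad_y g))
  (G_unbiased_xy : unbiased pi_g (fun z => hess_xy (G z)) (hess_xy g))
  (G_unbiased_yy : unbiased pi_g (fun z => hess_yy (G z)) (hess_yy g))
  (* Assumptions 1, 2 and 3 *)
  (f_upper : upper_level c f) (g_lower : lower_level c g)
  (F_upper : {ae pi_f, forall xi, upper_level c (F xi)})
  (G_lower : {ae pi_g, forall z, lower_level c (G z)})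
  (* the bilevel problem *)
  (ystar : 'cV[R]_d_up -> 'cV[R]_d_lo)
  (ystar_argmin : forall x y, g x (ystar x) <= g x y)
  (ell : 'cV[R]_d_up -> R) (ell_def : forall x, ell x = f x (ystar x))
  (ell_star : R)
  (ell_star_min : (exists x, ell x = ell_star) /\ forall x, ell_star <= ell x)
  (ell_convex : strongly_convex mu_f ell)
  (* the stochastic estimator, its law, and Assumption 4 *)
  (T : nat) (T_ge1 : (1 <= T)%N)
  (K : nat) (K_def : K = sample_number c T) (L_K_gt0 : 0 < L_K_sq c K)
  (pibar : probability (Xi * K.+1.-tuple Z * nat)%type R)
  (pibar_law : draw_law pi_f pi_g pibar)
  (variance_f : forall x y,
    ('E_pibar[fun s => (enorm (estimator F G (L_g c) s x y - surrogate f g x y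
        - bias pibar (estimator F G (L_g c) (K := K)) (surrogate f g) x y)
        ^+ 2)%R] <= (sigma_f ^+ 2)%:E)%E)
  (variance_g : forall x y,
    ('E_pi_g[fun z => (enorm (grad_y (G z) x y - grad_y g x y) ^+ 2)%R]
      <= (sigma_g ^+ 2)%:E)%E)
  (* the samples used by the algorithm *)
  (d : measure_display) (Omega : measurableType d) (P : probability Omega R)
  (zeta : nat -> {RV P >-> Z})
  (xibar : nat -> {RV P >-> (Xi * K.+1.-tuple Z * nat)%type})
  (zeta_law : forall t A, measurable A -> distribution P (zeta t) A = pi_g A)
  (xibar_law : forall t A,
    measurable A -> distribution P (xibar t) A = pibar A)
  (indep : mutually_independent P (fun i : nat + nat =>
    match i with
    | inl t => preimage_set_system [set: Omega] (zeta t) measurable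
    | inr t => preimage_set_system [set: Omega] (xibar t) measurable
    end))
  (* parameters of the algorithm *)
  (alpha : R) (alpha_gt0 : 0 < alpha)
  (alpha_le : [/\ alpha <= 1 / (mu_f + 1),
    alpha <= 1 / (2 * mu_g c * chat_beta c mu_f),
    alpha <= mu_g c / (chat_beta c mu_f * L_g c ^+ 2),
    alpha <= 1 / (8 * L_K_sq c K + L_f c) &
    alpha <= (L_bar c ^+ 2 + 2 * L_y c ^+ 2)
             / (4 * L_K_sq c K * L_g c ^+ 2 * chat_beta c mu_f ^+ 2)])
  (x0 : 'cV[R]_d_up) (y0 : 'cV[R]_d_lo) :
  let iterates (w : Omega) : nat -> sustain_state R d_up d_lo :=
    sustain (fun z => grad_y (G z)) (estimator F G (L_g c) (K := K))
      (fun=> alpha) (fun=> chat_beta c mu_f * alpha)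
      (fun t => if t == 0%N then 1 else (mu_f + 1) * alpha) (fun=> 1)
      x0 y0 (fun t => zeta t w) (fun t => xibar t w) in
  let Delta0 := ell x0 - ell_star + sigma_f ^+ 2
                + enorm (y0 - ystar x0) ^+ 2 in
  forall t : nat, (1 <= t)%N ->
    ('E_P[fun w => (ell (cur_x (iterates w t)) - ell_star)%R]
     <= ((1 - mu_f * alpha) ^+ t * Delta0
         + 1 / mu_f * (2 / T%:R
           + ((2 * chat_beta c mu_f ^+ 2
               + 8 * chat_beta c mu_f ^+ 2 * L_K_sq c K) * sigma_g ^+ 2
              + 2 * (mu_f + 1) ^+ 2 * sigma_f ^+ 2) * alpha))%:E)%E.
Proof.
set ch := chat_beta c mu_f.
have K_gt0 : (0 < K)%N.
  by rewrite K_def /sample_number absz_gt0 gt_eqF// lt_max.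
have [Nf [mNf Nf0 Ff]] := ae_null_set F_upper.
have [Ng [mNg Ng0 Gg]] := ae_null_set G_lower.
(* regular everywhere, and equal to [F] and [G] almost surely *)
pose F' xi := if xi \in Nf then f else F xi.
pose G' z := if z \in Ng then g else G z.
have F'_upper xi : upper_level c (F' xi).
  by rewrite /F'; case: ifPn => // /negP h; apply: Ff => ?; apply: h; rewrite inE.
have G'_lower z : lower_level c (G' z).
  by rewrite /G'; case: ifPn => // /negP h; apply: Gg => ?; apply: h; rewrite inE.
have F'_x := unbiased_patch mNf Nf0 F_unbiased_x.
have F'_y := unbiased_patch mNf Nf0 F_unbiased_y.
have G'_y := unbiased_patch mNg Ng0 G_unbiased_y.
have G'_xy := unbiased_patch mNg Ng0 G_unbiased_xy.
have G'_yy := unbiased_patch mNg Ng0 G_unbiased_yy.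
pose est := estimator F G (L_g c) (K := K).
pose est' := estimator F' G' (L_g c) (K := K).
have FF' xi : ~ Nf xi -> F xi = F' xi by move=> h; rewrite /F' memNset.
have GG' z : ~ Ng z -> G z = G' z by move=> h; rewrite /G' memNset.
have [B [mB B0 estB]] : exists B, [/\ measurable B, pibar B = 0%E &
    forall s, ~ B s -> est s = est' s].
  have : pibar.-negligible ([set s | Nf s.1.1] `|`
      \bigcup_i [set s | Ng (tnth s.1.2 (inord i))]).
    apply: negligibleU.
      apply/negligibleP; last exact: etrans (pibar_xi K_gt0 pibar_law mNf) Nf0.
      by rewrite -[X in measurable X]setTI; exact: measurable_xi.
    apply: negligible_bigcup => i; apply/negligibleP.
      by rewrite -[X in measurable X]setTI; exact: measurable_zeta.
    exact: etrans (pibar_zeta K_gt0 pibar_law _ mNg) Ng0.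
  move=> [B [mB B0 sB]]; exists B; split; [exact: mB|exact: B0|move=> s Bs].
  apply: estimator_ext.
    by apply: FF' => h; apply: Bs; apply: sB; left.
  move=> i; apply: GG' => h; apply: Bs; apply: sB; right.
  by exists (val i) => //=; rewrite inord_val.
pose E := emean pibar est'.
have EE x y : mean_mx pibar (fun s => est s x y) = E x y.
  by apply: (mean_mx_off_null mB B0) => s /estB ->.
have chE : ch * mu_g c = 8 * L_y c ^+ 2 + 8 * L_bar c ^+ 2 + 2 * mu_f.
  by rewrite /ch /chat_beta divfK// gt_eqF.
have ch0 : 0 < ch.
  by rewrite -(pmulr_lgt0 _ mu_g_gt0) chE; have := sqr_ge0 (L_y c);
    have := sqr_ge0 (L_bar c); have := mu_f_gt0; lra.
have Lg0 := L_g_gt0 mu_g_gt0 L_g_mu_g.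
have Lf0 : 0 <= L_f c.
  rewrite L_fE; apply: mulr_ge0; last by rewrite addr_ge0// (L_y_ge0 C_gxy_gt0 mu_g_gt0).
  exact: (L_bar_ge0 L_fx_ge0 L_fy_ge0 L_gxy_ge0 L_gyy_ge0 C_gxy_gt0 mu_g_gt0 f_upper).
have Lg2 : 0 < L_g c ^+ 2 by rewrite exprn_gt0.
have ch2 : 0 < ch ^+ 2 by rewrite exprn_gt0.
case: alpha_le => a1 a2 a3 a4 a5.
have h1 : alpha * (mu_f + 1) <= 1 by rewrite -ler_pdivlMr// addr_gt0.
have h2 : alpha * (2 * mu_g c * ch) <= 1.
  rewrite -ler_pdivlMr; first exact: a2.
  by apply: mulr_gt0 ch0; exact: mulr_gt0.
have h3 : ch * alpha <= mu_g c / L_g c ^+ 2.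
  rewrite mulrC -ler_pdivlMr// (le_trans a3)// -/ch; move: (L_g c ^+ 2) (ch) Lg2 ch0 => p q p0 q0.
  by rewrite le_eqVlt; apply/predU1P; left; field; rewrite !gt_eqF.
have h4 : alpha * (8 * L_K_sq c K + L_f c) <= 1.
  rewrite -ler_pdivlMr; first exact: a4.
  by apply: ltr_pwDl => //; exact: mulr_gt0.
have h5 : alpha * (4 * L_K_sq c K * L_g c ^+ 2 * ch ^+ 2) <= L_bar c ^+ 2 + 2 * L_y c ^+ 2.
  rewrite -ler_pdivlMr//; apply: mulr_gt0 ch2; apply: mulr_gt0 Lg2.
  exact: mulr_gt0.
have E_continuous s i : econtinuous (fun x y => est' s x y i 0).
  apply: (lipschitz_econtinuous (sqrtr_ge0 (est_lip c K s.2))) => x y x' y'.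
  have h := entry_le_enorm (est' s x y - est' s x' y') i.
  have q := est_sub_sq L_gxy_ge0 L_gyy_ge0 C_gxy_gt0 mu_g_gt0 L_g_mu_g F'_upper G'_lower s x y x' y'.
  rewrite -/(est' s) in q; move: h q; move: (est' s x y) (est' s x' y') => u v.
  rewrite !mxE => h q; apply: (le_trans h).
  exact: le_sqrt_mul (est_lip_ge0 c K s.2) (enorm_pair_ge0 _ _) (enorm_ge0 _) q.
have Gam_continuous z j : econtinuous (fun x y => grad_y (G' z) x y j 0).
  apply: (lipschitz_econtinuous (ltW Lg0)) => x y x' y'.
  apply: le_trans (lower_lip (G'_lower z) x y x' y').
  have := entry_le_enorm (grad_y (G' z) x y - grad_y (G' z) x' y') j.
  by move: (grad_y _ x y) (grad_y _ x' y') => p q; rewrite !mxE.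
have E_mean x y := estimator_mean mu_g_gt0 L_g_mu_g F'_x F'_y G'_xy G'_yy F'_upper G'_lower K_gt0 pibar_law x y.
have E_bias x y : enorm (E x y - surrogate f g x y) ^+ 2 <= (T%:R)^-1.
  exact: (bias_sq_le C_gxy_gt0 mu_g_gt0 L_g_mu_g F'_x F'_y G'_xy G'_yy f_upper g_lower
    F'_upper G'_lower K_gt0 pibar_law x y T_ge1 K_def).
have E_variance x y :
    (\int[pibar]_s (enorm (est' s x y - E x y) ^+ 2)%:E <= (sigma_f ^+ 2)%:E)%E.
  have := variance_f x y; rewrite unlock; apply: le_trans.
  apply: (ge0_le_integral_off_null mB B0) => s; rewrite ?lee_fin ?sqr_ge0// => Bs.
  rewrite -(estB s Bs) /bias -/est EE.
  by move: (est s x y) (surrogate _ _ _ _) (E x y) => p q r; rewrite opprB addrA subrK.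
have Gam_variance x y :
    (\int[pi_g]_z (enorm (grad_y (G' z) x y - grad_y g x y) ^+ 2)%:E <= (sigma_g ^+ 2)%:E)%E.
  have := variance_g x y; rewrite unlock; apply: le_trans.
  apply: (ge0_le_integral_off_null mNg Ng0) => [z|z|z zN].
  - by rewrite lee_fin; exact: sqr_ge0.
  - by rewrite lee_fin; exact: sqr_ge0.
  by rewrite -(GG' z zN).
move=> iterates Delta0 t _; rewrite unlock.
have [BO [mBO BO0 good]] : exists BO, [/\ measurable BO, P BO = 0%E &
    forall w, ~ BO w -> forall t, ~ Ng (zeta t w) /\ ~ B (xibar t w)].
  have : P.-negligible (\bigcup_t ((zeta t @^-1` Ng) `|` (xibar t @^-1` B))).
    apply: negligible_bigcup => i; apply: negligibleU; apply/negligibleP.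
    - by rewrite -[X in measurable X]setTI; exact: measurable_funP.
    - exact: (eq_trans (zeta_law i Ng mNg) Ng0).
    - by rewrite -[X in measurable X]setTI; exact: measurable_funP.
    - exact: (eq_trans (xibar_law i B mB) B0).
  move=> [BO [mBO BO0 sBO]]; exists BO; split; [exact: mBO|exact: BO0|move=> w h i].
  by split=> h'; apply: h; apply: sBO; exists i => //; [left|right].
have main := expected_gap_bound L_fx_ge0 L_fy_ge0 L_gxy_ge0 L_gyy_ge0 C_gxy_gt0 mu_g_gt0 L_g_mu_g
  mu_f_gt0 f_upper g_lower ystar_argmin ell_def ell_star_min ell_convex G'_y
  Gam_variance Gam_continuous (fun x y => (E_mean x y).1) E_continuous E_variance
  (estimator_ms_lip L_gxy_ge0 L_gyy_ge0 C_gxy_gt0 mu_g_gt0 L_g_mu_g F'_upper G'_lower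
    K_gt0 pibar_law) E_bias L_K_gt0 alpha_gt0 erefl h1 h2 h3 h4 h5 (ler0n R T)
  zeta_law xibar_law indep x0 y0 t.
apply: le_trans main.
apply: (ge0_le_integral_off_null mBO BO0) => w.
- by rewrite lee_fin subr_ge0; case: ell_star_min.
- by rewrite lee_fin subr_ge0; case: ell_star_min.
move=> Bw; rewrite lee_fin /x_at /iterates.
rewrite (@sustain_ext _ _ _ _ _ _ (fun z => grad_y (G' z)) _ est') => [|i|i].
- exact: lexx.
- by rewrite -(GG' _ (good w Bw i).1).
- exact: (estB _ (good w Bw i).2).
Qed.
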